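(* Fix a real number $\alpha \neq 0$ and a real number $\Delta > 0$. Let $\{L(s,f) : f \in \mathcal{F}\}$ be a family of $L$-functions (in the sense described in the context) with an associated symmetry group $G \in \{\mathrm{U}, \mathrm{Sp}, \mathrm{O}, \mathrm{SO(even)}, \mathrm{SO(odd)}\}$, and assume the generalized Riemann hypothesis for the $L$-functions in this family, i.e. every non-trivial zero $\rho_f=\tfrac12+i\gamma_f$ has $\gamma_f\in\mathbb R$. Suppose that $$\lim_{\mathcal{Q}\to\infty}\frac{1}{|\mathcal F(\mathcal Q)|}\sum_{f\in\mathcal F(\mathcal Q)}\sum_{\gamma_f}\phi\Big(\frac{\gamma_f\log c_f}{2\pi}\Big)=\int_{\mathbb R}\phi(x)\,W_G(x)\,\mathrm{d}x$$ holds for every even Schwartz function $\phi:\mathbb R\to\mathbb R$ with $\operatorname{supp}\widehat\phi\subseteq(-\Delta,\Delta)$. Then $$\limsup_{\mathcal Q\to\infty}\ \min_{\substack{\gamma_f\\ f\in\mathcal F(\mathcal Q)}}\Big|\frac{\gamma_f\log c_f}{2\pi}-\alpha\Big|\le\sqrt{\mathbb A(G,\pi\Delta,\alpha)}.$$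
   Context: Setting: $\mathcal F$ is a family of automorphic objects; each $f\in\mathcal F$ has an $L$-function $L(s,f)=\sum_{n\ge1}\lambda_f(n)n^{-s}$ which continues to an entire function, with completed $L$-function $\Lambda(s,f)=L_\infty(s,f)L(s,f)$ satisfying $\Lambda(s,f)=\varepsilon_f\Lambda(1-s,\bar f)$, where $|\varepsilon_f|=1$ and $L(s,\bar f)$ has coefficients $\overline{\lambda_f(n)}$. $c_f$ denotes the analytic conductor of $L(s,f)$, and the non-trivial zeros are written $\rho_f=\tfrac12+i\gamma_f$, counted with multiplicity in all sums. It is assumed that $f\in\mathcal F\Rightarrow\bar f\in\mathcal F$ and that $L_\infty(s,f)\neq0$ for all $\mathrm{Re}(s)=\tfrac12$. $\mathcal F(\mathcal Q)$ denotes either $\{f\in\mathcal F: c_f=\mathcal Q\}$ or $\{f\in\mathcal F: c_f\le\mathcal Q\}$ (depending on the family), and $\mathcal Q\to\infty$. The Fourier transform is $\widehat\phi(\xi)=\int_{\mathbb R}\phi(x)e^{-2\pi i x\xi}\,\mathrm dx$. Densities: $W_{\mathrm U}(x)=1$; $W_{\mathrm{Sp}}(x)=1-\frac{\sin2\pi x}{2\pi x}$; $W_{\mathrm O}(x)=1+\tfrac12\boldsymbol\delta_0(x)$; $W_{\mathrm{SO(even)}}(x)=1+\frac{\sin2\pi x}{2\pi x}$; $W_{\mathrm{SO(odd)}}(x)=1-\frac{\sin2\pi x}{2\pi x}+\boldsymbol\delta_0(x)$, where $\boldsymbol\delta_0$ is the Dirac delta at $0$ (so that $\int g\,W_G$ includes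 the term $\tfrac12 g(0)$, resp. $g(0)$, for $G=\mathrm O$, resp. $\mathrm{SO(odd)}$). $\mathcal H_{\pi\Delta}$ is the set of entire functions of exponential type at most $\pi\Delta$ whose restriction to $\mathbb R$ is square-integrable, and $$\mathbb A(G,\pi\Delta,\alpha):=\inf_{0\ne f\in\mathcal H_{\pi\Delta}}\frac{\int_{\mathbb R}|(x-\alpha)f(x)|^2\,W_G(x)\,\mathrm dx}{\int_{\mathbb R}|f(x)|^2\,W_G(x)\,\mathrm dx}.$$ *)

(* Defs.v *)
From HB Require Import structures.
From mathcomp Require Import all_boot all_order all_algebra.
From mathcomp Require Import finmap.
From mathcomp Require Import all_classical all_reals all_analysis.
From mathcomp Require Export complex.

Set Implicit Arguments.
Unset Strict Implicit.
Unset Printing Implicit Defensive.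

Import Order.TTheory GRing.Theory Num.Theory.
Import numFieldNormedType.Exports.

Local Open Scope classical_set_scope.
Local Open Scope ring_scope.

(* R[i] as a structure, so that the normed-module instance attached to the sort of
   every numFieldType, hence the complex derivative, is found on it. *)
Definition Cplx (R : realType) : numClosedFieldType := R[i]%C.

Section ComplexAnalysis.
Variable R : realType.
Local Notation C := (Cplx R).
Implicit Types (F : C -> C) (z s : C).

Definition cmod z : R := Normc.normc z.

Definition ofreal (x : R) : C := (x%:C)%C.

Definition cexp z : C :=
  (expR (complex.Re z) * cos (complex.Im z) +i*
   (expR (complex.Re z) * sin (complex.Im z)))%C.

(* The summand lam(n) n^{-s} is lam n * npow_opp n s, for n >= 1. *)
Definition npow_opp (n : nat) s : C := cexp (- (s * ofreal (ln n%:R))).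

Definition holomorphic_at F z := \forall w \near z, derivable F w 1.

Definition entire F := forall z, derivable F z 1.

(* g is meromorphic on the whole plane and P is its set of poles; the values
   of g on P carry no meaning. *)
Definition meromorphic_with_poles (g : C -> C) (P : set C) :=
  [/\ (forall z, \forall w \near z^', ~ P w),
      (forall z, ~ P z -> holomorphic_at g z) &
      (forall z, P z -> forall M : R, \forall w \near z^', M < cmod (g w))].

Definition exp_type_le (tau : R) F :=
  forall eps : R, 0 < eps ->
    exists A : R, forall z, cmod (F z) <= A * expR ((tau + eps) * cmod z).

(* The space H_tau of the extremal problem. *)
Definition in_H (tau : R) F :=
  [/\ entire F, exp_type_le tau F &
      (\int[lebesgue_measure]_x ((cmod (F (ofreal x)) ^+ 2)%:E) < +oo)%E].

End ComplexAnalysis.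

Section TestFunctions.
Variable R : realType.
Implicit Type phi : R -> R.

Definition schwartz phi :=
  forall k : nat,
    (forall x, derivable (derive1n k phi) x 1) /\
    (forall j : nat, exists M : R,
       forall x, `|x ^+ j * derive1n k phi x| <= M).

Definition fourier phi (xi : R) : Cplx R :=
  ((\int[lebesgue_measure]_x (phi x * cos (2 * pi * x * xi))) +i*
   (- \int[lebesgue_measure]_x (phi x * sin (2 * pi * x * xi))))%C.

Definition fourier_supp phi : set R := closure [set xi | fourier phi xi != 0].

End TestFunctions.

Inductive symgroup := SymU | SymSp | SymO | SymSOeven | SymSOodd.

Section Densities.
Variable R : realType.

Definition sinc2pi (x : R) : R :=
  if x == 0 then 1 else sin (2 * pi * x) / (2 * pi * x).

(* W_G = W_ac G + W_atom G * delta_0. *)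
Definition W_ac (G : symgroup) (x : R) : R :=
  match G with
  | SymU => 1
  | SymSp => 1 - sinc2pi x
  | SymO => 1
  | SymSOeven => 1 + sinc2pi x
  | SymSOodd => 1 - sinc2pi x
  end.

Definition W_atom (G : symgroup) : R :=
  match G with
  | SymU => 0
  | SymSp => 0
  | SymO => 2^-1
  | SymSOeven => 0
  | SymSOodd => 1
  end.

Definition integralW (G : symgroup) (g : R -> R) : \bar R :=
  (\int[lebesgue_measure]_x ((g x * W_ac G x)%:E) + (W_atom G * g 0%R)%:E)%E.

(* The quotient may be +oo (when x F(x) is not square-integrable); its
   denominator is finite, and positive for F <> 0. *)
Definition extremalA (G : symgroup) (tau alpha : R) : \bar R :=
  ereal_inf
    [set (integralW G (fun x => (cmod (ofreal (x - alpha) * F (ofreal x)) ^+ 2)%R) /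
          integralW G (fun x => (cmod (F (ofreal x)) ^+ 2)%R))%E
    | F in [set F : Cplx R -> Cplx R | in_H tau F /\ exists z, F z != 0]].

End Densities.

(* The abscissa of convergence of the Dirichlet series is left free.  Lambda is
   the entire function which agrees with L_oo * L away from the poles of L_oo.
   cond is the analytic conductor; of its definition only positivity and
   invariance under conjugation are retained. *)
Record Lfamily (R : realType) := {
  obj :> choiceType;
  dual : obj -> obj;
  lam : obj -> nat -> Cplx R;
  Lfn : obj -> Cplx R -> Cplx R;
  Linf : obj -> Cplx R -> Cplx R;
  Linf_poles : obj -> set (Cplx R);
  Lambda : obj -> Cplx R -> Cplx R;
  rootnum : obj -> Cplx R;
  cond : obj -> R;
  Lfn_entire : forall f, entire (Lfn f);
  Lfn_series : forall f, exists sigma : R,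
    forall s : Cplx R, sigma < complex.Re s ->
      (fun N : nat => \sum_(1 <= n < N.+1) lam f n * npow_opp n s) @ \oo
        --> Lfn f s;
  Linf_mero : forall f, meromorphic_with_poles (Linf f) (Linf_poles f);
  Linf_neq0 : forall f (s : Cplx R),
    complex.Re s = 2^-1 -> ~ Linf_poles f s -> Linf f s != 0;
  Lambda_entire : forall f, entire (Lambda f);
  Lambda_def : forall f (s : Cplx R),
    ~ Linf_poles f s -> Lambda f s = Linf f s * Lfn f s;
  lam_dual : forall f n, (0 < n)%N -> lam (dual f) n = (lam f n)^*;
  rootnum_norm : forall f, cmod (rootnum f) = 1;
  Lambda_fe : forall f s, Lambda f s = rootnum f * Lambda (dual f) (1 - s);
  cond_gt0 : forall f, 0 < cond f;
  cond_dual : forall f, cond (dual f) = cond f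
}.

Inductive ordering := ExactConductor | ConductorUpTo.

Section LowLyingZeros.
Variables (R : realType) (F : Lfamily R) (o : ordering).
Implicit Types (f : F) (Q gamma : R).

Definition subfamily Q : set F :=
  match o with
  | ExactConductor => [set f | cond f = Q]
  | ConductorUpTo => [set f | cond f <= Q]
  end.

(* Q -> +oo through the values for which the average over F(Q) makes sense. *)
Definition Q_to_infty : set_system R :=
  within [set Q | subfamily Q !=set0] (pinfty_nbhs R).

Definition nontrivial_zero f (rho : Cplx R) := Lambda f rho = 0.

Definition GRH :=
  forall f rho, nontrivial_zero f rho -> complex.Re rho = 2^-1.

Definition critical_pt gamma : Cplx R := (2^-1 +i* gamma)%C.

(* A zero 1/2 + i gamma of multiplicity m is listed as
   (gamma, 0), ..., (gamma, m - 1). *)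
Definition zeros_with_mult f : set (R * nat) :=
  [set p | forall j : nat, (j <= p.2)%N ->
     derive1n j (Lambda f) (critical_pt p.1) = 0].

Definition normalized f gamma : R := gamma * ln (cond f) / (2 * pi).

(* The sum of phi over the zeros of f, as the sum of the positive terms minus
   the sum of the negative ones.  Both are finite as soon as the zeros have
   polynomial growth, as those of an automorphic L-function do. *)
Definition zero_sum f (phi : R -> R) : \bar R :=
  let g (p : R * nat) := (phi (normalized f p.1))%:E in
  (\esum_(p in zeros_with_mult f) (g^\+ p) -
   \esum_(p in zeros_with_mult f) (g^\- p))%E.

Definition zero_average (phi : R -> R) Q : \bar R :=
  ((#|` fset_set (subfamily Q)|%:R^-1)%:E *
   \sum_(f \in subfamily Q) zero_sum f phi)%E.

Definition min_zero_dist (alpha : R) Q : \bar R :=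
  ereal_inf [set d | exists f gamma,
    [/\ subfamily Q f, nontrivial_zero f (critical_pt gamma) &
        d = (`|normalized f gamma - alpha|)%:E]].

End LowLyingZeros.

Arguments subfamily {R} F o Q.
Arguments Q_to_infty {R} F o.
Arguments zero_average {R} F o phi Q.
Arguments min_zero_dist {R} F o alpha Q.

(* Main.v *)
(* If the limsup exceeds sqrt A, choose m strictly in between and F in H_{pi Delta}
   whose quotient is below m^2.  Put P = |F|^2 on the real line, and let phi be the
   even part of Theta(x) = ((x - alpha)^2 - m^2) P(lambda x) g(eps x)^2, where
   lambda < 1 is close to 1 and g is a rapidly decreasing band-limited function with
   g(0) = 1.  Then phi is an even Schwartz function of exponential type less than
   2 pi Delta, so its Fourier transform is supported inside (-Delta, Delta), and its
   integral against W_G is negative when lambda is close enough to 1 and eps to 0,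
   because the integrals converge to those of the quotient.  By the density hypothesis
   the averages over zeros are eventually negative.  But the functional equation makes
   the normalized zeros of f and of its dual opposite, so if no normalized zero of the
   subfamily were within m of alpha, none would be within m of -alpha either; phi would
   then be nonnegative at all of them.

   Exponential type is handled on the real line through bounds
   |h^(n)(x)| <= A rho^n e^{rho |x|}, which for |F|^2 come from the Taylor coefficients
   of F.  That a function h of type rho has no Fourier mass at t > rho is proved by
   rotating the Laplace integral of h(x) cos(t x) to the imaginary axis: two
   integrations by parts identify the two integrals when the Laplace parameter s is
   larger than rho, analytic continuation in s extends this to s > 0, and s -> 0. *)
Require Import Defs.
From HB Require Import structures.
From mathcomp Require Import all_boot all_order all_algebra.
From mathcomp Require Import all_classical all_reals all_analysis.
From mathcomp Require Import measurable_realfun.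
From mathcomp Require Import ring lra zify.
Import Order.TTheory GRing.Theory Num.Theory.
Import numFieldNormedType.Exports.
Local Open Scope classical_set_scope.
Local Open Scope ring_scope.

Set Implicit Arguments.
Unset Strict Implicit.
Unset Printing Implicit Defensive.

(** * The complex modulus *)

(** [F] is only square-integrable on the line, so (x - alpha)^2 |F|^2 is far from Schwartz; the
    dilation is what makes room for a multiplier. Shrinking the variable by 1 - d frees type 2 tau
    d, which pays for two factors [g], for the quadratic polynomial (a polynomial has arbitrarily
    small type) and for the loss in passing from type tau to derivative bounds with some rho > tau.
    Pointwise control is needed twice: for the growth of |F|^2 and for the decay of the derivatives
    of the test function. Both come from one Bernstein-type inequality, which bounds h'(x) by the
    supremum of |h| near x up to an error of order exp (- |x|). Applied to a bounded primitive of
    |F|^2 it gives linear growth; iterated on a rapidly decreasing h it makes h Schwartz. The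
    densities of Sp and SO(odd) vanish at 0, so a weighted integral controls the unweighted one only
    for |x| >= 1; near 0 the integrability of |F|^2 itself takes over. *)

Section ComplexModulus.
Variable R : realType.
Local Notation C := (Cplx R).
Implicit Types z w h : C.

Lemma cmodE z : cmod z = Num.sqrt (complex.Re z ^+ 2 + complex.Im z ^+ 2).
Proof. by case: z. Qed.

Lemma cmodD z w : cmod (z + w) <= cmod z + cmod w.
Proof. exact: (@le_normcD R z w). Qed.

Lemma cmodM z w : cmod (z * w) = cmod z * cmod w.
Proof. exact: Normc.normcM. Qed.

Lemma cmodN z : cmod (- z) = cmod z.
Proof. exact: (@normcN R z). Qed.

Lemma cmodV z : cmod z^-1 = (cmod z)^-1.
Proof. exact: Normc.normcV. Qed.

Lemma cmod0 : cmod (0 : C) = 0.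
Proof. exact: Normc.normc0. Qed.

Lemma cmod1 : cmod (1 : C) = 1.
Proof. exact: Normc.normc1. Qed.

Lemma cmod_ge0 z : 0 <= cmod z.
Proof. by rewrite cmodE sqrtr_ge0. Qed.

Lemma cmod_eq0 z : (cmod z == 0) = (z == 0).
Proof.
apply/eqP/eqP => [|->]; last exact: cmod0.
exact: Normc.eq0_normc.
Qed.

Lemma cmod_gt0 z : (0 < cmod z) = (z != 0).
Proof. by rewrite lt0r cmod_eq0 cmod_ge0 andbT. Qed.

Lemma cmodX z n : cmod (z ^+ n) = cmod z ^+ n.
Proof.
elim: n => [|n IH]; first by rewrite !expr0 cmod1.
by rewrite !exprS cmodM IH.
Qed.

Lemma cmod_ofreal (x : R) : cmod (ofreal x) = `|x|.
Proof. by rewrite cmodE /= expr0n /= addr0 sqrtr_sqr. Qed.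

Lemma normr_Re_cmod z : `|complex.Re z| <= cmod z.
Proof.
rewrite cmodE -sqrtr_sqr ler_sqrt ?addr_ge0 ?sqr_ge0//.
by rewrite lerDl sqr_ge0.
Qed.

Lemma normr_Im_cmod z : `|complex.Im z| <= cmod z.
Proof.
rewrite cmodE -sqrtr_sqr ler_sqrt ?addr_ge0 ?sqr_ge0//.
by rewrite lerDr sqr_ge0.
Qed.

Lemma cmod_sqr z : cmod z ^+ 2 = complex.Re z ^+ 2 + complex.Im z ^+ 2.
Proof. by rewrite cmodE sqr_sqrtr// addr_ge0 ?sqr_ge0. Qed.

Lemma cmod_le_ReIm z : cmod z <= `|complex.Re z| + `|complex.Im z|.
Proof.
rewrite -(@ler_pXn2r _ 2) ?nnegrE ?addr_ge0 ?cmod_ge0//.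
rewrite cmod_sqr sqrrD !real_normK ?num_real// lerD2r lerDl.
by rewrite mulrn_wge0// mulr_ge0.
Qed.

Lemma cRe_D z w : complex.Re (z + w) = complex.Re z + complex.Re w.
Proof. by case: z; case: w. Qed.

Lemma cIm_D z w : complex.Im (z + w) = complex.Im z + complex.Im w.
Proof. by case: z; case: w. Qed.

Lemma cRe_N z : complex.Re (- z) = - complex.Re z.
Proof. by case: z. Qed.

Lemma cIm_N z : complex.Im (- z) = - complex.Im z.
Proof. by case: z. Qed.

Lemma cRe_M z w :
  complex.Re (z * w) = complex.Re z * complex.Re w - complex.Im z * complex.Im w.
Proof. by case: z; case: w. Qed.

Lemma cIm_M z w :
  complex.Im (z * w) = complex.Re z * complex.Im w + complex.Im z * complex.Re w.
Proof. by case: z; case: w. Qed.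

Lemma eq_ReIm z w :
  complex.Re z = complex.Re w -> complex.Im z = complex.Im w -> z = w.
Proof. by case: z => a b; case: w => c d /= -> ->. Qed.

Definition cdiff (K : C -> C) z := exists L : C, forall eps : R, 0 < eps ->
  exists2 delta : R, 0 < delta & forall h, cmod h < delta ->
    cmod (K (z + h) - K z - L * h) <= eps * cmod h.

Definition ccont (K : C -> C) := forall z (eps : R), 0 < eps ->
  exists2 delta : R, 0 < delta & forall h, cmod h < delta ->
    cmod (K (z + h) - K z) <= eps.

Lemma normC_cmod z : `|z| = (cmod z)%:C%C.
Proof. by []. Qed.

Lemma derivable_cdiff (K : C -> C) z : derivable K z 1 -> cdiff K z.
Proof.
move=> /cvg_ex[/= L].
move=> /(@cvgrPdist_le C C C _ _ (fun h => h^-1 *: (K (h%:A + z) - K z)) L) HL.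
exists L => eps e0.
have e0' : (0 : C) < eps%:C%C by rewrite -[0]/(0%:C)%C ltcR.
have := HL _ e0'; rewrite near_withinE => /nbhs_ballP[/= d d0 Hd].
(* A positive element of [Cplx R] is real; this turns the complex radius of the ball into a real
   one. *)
have dE : d = (complex.Re d)%:C%C.
  by move: d0; rewrite ltcE /= => /andP[/eqP Hi _]; apply: eq_ReIm.
have rd0 : 0 < complex.Re d by move: d0; rewrite ltcE /= => /andP[].
exists (complex.Re d) => // h hd.
have [->|h0] := eqVneq h 0.
  by rewrite addr0 subrr mulr0 subr0 cmod0 mulr0.
have := Hd h; rewrite /ball /= sub0r normrN normC_cmod dE ltcR => /(_ hd h0).
rewrite normC_cmod lecR => H.
rewrite -[X in X <= _](_ : cmod (L - h^-1 *: (K (h *: 1 + z) - K z)) * cmod h = _).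
  by rewrite ler_wpM2r// cmod_ge0.
rewrite -cmodM mulrBl -cmodN opprB; congr cmod.
by rewrite /GRing.scale /= mulr1 mulrAC mulVf// mul1r (addrC h).
Qed.

Lemma cdiff_cont_at (K : C -> C) z : cdiff K z -> forall eps : R, 0 < eps ->
  exists2 delta : R, 0 < delta & forall h, cmod h < delta ->
    cmod (K (z + h) - K z) <= eps.
Proof.
move=> [L HL] eps e0.
have [d d0 Hd] := HL _ (@ltr01 R).
have p0 : 0 < 1 + cmod L by rewrite ltr_pwDl// cmod_ge0.
exists (Num.min d (eps / (1 + cmod L))); first by rewrite lt_min d0 divr_gt0.
move=> h; rewrite lt_min => /andP[hd he].
rewrite -[K (z + h) - K z](subrK (L * h)) (le_trans (cmodD _ _))//.
rewrite cmodM (le_trans (lerD (Hd _ hd) (lexx _)))// -mulrDl.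
by rewrite mulrC -ler_pdivlMr// ltW.
Qed.

End ComplexModulus.

(** * Cauchy theorem for rectangles *)

Section SegmentIntegral.
Variable R : realType.
Local Notation mu := (@lebesgue_measure R).
Local Notation C := (Cplx R).
Implicit Types (f g : R -> R) (a b c : R).

Lemma continuous_integrable_cc f a b :
  continuous f -> mu.-integrable `[a, b] (EFin \o f).
Proof.
move=> cf; apply: continuous_compact_integrable; first exact: segment_compact.
exact: continuous_subspaceT.
Qed.

Lemma Rintegral_cst_cc (k a b : R) : a <= b ->
  \int[mu]_(x in `[a, b]) k = k * (b - a).
Proof.
move=> ab; rewrite Rintegral_cst//= lebesgue_measure_itv/= lte_fin.
by case: ltgtP ab => // -> _; rewrite subrr.
Qed.

Lemma normr_Rintegral_le_cc f a b (M : R) : continuous f -> a <= b ->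
  (forall x, a <= x <= b -> `|f x| <= M) ->
  `|\int[mu]_(x in `[a, b]) f x| <= M * (b - a).
Proof.
move=> cf ab fM; have itf := continuous_integrable_cc a b cf.
rewrite (le_trans (le_normr_Rintegral _ _))//.
rewrite -Rintegral_cst_cc//; apply: le_Rintegral => //.
- exact: (integrable_norm itf).
- by apply: continuous_integrable_cc => x; exact: cst_continuous.
Qed.

Lemma Rintegral_cat_cc f a b c : continuous f -> a <= b -> b <= c ->
  \int[mu]_(x in `[a, c]) f x =
  \int[mu]_(x in `[a, b]) f x + \int[mu]_(x in `[b, c]) f x.
Proof.
move=> cf ab bc; have itf := continuous_integrable_cc a c cf.
have := @Rintegral_itvB R f (BLeft a) (BRight c) b itf.
rewrite !bnd_simp => /(_ ab bc) H.
have <- : \int[mu]_(x in `]b, c]) f x = \int[mu]_(x in `[b, c]) f x.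
  apply: Rintegral_itv_obnd_cbnd; apply: integrableS itf => //.
  by apply: subset_itvr; rewrite bnd_simp.
by rewrite -H addrC subrK.
Qed.

Lemma Rintegral_id_cc a b : a <= b ->
  \int[mu]_(x in `[a, b]) x = (b ^+ 2 - a ^+ 2) / 2.
Proof.
rewrite le_eqVlt => /predU1P[->|ab].
  by rewrite set_itv1 Rintegral_set1 subrr mul0r.
have d (x : R) : is_derive x 1 (fun y : R => y ^+ 2 / 2) x.
  apply: is_derive_eq.
  by rewrite /GRing.scale /=; field.
have cF : continuous (fun y : R => y ^+ 2 / 2).
  by move=> x; apply/differentiable_continuous/derivable1_diffP; apply: ex_derive.
rewrite /Rintegral (@continuous_FTC2 _ id (fun x => x ^+ 2 / 2))//.
- by rewrite /= mulrBl.
- by apply: continuous_subspaceT => x; exact: cvg_id.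
- by split; [move=> x _; exact: ex_derive|apply: cvg_at_right_filter; exact: cF|apply: cvg_at_left_filter; exact: cF].
- by move=> x _; rewrite derive1E derive_val.
Qed.

Definition lcont (f : R -> C) :=
  continuous (fun x => complex.Re (f x)) /\ continuous (fun x => complex.Im (f x)).

Definition intc (f : R -> C) a b : C :=
  (\int[mu]_(x in `[a, b]) complex.Re (f x) +i*
   \int[mu]_(x in `[a, b]) complex.Im (f x))%C.

Lemma continuous_lincomb f g (r s : R) : continuous f -> continuous g ->
  continuous (fun x => r * f x + s * g x).
Proof.
by move=> cf cg x; apply: cvgD; apply: cvgM; [exact: cvg_cst|exact: cf|exact: cvg_cst|exact: cg].
Qed.

Lemma lcontD (f g : R -> C) : lcont f -> lcont g -> lcont (fun x => f x + g x).
Proof.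
move=> [f1 f2] [g1 g2]; split.
- under eq_fun do rewrite cRe_D.
  by move=> x; apply: cvgD; [exact: f1|exact: g1].
- under eq_fun do rewrite cIm_D.
  by move=> x; apply: cvgD; [exact: f2|exact: g2].
Qed.

Lemma lcontZ (k : C) (f : R -> C) : lcont f -> lcont (fun x => k * f x).
Proof.
move=> [f1 f2]; split.
- under eq_fun do rewrite cRe_M -mulNr.
  exact: continuous_lincomb.
- under eq_fun do rewrite cIm_M.
  exact: continuous_lincomb.
Qed.

Lemma lcont_cst (k : C) : lcont (fun=> k).
Proof. by split => x; exact: cst_continuous. Qed.

Lemma lcont_ofreal : lcont (@ofreal R).
Proof. by split => x; [exact: cvg_id|exact: cst_continuous]. Qed.

Lemma intcD (f g : R -> C) a b : lcont f -> lcont g ->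
  intc (fun x => f x + g x) a b = intc f a b + intc g a b.
Proof.
move=> [f1 f2] [g1 g2]; apply: eq_ReIm => /=.
- under eq_Rintegral do rewrite cRe_D.
  by rewrite RintegralD//; exact: continuous_integrable_cc.
- under eq_Rintegral do rewrite cIm_D.
  by rewrite RintegralD//; exact: continuous_integrable_cc.
Qed.

Lemma intcZ (k : C) (f : R -> C) a b : lcont f ->
  intc (fun x => k * f x) a b = k * intc f a b.
Proof.
move=> [f1 f2].
have i1 := continuous_integrable_cc a b f1.
have i2 := continuous_integrable_cc a b f2.
have s r (h : R -> R) : continuous h -> mu.-integrable `[a, b] (EFin \o (fun x => r * h x)).
  move=> ch; apply: continuous_integrable_cc => x.
  by apply: cvgM; [exact: cvg_cst|exact: ch].
apply: eq_ReIm; rewrite ?cRe_M ?cIm_M /=.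
- under eq_Rintegral do rewrite cRe_M.
  by rewrite RintegralB// ?RintegralZl//; exact: s.
- under eq_Rintegral do rewrite cIm_M.
  by rewrite RintegralD// ?RintegralZl//; exact: s.
Qed.

Lemma intc_cat (f : R -> C) a b c : lcont f -> a <= b -> b <= c ->
  intc f a c = intc f a b + intc f b c.
Proof.
by move=> [f1 f2] ab bc; apply: eq_ReIm; rewrite ?cRe_D ?cIm_D /=;
  exact: Rintegral_cat_cc.
Qed.

Lemma eq_intc (f g : R -> C) a b : (forall x, a <= x <= b -> f x = g x) ->
  intc f a b = intc g a b.
Proof.
move=> fg; rewrite /intc.
by congr Complex; apply: eq_Rintegral => x; rewrite inE/= in_itv/= => /fg ->.
Qed.

(** The factor 2 comes from bounding the real and imaginary integrals separately; it reappears in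
    the Cauchy estimates, where constants are immaterial. *)
Lemma cmod_intc_le (f : R -> C) a b (M : R) : lcont f -> a <= b ->
  (forall x, a <= x <= b -> cmod (f x) <= M) ->
  cmod (intc f a b) <= 2 * M * (b - a).
Proof.
move=> [f1 f2] ab fM; rewrite (le_trans (cmod_le_ReIm _))//=.
have -> : 2 * M * (b - a) = M * (b - a) + M * (b - a) by ring.
rewrite lerD//; rewrite normr_Rintegral_le_cc// => x /fM;
  by [exact: (le_trans (normr_Re_cmod _))|exact: (le_trans (normr_Im_cmod _))].
Qed.

Lemma intc_affine (A B : C) a b : a <= b ->
  intc (fun x => A + B * ofreal x) a b =
  A * ofreal (b - a) + B * ofreal ((b ^+ 2 - a ^+ 2) / 2).
Proof.
move=> ab; rewrite intcD; [|exact: lcont_cst|exact/lcontZ/lcont_ofreal].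
rewrite intcZ; last exact: lcont_ofreal.
congr (_ + _ * _).
  rewrite -[A in intc (fun=> A)]mulr1 (@intcZ A (fun=> 1)); last exact: lcont_cst.
  congr (_ * _); apply: eq_ReIm => /=.
    by rewrite Rintegral_cst_cc// mul1r.
  by rewrite Rintegral_cst_cc// mul0r.
by apply: eq_ReIm => /=; rewrite ?Rintegral_id_cc// Rintegral_cst_cc// mul0r.
Qed.

End SegmentIntegral.

(** * Goursat's bisection argument *)

Section Goursat.
Variable R : realType.
Local Notation C := (Cplx R).
Implicit Types (K : C -> C) (x y p q : R).

Let ii : C := 'i%C.

Definition line_cont K :=
  (forall y, lcont (fun t => K (t +i* y)%C)) /\ (forall x, lcont (fun t => K (x +i* t)%C)).

Lemma ccont_line K : ccont K -> line_cont K.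
Proof.
move=> cK.
have key (l : R -> C) : (forall t s, cmod (l s - l t) = `|s - t|) -> lcont (fun t => K (l t)).
  move=> lE; split => t; apply/cvgrPdist_le => e e0;
    have [d d0 Hd] := cK (l t) _ e0; near=> s.
  - rewrite distrC -cRe_N -cRe_D (le_trans (normr_Re_cmod _))//.
    rewrite -[l s](subrKC (l t)) Hd// lE distrC.
    by near: s; exact: cvgr_dist_lt.
  - rewrite distrC -cIm_N -cIm_D (le_trans (normr_Im_cmod _))//.
    rewrite -[l s](subrKC (l t)) Hd// lE distrC.
    by near: s; exact: cvgr_dist_lt.
split => [y|x]; apply: key => t s; rewrite cmodE /= subrr expr0n /= ?addr0 ?add0r;
  exact: sqrtr_sqr.
Unshelve. all: by end_near. Qed.

Lemma line_contD K1 K2 : line_cont K1 -> line_cont K2 ->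
  line_cont (fun u => K1 u + K2 u).
Proof. by move=> [a b] [c d]; split => t; exact: lcontD. Qed.

Lemma complex_split x y : (x +i* y)%C = ofreal x + ii * ofreal y :> C.
Proof. by rewrite [LHS]complexE. Qed.

Lemma line_cont_affine (A B : C) : line_cont (fun u => A + B * u).
Proof.
split => t; under [X in lcont X]eq_fun do rewrite complex_split mulrDr.
- under [X in lcont X]eq_fun do rewrite addrCA addrC.
  apply: lcontD; first exact: lcont_cst.
  exact/lcontZ/lcont_ofreal.
- under [X in lcont X]eq_fun do rewrite addrA mulrA.
  apply: lcontD; first exact: lcont_cst.
  exact/lcontZ/lcont_ofreal.
Qed.

Definition hline K x p y := intc (fun t => K (t +i* y)%C) x (x + p).
Definition vline K x y q := intc (fun t => K (x +i* t)%C) y (y + q).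

(** The contour integral of K dz, counterclockwise; [ii] is dz/dt on the vertical sides. Storing a
    corner and the side lengths makes bisection a change of parameters. *)
Definition rect_int K x y p q :=
  hline K x p y + ii * vline K (x + p) y q - hline K x p (y + q) - ii * vline K x y q.

Lemma rect_intD K1 K2 x y p q : line_cont K1 -> line_cont K2 ->
  rect_int (fun u => K1 u + K2 u) x y p q = rect_int K1 x y p q + rect_int K2 x y p q.
Proof.
by move=> [a b] [c d]; rewrite /rect_int /hline /vline !intcD//; ring.
Qed.

Lemma rect_int_affine (A B : C) x y p q : 0 <= p -> 0 <= q ->
  rect_int (fun u => A + B * u) x y p q = 0.
Proof.
move=> p0 q0.
have hE z : hline (fun u => A + B * u) x p z =
    (A + B * (ii * ofreal z)) * ofreal p + B * ofreal (((x + p) ^+ 2 - x ^+ 2) / 2).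
  rewrite /hline (@eq_intc _ _ (fun t => (A + B * (ii * ofreal z)) + B * ofreal t)).
    by rewrite intc_affine ?lerDl// addrAC subrr add0r.
  by move=> t _; rewrite complex_split; ring.
have vE z : vline (fun u => A + B * u) z y q =
    (A + B * ofreal z) * ofreal q + B * ii * ofreal (((y + q) ^+ 2 - y ^+ 2) / 2).
  rewrite /vline (@eq_intc _ _ (fun t => (A + B * ofreal z) + (B * ii) * ofreal t)).
    by rewrite intc_affine ?lerDl// addrAC subrr add0r.
  by move=> t _; rewrite complex_split; ring.
have oD r s : ofreal (r + s) = ofreal r + ofreal s :> C by exact: rmorphD.
rewrite /rect_int !hE !vE !oD; ring.
Qed.

Lemma rect_int_split K x y p q : line_cont K -> 0 <= p -> 0 <= q ->
  rect_int K x y p q =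
  (rect_int K x y (p / 2) (q / 2) + rect_int K (x + p / 2) y (p / 2) (q / 2)) +
  (rect_int K x (y + q / 2) (p / 2) (q / 2) +
   rect_int K (x + p / 2) (y + q / 2) (p / 2) (q / 2)).
Proof.
move=> [cK1 cK2] p0 q0.
have hs z : hline K x p z = hline K x (p / 2) z + hline K (x + p / 2) (p / 2) z.
  rewrite /hline -addrA -splitr; apply: intc_cat => //; rewrite ?lerDl ?lerD2l; lra.
have vs z : vline K z y q = vline K z y (q / 2) + vline K z (y + q / 2) (q / 2).
  rewrite /vline -addrA -splitr; apply: intc_cat => //; rewrite ?lerDl ?lerD2l; lra.
rewrite /rect_int !hs !vs.
have -> : x + p / 2 + p / 2 = x + p by rewrite -addrA -splitr.
have -> : y + q / 2 + q / 2 = y + q by rewrite -addrA -splitr.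
ring.
Qed.

Lemma rect_int_quarter K x y p q (c : R) : line_cont K -> 0 <= p -> 0 <= q ->
  c < cmod (rect_int K x y p q) ->
  exists s : R * R, [/\ s.1 = x \/ s.1 = x + p / 2, s.2 = y \/ s.2 = y + q / 2 &
    c / 4 < cmod (rect_int K s.1 s.2 (p / 2) (q / 2))].
Proof.
move=> cK p0 q0; rewrite rect_int_split// => H.
apply: contrapT => N.
have le s : (s.1 = x \/ s.1 = x + p / 2) -> (s.2 = y \/ s.2 = y + q / 2) ->
    cmod (rect_int K s.1 s.2 (p / 2) (q / 2)) <= c / 4.
  by move=> h1 h2; rewrite leNgt; apply/negP => h3; apply: N; exists s.
have h1 := le (x, y) (or_introl erefl) (or_introl erefl).
have h2 := le (x + p / 2, y) (or_intror erefl) (or_introl erefl).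
have h3 := le (x, y + q / 2) (or_introl erefl) (or_intror erefl).
have h4 := le (x + p / 2, y + q / 2) (or_intror erefl) (or_intror erefl).
move: H; rewrite ltNge => /negP; apply.
rewrite (le_trans (cmodD _ _))//.
rewrite (le_trans (lerD (cmodD _ _) (cmodD _ _)))//.
rewrite (le_trans (lerD (lerD h1 h2) (lerD h3 h4)))//; lra.
Qed.

(** [u] lists the left endpoints of intervals obtained by repeated bisection; their supremum is the
    common point. Applied to each coordinate, this gives the limit point of the nested
    rectangles. *)
Lemma nested_halving (u : nat -> R) p : 0 <= p ->
  (forall n, u n.+1 = u n \/ u n.+1 = u n + p / 2 ^+ n / 2) ->
  exists l, forall n, u n <= l <= u n + p / 2 ^+ n.
Proof.
move=> p0 Hu.
have h n : 0 <= p / 2 ^+ n by rewrite divr_ge0.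
have hS n : p / 2 ^+ n.+1 = p / 2 ^+ n / 2 by rewrite exprSr invfM mulrA.
have inc n m : u n <= u (n + m)%N.
  elim: m => [|m IH]; first by rewrite addn0.
  rewrite addnS (le_trans IH)//; have := h (n + m)%N.
  case: (Hu (n + m)%N) => ->; lra.
have dec n m : u (n + m)%N + p / 2 ^+ (n + m) <= u n + p / 2 ^+ n.
  elim: m => [|m IH]; first by rewrite addn0.
  rewrite addnS hS (le_trans _ IH)//; have := h (n + m)%N.
  case: (Hu (n + m)%N) => ->; lra.
have bnd n m : u m <= u n + p / 2 ^+ n.
  rewrite (le_trans (inc m n))// addnC (le_trans _ (dec n m))//.
  by rewrite lerDl.
have ne : has_sup (range u).
  by split; [exists (u 0%N), 0%N|exists (u 0%N + p / 2 ^+ 0) => _ [m _ <-]].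
exists (sup (range u)) => n; apply/andP; split.
  by apply: ub_le_sup; [case: ne|exists n].
by apply: ge_sup => [|_ [m _ <-]//]; case: ne.
Qed.

Lemma half_expn_small (c d : R) : 0 < d -> exists n, c / 2 ^+ n < d.
Proof.
move=> d0; have h : (fun n => c * (2^-1 : R) ^+ n) @ \oo --> (c * 0 : R).
  apply: cvgM; first exact: cvg_cst.
  by apply: cvg_expr; rewrite ger0_norm ?invr_ge0//; lra.
rewrite mulr0 in h.
have /cvgrPdist_lt/(_ _ d0)[N _ /(_ N (leqnn N))] := h.
rewrite /= sub0r normrN exprVn => H; exists N.
exact: le_lt_trans (ler_norm _) H.
Qed.

(** Bisect, keep a quarter carrying its share of the integral, and contradict differentiability at
    the limit point. Continuity is asked everywhere but differentiability only on the rectangle,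
    because the difference quotient integrated later is known to be merely continuous at one
    point. *)
Theorem goursat_rect K x y p q : ccont K -> 0 <= p -> 0 <= q ->
  (forall z, x <= complex.Re z <= x + p -> y <= complex.Im z <= y + q -> cdiff K z) ->
  rect_int K x y p q = 0.
Proof.
move=> cK p0 q0 dK; have lK := ccont_line cK.
apply/eqP; rewrite -cmod_eq0; apply/eqP/le_anti; rewrite cmod_ge0 andbT.
rewrite leNgt; apply/negP => c0.
(* Half the modulus, so that the inequality propagated through the bisection is strict. *)
pose c := cmod (rect_int K x y p q) / 2.
have cc : c < cmod (rect_int K x y p q) by rewrite /c; lra.
have {}c0 : 0 < c by rewrite /c; lra.
have h2 n : 0 <= p / 2 ^+ n by rewrite divr_ge0.
have h3 n : 0 <= q / 2 ^+ n by rewrite divr_ge0.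
pose bad n (s : R * R) :=
  c / 4 ^+ n < cmod (rect_int K s.1 s.2 (p / 2 ^+ n) (q / 2 ^+ n)).
have : forall ns : nat * (R * R), exists s', bad ns.1 ns.2 ->
    [/\ s'.1 = ns.2.1 \/ s'.1 = ns.2.1 + p / 2 ^+ ns.1 / 2,
        s'.2 = ns.2.2 \/ s'.2 = ns.2.2 + q / 2 ^+ ns.1 / 2 & bad ns.1.+1 s'].
  move=> [n s] /=; have [bs|nb] := pselect (bad n s); last by exists s.
  have [s' [H1 H2 H3]] := rect_int_quarter lK (h2 n) (h3 n) bs.
  exists s' => _; split => //; rewrite /bad !exprSr !invfM !mulrA //.
move=> /choice[nxt Hn].
pose s := fix s n := if n is m.+1 then nxt (m, s m) else (x, y).
have sb n : bad n (s n).
  elim: n => [|n IH]; first by rewrite /bad /= !expr0 !divr1.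
  by have [] := Hn (n, s n) IH.
have [|l1 Hl1] := @nested_halving (fun n => (s n).1) p p0.
  by move=> n; have [] := Hn (n, s n) (sb n).
have [|l2 Hl2] := @nested_halving (fun n => (s n).2) q q0.
  by move=> n; have [] := Hn (n, s n) (sb n).
pose z : C := (l1 +i* l2)%C.
have [L HL] : cdiff K z.
  apply: dK; [have := Hl1 0%N|have := Hl2 0%N]; by rewrite /= expr0 divr1.
have pq0 : 0 < 4 * (p + q) ^+ 2 + 1.
  by rewrite ltr_wpDl// mulr_ge0// sqr_ge0.
(* On the n-th rectangle the remainder integrates to at most 4 e (p + q)^2 / 4^n; this choice keeps
   it within c / 4^n, and the + 1 covers p = q = 0. *)
have e0 : 0 < c / (4 * (p + q) ^+ 2 + 1) by rewrite divr_gt0.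
have [d d0 Hd] := HL _ e0.
set e := c / _ in e0 Hd.
have [n Hnn] := half_expn_small (p + q) d0.
have := sb n; rewrite /bad ltNge => /negP; apply.
set X := (s n).1; set Y := (s n).2; set P := p / _; set Q := q / _.
have PQ : P + Q < d by rewrite /P /Q -mulrDl.
have P0 : 0 <= P by exact: h2.
have Q0 : 0 <= Q by exact: h3.
have KE : K = fun u => ((K z - L * z) + L * u) + (K u - K z - L * (u - z)).
  by apply/funext => u; ring.
(* Affine functions integrate to 0, so only the remainder of the first-order expansion at the limit
   point contributes. *)
pose Ra u := K u - K z - L * (u - z).
have lR : line_cont Ra.
  have -> : Ra = fun u => (- (K z) + L * z + (- L) * u) + K u.
    by apply/funext => u; rewrite /Ra; ring.
  by apply: line_contD => //; exact: line_cont_affine.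
rewrite [in leLHS]KE rect_intD//; last exact: line_cont_affine.
rewrite rect_int_affine// add0r.
have RB t r : X <= t <= X + P -> Y <= r <= Y + Q -> cmod (Ra (t +i* r)%C) <= e * (P + Q).
  move=> /andP[t1 t2] /andP[r1 r2].
  have hb : cmod ((t +i* r)%C - z : C) <= P + Q.
    rewrite (le_trans (cmod_le_ReIm _))//= lerD// ler_norml.
    - have := Hl1 n; rewrite -/X -/P => /andP[? ?]; apply/andP; split; lra.
    - have := Hl2 n; rewrite -/Y -/Q => /andP[? ?]; apply/andP; split; lra.
  have := Hd ((t +i* r)%C - z); rewrite subrKC => /(_ (le_lt_trans hb PQ)) H.
  by rewrite /Ra (le_trans H)// ler_wpM2l// ltW.
have XP : X <= X <= X + P by rewrite lexx lerDl.
have XP' : X <= X + P <= X + P by rewrite lexx lerDl P0.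
have YQ : Y <= Y <= Y + Q by rewrite lexx lerDl.
have YQ' : Y <= Y + Q <= Y + Q by rewrite lexx lerDl Q0.
have ci : cmod ii = 1 by rewrite cmodE /= expr0n expr1n add0r sqrtr1.
have B1 r : Y <= r <= Y + Q -> cmod (hline Ra X P r) <= 2 * (e * (P + Q)) * P.
  move=> hr; have XX : X <= X + P by rewrite lerDl.
  have := cmod_intc_le (lR.1 r) XX (fun t ht => RB t r ht hr).
  by rewrite (addrAC X) subrr add0r.
have B2 t : X <= t <= X + P -> cmod (vline Ra t Y Q) <= 2 * (e * (P + Q)) * Q.
  move=> ht; have YY : Y <= Y + Q by rewrite lerDl.
  have := cmod_intc_le (lR.2 t) YY (fun r hr => RB t r ht hr).
  by rewrite (addrAC Y) subrr add0r.
have : cmod (rect_int Ra X Y P Q) <= 4 * e * (P + Q) ^+ 2.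
  rewrite /rect_int (le_trans (cmodD _ _))// (le_trans (lerD (cmodD _ _) (lexx _)))//.
  rewrite (le_trans (lerD (lerD (cmodD _ _) (lexx _)) (lexx _)))//.
  rewrite !cmodN !cmodM ci !mul1r.
  rewrite (le_trans (lerD (lerD (lerD (B1 _ YQ) (B2 _ XP')) (B1 _ YQ')) (B2 _ XP)))//.
  rewrite le_eqVlt; apply/orP; left; apply/eqP; ring.
move=> /le_trans; apply.
have -> : (P + Q) ^+ 2 = (p + q) ^+ 2 / 4 ^+ n.
  rewrite /P /Q -mulrDl exprMn exprVn -exprM mulnC exprM.
  by congr (_ / _ ^+ _); ring.
rewrite mulrA ler_wpM2r ?invr_ge0 ?exprn_ge0//.
rewrite (_ : 4 * e * _ = c * (4 * (p + q) ^+ 2 / (4 * (p + q) ^+ 2 + 1))).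
  apply: ler_piMr; first exact: ltW.
  by rewrite ler_pdivrMr// mul1r lerDl.
by rewrite /e; ring.
Qed.

End Goursat.

(** * Calculus of complex differentiable functions and the complex exponential *)

Section ComplexDifferentiability.
Variable R : realType.
Local Notation C := (Cplx R).
Implicit Types (K F : C -> C) (z w u h : C).

Definition ccont_at K z := forall eps : R, 0 < eps ->
  exists2 delta : R, 0 < delta & forall h, cmod h < delta ->
    cmod (K (z + h) - K z) <= eps.

Lemma ccont_at_bounded K z : ccont_at K z ->
  exists2 delta : R, 0 < delta & forall h, cmod h < delta ->
    cmod (K (z + h)) <= cmod (K z) + 1.
Proof.
move=> /(_ _ ltr01)[d d0 Hd]; exists d => // h /Hd H.
by rewrite -[K (z + h)](subrK (K z)) (le_trans (cmodD _ _))// addrC lerD2l.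
Qed.

Lemma ccont_atM K1 K2 z : ccont_at K1 z -> ccont_at K2 z ->
  ccont_at (fun u => K1 u * K2 u) z.
Proof.
move=> c1 c2 e e0.
have [d1 d10 H1] := ccont_at_bounded c1.
pose M := cmod (K1 z) + 1 + cmod (K2 z) + 1.
have M0 : 0 < M by rewrite /M; have := cmod_ge0 (K1 z); have := cmod_ge0 (K2 z); lra.
have e20 : 0 < e / (2 * M) by rewrite divr_gt0// mulr_gt0.
have [d2 d20 H2] := c1 _ e20.
have [d3 d30 H3] := c2 _ e20.
exists (Num.min d1 (Num.min d2 d3)); first by rewrite !lt_min d10 d20.
move=> h; rewrite !lt_min => /and3P[/H1 h1 /H2 h2 /H3 h3].
have -> : K1 (z + h) * K2 (z + h) - K1 z * K2 z =
  K1 (z + h) * (K2 (z + h) - K2 z) + K2 z * (K1 (z + h) - K1 z) by ring.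
rewrite (le_trans (cmodD _ _))// !cmodM.
have E : e = M * (e / (2 * M)) + M * (e / (2 * M)) by field; rewrite gt_eqF.
have p1 := cmod_ge0 (K1 z); have p2 := cmod_ge0 (K2 z).
by rewrite [leRHS]E; apply: lerD; apply: ler_pM; rewrite ?cmod_ge0//; rewrite /M; lra.
Qed.

Lemma ccont_at_comp K1 K2 z : ccont_at K1 z -> ccont_at K2 (K1 z) ->
  ccont_at (fun u => K2 (K1 u)) z.
Proof.
move=> c1 c2 e e0; have [d d0 Hd] := c2 _ e0.
have d20 : 0 < d / 2 by lra.
have [d' d'0 Hd'] := c1 _ d20; exists d' => // h /Hd' H.
rewrite -[K1 (z + h)](subrKC (K1 z)); apply: Hd.
by rewrite (le_lt_trans H)//; lra.
Qed.

Lemma cdiff_ccont_at K z : cdiff K z -> ccont_at K z.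
Proof. exact: cdiff_cont_at. Qed.

Lemma cdiff_comp K1 K2 z : cdiff K1 z -> cdiff K2 (K1 z) ->
  cdiff (fun u => K2 (K1 u)) z.
Proof.
move=> d1 [L2 H2]; have c1 := cdiff_ccont_at d1; case: d1 => L1 H1.
exists (L2 * L1) => e e0.
pose A := cmod L2 + cmod L1 + 1.
have A0 : 0 < A by rewrite /A; have := cmod_ge0 L1; have := cmod_ge0 L2; lra.
pose e' := Num.min 1 (e / (2 * A)).
have e'0 : 0 < e' by rewrite lt_min ltr01 divr_gt0// mulr_gt0.
have e'1 : e' <= 1 by rewrite ge_min lexx.
have e'e : e' * (2 * A) <= e by rewrite -ler_pdivlMr ?mulr_gt0// ge_min lexx orbT.
have [d1 d10 Hd1] := H1 _ e'0.
have [d2 d20 Hd2] := H2 _ e'0.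
have d220 : 0 < d2 / 2 by lra.
have [d3 d30 Hd3] := c1 _ d220.
exists (Num.min d1 d3); first by rewrite lt_min d10.
move=> h; rewrite lt_min => /andP[/Hd1 h1 /Hd3 h3].
set k := K1 (z + h) - K1 z in h1 h3.
have := Hd2 k; rewrite /k subrKC -/k => /(_ (le_lt_trans h3 _)) h2.
have {}h2 : cmod (K2 (K1 (z + h)) - K2 (K1 z) - L2 * k) <= e' * cmod k by apply: h2; lra.
have -> : K2 (K1 (z + h)) - K2 (K1 z) - L2 * L1 * h =
  (K2 (K1 (z + h)) - K2 (K1 z) - L2 * k) + L2 * (k - L1 * h) by ring.
rewrite (le_trans (cmodD _ _))// cmodM.
have hk : cmod k <= (cmod L1 + 1) * cmod h.
  rewrite -[k](subrK (L1 * h)) (le_trans (cmodD _ _))// cmodM mulrDl mul1r addrC lerD2l.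
  by rewrite (le_trans h1)// ler_piMl// cmod_ge0.
rewrite (le_trans (lerD h2 (ler_wpM2l (cmod_ge0 _) h1)))//.
rewrite (le_trans (lerD (ler_wpM2l (ltW e'0) hk) (lexx _)))//.
rewrite (_ : _ + _ = e' * A * cmod h); last by rewrite /A; ring.
rewrite ler_wpM2r ?cmod_ge0// (le_trans _ e'e)// mulrCA ler_peMl//.
  by rewrite mulr_ge0// ltW.
lra.
Qed.

Lemma cdiffM K1 K2 z : cdiff K1 z -> cdiff K2 z -> cdiff (fun u => K1 u * K2 u) z.
Proof.
move=> d1 d2; have c1 := cdiff_ccont_at d1.
case: d1 => L1 H1; case: d2 => L2 H2.
exists (K1 z * L2 + L1 * K2 z) => e e0.
pose A := cmod (K1 z) + 1 + cmod (K2 z) + cmod L2.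
have A0 : 0 < A.
  by rewrite /A; have := cmod_ge0 (K1 z); have := cmod_ge0 (K2 z); have := cmod_ge0 L2; lra.
pose e' := e / A; have e'0 : 0 < e' by rewrite divr_gt0.
have [d3 d30 H3] := ccont_at_bounded c1.
have [d4 d40 H4] := c1 _ e'0.
have [d1 d10 Hd1] := H1 _ e'0.
have [d2 d20 Hd2] := H2 _ e'0.
exists (Num.min (Num.min d1 d2) (Num.min d3 d4)); first by rewrite !lt_min d10 d20 d30.
move=> h; rewrite !lt_min => /andP[/andP[/Hd1 h1 /Hd2 h2] /andP[/H3 h3 /H4 h4]].
have -> : K1 (z + h) * K2 (z + h) - K1 z * K2 z - (K1 z * L2 + L1 * K2 z) * h =
  K1 (z + h) * (K2 (z + h) - K2 z - L2 * h) +
  (K2 z * (K1 (z + h) - K1 z - L1 * h) + (K1 (z + h) - K1 z) * L2 * h) by ring.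
rewrite (le_trans (cmodD _ _))// (le_trans (lerD (lexx _) (cmodD _ _)))// !cmodM.
have h0 := cmod_ge0 h.
have -> : e = A * e' by rewrite /e'; field; rewrite gt_eqF.
rewrite (_ : A * e' * cmod h = (cmod (K1 z) + 1) * (e' * cmod h) +
  (cmod (K2 z) * (e' * cmod h) + e' * cmod L2 * cmod h)); last by rewrite /A; ring.
rewrite lerD ?lerD ?ler_pM ?ler_wpM2r ?ler_wpM2l ?mulr_ge0 ?cmod_ge0//.
Qed.

Lemma cdiff_affine (A B : C) z : cdiff (fun u => A + B * u) z.
Proof.
exists B => e e0; exists 1 => // h _.
rewrite (_ : _ - _ = 0); first by rewrite cmod0 mulr_ge0 ?cmod_ge0 ?ltW.
ring.
Qed.

Lemma cdiff_inv z : z != 0 -> cdiff (fun u => u^-1) z.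
Proof.
move=> z0; exists (- z ^- 2) => e e0.
have m0 : 0 < cmod z by rewrite cmod_gt0.
exists (Num.min (cmod z / 2) (e * cmod z ^+ 3 / 2)).
  by rewrite lt_min !divr_gt0// mulr_gt0// exprn_gt0.
move=> h; rewrite lt_min => /andP[h1 h2].
have h3 : cmod z / 2 <= cmod (z + h).
  have := cmodD (z + h) (- h); rewrite cmodN addrK; lra.
have zh0 : z + h != 0 by rewrite -cmod_gt0 (lt_le_trans _ h3)// divr_gt0.
have -> : (z + h)^-1 - z^-1 - - z ^- 2 * h = h * (h / (z ^+ 2 * (z + h))).
  by field; rewrite zh0.
rewrite cmodM mulrC ler_wpM2r ?cmod_ge0// cmodM cmodV cmodM cmodX.
rewrite ler_pdivrMr; last by rewrite mulr_gt0 ?exprn_gt0 ?cmod_gt0.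
rewrite (le_trans (ltW h2))// (_ : e * _ / 2 = e * (cmod z ^+ 2 * (cmod z / 2))); last by ring.
by rewrite !ler_wpM2l ?exprn_ge0 ?cmod_ge0// ltW.
Qed.

Lemma ext_cdiff K1 K2 z (d : R) : 0 < d ->
  (forall h, cmod h < d -> K1 (z + h) = K2 (z + h)) -> cdiff K1 z -> cdiff K2 z.
Proof.
move=> d0 E [L H]; exists L => e e0; have [d' d'0 H'] := H _ e0.
exists (Num.min d d'); first by rewrite lt_min d0.
move=> h; rewrite lt_min => /andP[hd /H' {}H'].
have := E 0; rewrite cmod0 addr0 => /(_ d0) <-.
by rewrite -E.
Qed.

Lemma is_derive_approx (f : R -> R) (x df : R) : is_derive x 1 f df ->
  forall e : R, 0 < e -> exists2 d : R, 0 < d & forall t, `|t| < d ->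
    `|f (x + t) - f x - df * t| <= e * `|t|.
Proof.
move=> [dv vE] e e0.
have /cvgrPdist_le/(_ _ e0) := dv.
rewrite -/(derive _ _ _) vE near_withinE => /nbhs_ballP[/= d d0 Hd].
exists d => // t td; have [->|t0] := eqVneq t 0.
  by rewrite addr0 subrr mulr0 subr0 normr0 mulr0.
have := Hd t; rewrite /ball /= sub0r normrN => /(_ td t0).
rewrite /GRing.scale /= mulr1 (addrC t) -(@ler_pM2r _ `|t|) ?normr_gt0// -normrM.
by rewrite mulrBl mulrAC mulVf// mul1r -normrN opprB.
Qed.

Lemma cexpD z w : cexp (z + w) = cexp z * cexp w.
Proof.
apply: eq_ReIm; rewrite ?cRe_M ?cIm_M /= cRe_D cIm_D expRD ?sinD ?cosD; ring.
Qed.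

Lemma cexp0 : cexp (0 : C) = 1.
Proof. by apply: eq_ReIm; rewrite /= expR0 ?cos0 ?sin0 ?mulr1 ?mulr0. Qed.

Lemma cmod_cexp z : cmod (cexp z) = expR (complex.Re z).
Proof.
by rewrite cmodE /= !exprMn -mulrDr cos2Dsin2 mulr1 sqrtr_sqr ger0_norm.
Qed.

Lemma cexp_neq0 z : cexp z != 0.
Proof. by rewrite -cmod_gt0 cmod_cexp expR_gt0. Qed.

Lemma cexp_2pi z : cexp (z + (0 +i* (2 * pi))%C) = cexp z.
Proof.
rewrite cexpD (_ : cexp (0 +i* (2 * pi))%C = 1) ?mulr1//.
apply: eq_ReIm; rewrite /= expR0 mul1r mulr_natl ?cos2pi ?sin2pi //.
Qed.

Lemma cexpN z : cexp (- z) = (cexp z)^-1.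
Proof.
apply: (mulIf (cexp_neq0 z)); rewrite -cexpD addNr cexp0 mulVf//.
exact: cexp_neq0.
Qed.

Lemma cexpMn z n : cexp (z *+ n) = cexp z ^+ n.
Proof.
elim: n => [|n IH]; first by rewrite mulr0n cexp0 expr0.
by rewrite mulrS cexpD IH exprS.
Qed.

(** By the addition formula only increments at 0 matter; there the real derivatives of [expR], [cos]
    and [sin] combine. The errors add up to 9 e' |h|, well below the 20 e' |h| allotted. *)
Lemma cdiff_cexp z : cdiff (@cexp R) z.
Proof.
exists (cexp z) => e e0.
have E0 : 0 < expR (complex.Re z) by exact: expR_gt0.
pose e' := e / (expR (complex.Re z) * 20).
have e'0 : 0 < e' by rewrite divr_gt0// mulr_gt0.
have [d1 d10 H1] := is_derive_approx (is_derive_expR (0 : R)) e'0.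
have [d2 d20 H2] := is_derive_approx (is_derive_cos (0 : R)) e'0.
have [d3 d30 H3] := is_derive_approx (is_derive_sin (0 : R)) e'0.
have [d4 d40 H4] := is_derive_approx (is_derive_expR (0 : R)) ltr01.
pose d := Num.min (Num.min d1 d2) (Num.min (Num.min d3 d4) (Num.min 1 (e'))).
exists d; first by rewrite !lt_min d10 d20 d30 d40 ltr01 e'0.
move=> h; rewrite !lt_min => /andP[/andP[h1 h2] /andP[/andP[h3 h4] /andP[h5 h6]]].
rewrite cexpD.
have -> : cexp z * cexp h - cexp z - cexp z * h = cexp z * (cexp h - 1 - h) by ring.
rewrite cmodM cmod_cexp.
have -> : e * cmod h = expR (complex.Re z) * (20 * e' * cmod h).
  by rewrite /e'; field; rewrite gt_eqF.
apply: ler_wpM2l; first exact: ltW.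
set a := complex.Re h; set b := complex.Im h.
have ha : `|a| <= cmod h by exact: normr_Re_cmod.
have hb : `|b| <= cmod h by exact: normr_Im_cmod.
have := H1 a (le_lt_trans ha h1); have := H2 b (le_lt_trans hb h2).
have := H3 b (le_lt_trans hb h3); have := H4 a (le_lt_trans ha h4).
rewrite !add0r expR0 cos0 sin0 oppr0 mul0r !mul1r ?subr0 ?addr0 => g4 g2 g3 g1.
have ex3 : `|expR a| <= 3.
  have := ler_normD (expR a - 1 - a) (1 + a).
  rewrite (_ : expR a - 1 - a + (1 + a) = expR a); last by ring.
  move/le_trans; apply; have := ler_normD 1 a; rewrite normr1; lra.
have ex1 : `|expR a - 1| <= 2 * e'.
  have := ler_normD (expR a - 1 - a) a; rewrite subrK; lra.
rewrite (le_trans (cmod_le_ReIm _))// !cRe_D !cIm_D !cRe_N !cIm_N /=.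
rewrite -/a -/b oppr0 addr0.
have -> : expR a * cos b - 1 - a = (expR a - 1 - a) + expR a * (cos b - 1) by ring.
have -> : expR a * sin b - b = expR a * (sin b - b) + (expR a - 1) * b by ring.
have k1 : `|expR a * (cos b - 1)| <= 3 * (e' * cmod h).
  rewrite normrM ler_pM// (le_trans g3)// ler_wpM2l// ltW//.
have k2 : `|expR a * (sin b - b)| <= 3 * (e' * cmod h).
  rewrite normrM ler_pM// (le_trans g2)// ler_wpM2l// ltW//.
have k3 : `|(expR a - 1) * b| <= 2 * e' * cmod h.
  by rewrite normrM ler_pM.
have k4 : `|expR a - 1 - a| <= e' * cmod h.
  by rewrite (le_trans g1)// ler_wpM2l// ltW.
have k0 : 0 <= e' * cmod h by rewrite mulr_ge0 ?cmod_ge0// ltW.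
have := ler_normD (expR a - 1 - a) (expR a * (cos b - 1)).
have := ler_normD (expR a * (sin b - b)) ((expR a - 1) * b).
rewrite -mulrA; move: k0 k1 k2 k3 k4; rewrite -mulrA.
set X := e' * cmod h; lra.
Qed.

End ComplexDifferentiability.

(** * Taylor expansion of entire functions *)

Section CircleMeans.
Variable R : realType.
Local Notation C := (Cplx R).
Local Notation mu := (@lebesgue_measure R).
Implicit Types (K F : C -> C) (z w u h : C) (s : R).

Let twopi : R := 2 * pi.
Let twopi0 : 0 < twopi. Proof. by rewrite mulr_gt0// pi_gt0. Qed.

(* For K(u) = G(exp u) this is the integral of G over the circle of radius
   exp s with respect to the angle. *)
Definition vmean K s : C := vline K s 0 twopi.

Lemma cmod_vmean_le K s (M : R) : ccont K ->
  (forall u, complex.Re u = s -> cmod (K u) <= M) ->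
  cmod (vmean K s) <= 2 * M * twopi.
Proof.
move=> /ccont_line[_ lK] KM.
have h : 0 <= 0 + twopi by rewrite add0r ltW.
have := cmod_intc_le (lK s) h (fun t _ => KM (s +i* t)%C erefl).
by rewrite subr0 {2}add0r.
Qed.

(** Cauchy's theorem on a rectangle whose height is one period: the horizontal sides cancel. For z =
    exp u this says that a circle integral is independent of the radius, obtained with rectangles
    only. *)
Lemma vmean_const K s1 s2 : ccont K -> s1 <= s2 ->
  (forall u, K (u + (0 +i* twopi)%C) = K u) ->
  (forall u, s1 <= complex.Re u <= s2 -> cdiff K u) -> vmean K s1 = vmean K s2.
Proof.
move=> cK s12 pK dK.
have s0 : 0 <= s2 - s1 by rewrite subr_ge0.
have := @goursat_rect R K s1 0 (s2 - s1) twopi cK s0 (ltW twopi0).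
rewrite subrKC => /(_ (fun z zs _ => dK z zs)).
rewrite /rect_int subrKC.
have -> : hline K s1 (s2 - s1) (0 + twopi) = hline K s1 (s2 - s1) 0.
  apply: eq_intc => t _; rewrite -[in RHS]pK; congr K.
  by apply: eq_ReIm; rewrite ?cRe_D ?cIm_D /= ?addr0.
rewrite [X in X - _]addrAC addrN add0r -mulrBr => /eqP; rewrite mulf_eq0 => /orP[|].
  by rewrite eq_complex /= oner_eq0 andbF.
by rewrite subr_eq0 => /eqP.
Qed.

(** Serves to cross the circle through a point where the integrand is continuous but not known to be
    differentiable. *)
Lemma vmean_continuous K s0 (M : R) : ccont K ->
  (forall u, s0 - 1 < complex.Re u < s0 + 1 -> cmod (K u) <= M) ->
  forall e : R, 0 < e -> exists2 d : R, 0 < d & forall s, `|s - s0| < d ->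
    cmod (vmean K s - vmean K s0) <= e.
Proof.
move=> cK KM e e0.
have lK := ccont_line cK.
have I0 : s0 \in `]s0 - 1, s0 + 1[ by rewrite in_itv/=; apply/andP; split; lra.
have key (P : C -> R) : (forall z, `|P z| <= cmod z) ->
    (forall x, continuous (fun t => P (K (x +i* t)%C))) ->
    (forall y, continuous (fun t => P (K (t +i* y)%C))) ->
    {for s0, continuous (fun s => \int[mu]_(t in `[0, 0 + twopi]) P (K (s +i* t)%C))}.
  move=> Pn cv ch.
  apply: (@continuity_under_integral R _ _ mu (fun s t => P (K (s +i* t)%C)) `[0, 0 + twopi] _
     (s0 - 1) (s0 + 1) _ _ (fun=> M)) => //.
  - by move=> x _; exact: continuous_integrable_cc.
  - by apply: aeW => y _ x _; exact: ch.
  - by apply: continuous_integrable_cc => x; exact: cst_continuous.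
  - move=> x; rewrite /= in_itv /= => Ix; apply: aeW => y _.
    by rewrite (le_trans (Pn _))// KM.
  - by rewrite inE /= I0.
have e20 : 0 < e / 2 by lra.
have c1 := key (@complex.Re R) (@normr_Re_cmod R) (fun x => (lK.2 x).1) (fun y => (lK.1 y).1).
have c2 := key (@complex.Im R) (@normr_Im_cmod R) (fun x => (lK.2 x).2) (fun y => (lK.1 y).2).
have /cvgrPdist_le/(_ _ e20)/nbhs_ballP[d1 d10 H1] := c1.
have /cvgrPdist_le/(_ _ e20)/nbhs_ballP[d2 d20 H2] := c2.
exists (Num.min d1 d2); first by rewrite lt_min d10.
move=> s; rewrite lt_min => /andP[sd1 sd2].
rewrite (le_trans (cmod_le_ReIm _))// cRe_D cIm_D cRe_N cIm_N [leRHS]splitr lerD//.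
  by rewrite distrC; apply: H1; rewrite /ball /= distrC.
by rewrite distrC; apply: H2; rewrite /ball /= distrC.
Qed.

Lemma vmeanD K1 K2 s : ccont K1 -> ccont K2 ->
  vmean (fun u => K1 u + K2 u) s = vmean K1 s + vmean K2 s.
Proof. by move=> /ccont_line[_ a] /ccont_line[_ b]; rewrite /vmean /vline intcD. Qed.

Lemma vmeanZ (k : C) K s : ccont K -> vmean (fun u => k * K u) s = k * vmean K s.
Proof. by move=> /ccont_line[_ a]; rewrite /vmean /vline intcZ. Qed.

Lemma eq_vmean K1 K2 s : (forall u, complex.Re u = s -> K1 u = K2 u) ->
  vmean K1 s = vmean K2 s.
Proof. by move=> E; apply: eq_intc => t _; exact: E. Qed.

Lemma ccontD K1 K2 : ccont K1 -> ccont K2 -> ccont (fun u => K1 u + K2 u).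
Proof.
move=> c1 c2 z e e0; have e20 : 0 < e / 2 by lra.
have [d1 d10 H1] := c1 z _ e20; have [d2 d20 H2] := c2 z _ e20.
exists (Num.min d1 d2); first by rewrite lt_min d10.
move=> h; rewrite lt_min => /andP[/H1 h1 /H2 h2].
rewrite opprD addrACA (le_trans (cmodD _ _))//; lra.
Qed.

Lemma ccont_cst (k : C) : ccont (fun=> k).
Proof. by move=> z e e0; exists 1 => // h _; rewrite subrr cmod0 ltW. Qed.

Lemma ccontM K1 K2 : ccont K1 -> ccont K2 -> ccont (fun u => K1 u * K2 u).
Proof. by move=> c1 c2 z; apply: ccont_atM; [exact: c1|exact: c2]. Qed.

Lemma ccont_sum n (K : 'I_n -> C -> C) : (forall i, ccont (K i)) ->
  ccont (fun u => \sum_(i < n) K i u).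
Proof.
elim: n K => [|n IH] K cK.
  by under [X in ccont X]eq_fun do rewrite big_ord0; exact: ccont_cst.
under [X in ccont X]eq_fun do rewrite big_ord_recr.
by apply: ccontD => //; apply: IH.
Qed.

Lemma vmean_sum n (K : 'I_n -> C -> C) s : (forall i, ccont (K i)) ->
  vmean (fun u => \sum_(i < n) K i u) s = \sum_(i < n) vmean (K i) s.
Proof.
elim: n K => [|n IH] K cK.
  rewrite big_ord0 (@eq_vmean _ (fun u => 0 * 0)).
    by rewrite vmeanZ ?mul0r//; exact: ccont_cst.
  by move=> u _; rewrite big_ord0 mul0r.
rewrite big_ord_recr /= -IH// -vmeanD//; last exact: ccont_sum.
by apply: eq_vmean => u _; rewrite big_ord_recr.
Qed.

Definition expn_opp n u : C := cexp (- u) ^+ n.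

Lemma cdiff_expn_opp n u : cdiff (expn_opp n) u.
Proof.
have -> : expn_opp n = fun u => cexp (0 + (- n%:R) * u).
  by apply/funext => v; rewrite /expn_opp -cexpMn add0r -mulr_natr; congr cexp; ring.
by apply: cdiff_comp; [exact: cdiff_affine|exact: cdiff_cexp].
Qed.

Lemma ccont_expn_opp n : ccont (expn_opp n).
Proof. by move=> u; apply: cdiff_ccont_at; exact: cdiff_expn_opp. Qed.

Lemma expn_opp_period n u : expn_opp n (u + (0 +i* twopi)%C) = expn_opp n u.
Proof. by rewrite /expn_opp !cexpN cexp_2pi. Qed.

Lemma cmod_expn_opp n u : cmod (expn_opp n u) = expR (- complex.Re u) ^+ n.
Proof. by rewrite cmodX cmod_cexp cRe_N. Qed.

Lemma le_exp_eq0 (x c : R) : 0 <= x ->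
  (forall s, 0 <= s -> x <= c * expR (- s)) -> x = 0.
Proof.
move=> x0 H; apply/eqP; rewrite eq_le x0 andbT leNgt; apply/negP => xp.
have c0 : 0 < c.
  by have := H 0 (lexx _); rewrite oppr0 expR0 mulr1; exact: lt_le_trans.
have cx : 0 < c / x by rewrite divr_gt0.
have cx2 : 0 <= 2 * (c / x) by lra.
have := H _ cx2.
rewrite expRN leNgt => /negP; apply.
rewrite ltr_pdivrMr ?expR_gt0// mulrC -ltr_pdivrMr//.
rewrite (lt_le_trans _ (expR_ge1Dx _))//; lra.
Qed.

(** For n > 0 the mean does not depend on the radius and is O(exp (- s)) as the radius exp s
    grows. *)
Lemma vmean_expn_opp n s : vmean (expn_opp n) s = if n is 0%N then ofreal twopi else 0.
Proof.
case: n => [|n].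
  rewrite /vmean /vline (@eq_intc _ _ (fun t => 1 + 0 * ofreal t)).
    by rewrite intc_affine ?add0r ?ltW// mul1r mul0r addr0 subr0.
  by move=> t _; rewrite /expn_opp expr0 mul0r addr0.
have cst s1 s2 : s1 <= s2 -> vmean (expn_opp n.+1) s1 = vmean (expn_opp n.+1) s2.
  move=> s12; apply: vmean_const => //.
  - exact: ccont_expn_opp.
  - by move=> u; exact: expn_opp_period.
  - by move=> u _; exact: cdiff_expn_opp.
have -> : vmean (expn_opp n.+1) s = vmean (expn_opp n.+1) 0.
  case: (leP s 0) => [|/ltW] /cst E; [exact: E|exact: esym E].
apply/eqP; rewrite -cmod_eq0; apply/eqP.
apply: (@le_exp_eq0 _ (2 * twopi)); first exact: cmod_ge0.
move=> t t0; rewrite (cst _ _ t0) mulrAC.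
apply: cmod_vmean_le => [|u ut]; first exact: ccont_expn_opp.
rewrite cmod_expn_opp ut exprS ler_piMr// exprn_ile1// ?expR_ge0//.
by rewrite expR_le1 oppr_le0.
Qed.

(** The bound says that the integrand is O(|z|) at z = 0, so integrals over shrinking circles tend
    to 0, while [vmean_const] makes them all equal. *)
Lemma const_vmean_eq0 K s0 (M : R) : ccont K ->
  (forall u, K (u + (0 +i* twopi)%C) = K u) ->
  (forall u, complex.Re u <= s0 -> cdiff K u /\ cmod (K u) <= M * expR (complex.Re u)) ->
  vmean K s0 = 0.
Proof.
move=> cK pK H; apply/eqP; rewrite -cmod_eq0; apply/eqP.
apply: (@le_exp_eq0 _ (2 * (M * expR s0) * twopi)); first exact: cmod_ge0.
move=> t t0; rewrite -(@vmean_const _ (s0 - t))//; last 2 first.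
- by rewrite lerBlDr lerDl.
- by move=> u /andP[_ /H[]].
rewrite (_ : _ * expR _ = 2 * (M * expR (s0 - t)) * twopi).
  apply: cmod_vmean_le => // u ut; rewrite -ut; apply: (H u _).2.
  by rewrite ut lerBlDr lerDl.
rewrite expRD; ring.
Qed.

End CircleMeans.

(** * Taylor coefficients, Cauchy estimates and Cauchy's formula *)

Section EntireTaylor.
Variable R : realType.
Local Notation C := (Cplx R).
Variable F : C -> C.
Hypothesis Fdiff : forall z, cdiff F z.
Hypothesis Fbnd : forall r : R, exists M : R, forall z, cmod z <= r -> cmod (F z) <= M.
Implicit Types (z w u h : C) (s : R).

Let twopi : R := 2 * pi.
Let twopi0 : 0 < twopi. Proof. by rewrite mulr_gt0// pi_gt0. Qed.

Let Kn n u : C := F (cexp u) * expn_opp n u.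

Let Fexp_diff u : cdiff (fun v => F (cexp v)) u.
Proof. by apply: cdiff_comp; [exact: cdiff_cexp|exact: Fdiff]. Qed.

Let Kn_diff n u : cdiff (Kn n) u.
Proof. by apply: cdiffM; [exact: Fexp_diff|exact: cdiff_expn_opp]. Qed.

Let Kn_cont n : ccont (Kn n).
Proof. by move=> u; exact: cdiff_ccont_at. Qed.

Let Kn_period n u : Kn n (u + (0 +i* twopi)%C) = Kn n u.
Proof. by rewrite /Kn expn_opp_period cexp_2pi. Qed.

(** The average of F(z) z^-n over the unit circle; [Kn_mean] makes the radius free, which turns the
    trivial bound into Cauchy's estimate. *)
Definition taylor_coef n : C := (ofreal twopi)^-1 * vmean (Kn n) 0.

Let Kn_mean n s : vmean (Kn n) s = vmean (Kn n) 0.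
Proof.
have cst s1 s2 : s1 <= s2 -> vmean (Kn n) s1 = vmean (Kn n) s2.
  move=> s12; apply: vmean_const => //; exact: Kn_cont.
case: (leP s 0) => [|/ltW] /cst E; [exact: E|exact: esym E].
Qed.

Lemma taylor_coef_le n (r M : R) : 0 < r ->
  (forall z, cmod z = r -> cmod (F z) <= M) -> cmod (taylor_coef n) <= 2 * M / r ^+ n.
Proof.
move=> r0 FM; rewrite /taylor_coef -(Kn_mean n (ln r)) cmodM cmodV cmod_ofreal.
rewrite (ger0_norm (ltW twopi0)) mulrC ler_pdivrMr//.
rewrite -(mulrA 2); apply: cmod_vmean_le; first exact: Kn_cont.
move=> u ur; rewrite cmodM cmod_expn_opp ur expRN lnK// exprVn.
apply: ler_wpM2r; first by rewrite invr_ge0 exprn_ge0// ltW.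
by apply: FM; rewrite cmod_cexp ur lnK.
Qed.

Section AtPoint.
Variable w : C.

Let Q := sval (cid (Fdiff w)).
Let quo z := if z == w then Q else (F z - F w) / (z - w).

Let quo_diff z : z != w -> cdiff quo z.
Proof.
move=> zw.
have d0 : 0 < cmod (z - w) by rewrite cmod_gt0 subr_eq0.
apply: (@ext_cdiff _ (fun v => ((- F w) + F v) * (v - w)^-1) _ _ _ d0).
  move=> h hd; rewrite /quo ifF; first by rewrite (addrC (- F w)).
  apply/negP => /eqP E; move: hd; rewrite -E.
  by rewrite opprD addrA subrr add0r cmodN ltxx.
apply: cdiffM.
  apply: (@cdiff_comp _ F (fun v => - F w + v)); first exact: Fdiff.
  have -> : (fun v : C => - F w + v) = (fun v => - F w + 1 * v).
    by apply/funext => v; rewrite mul1r.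
  exact: cdiff_affine.
apply: (@cdiff_comp _ (fun v => v - w) (fun v => v^-1)).
  have -> : (fun v : C => v - w) = (fun v => - w + 1 * v).
    by apply/funext => v; rewrite mul1r addrC.
  exact: cdiff_affine.
by apply: cdiff_inv; rewrite subr_eq0.
Qed.

Let quo_cont z : ccont_at quo z.
Proof.
have [->|zw] := eqVneq z w; last exact/cdiff_ccont_at/quo_diff.
move=> e e0; have := svalP (cid (Fdiff w)) _ e0; rewrite -/Q => -[d d0 Hd].
exists d => // h hd; rewrite /quo eqxx; have [h0|h0] := eqVneq h 0.
  by rewrite h0 addr0 eqxx subrr cmod0 ltW.
rewrite ifF; last by apply/negP => /eqP/(canRL (addKr w)); rewrite addNr => /eqP; exact/negP.
rewrite (addrC w) addrK -(ler_pM2r (_ : 0 < cmod h)) ?cmod_gt0// -cmodM.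
by rewrite mulrBl divfK//; have := Hd h hd; rewrite (addrC w h).
Qed.

Let quo_bnd (r : R) : exists2 M : R, 0 <= M & forall z, cmod z <= r -> cmod (quo z) <= M.
Proof.
have [M HM] := Fbnd r.
have [d d0 Hd] := ccont_at_bounded (quo_cont w).
have h1 := cmod_ge0 (quo w); have h2 := cmod_ge0 (F w).
have h3 : 0 <= (`|M| + cmod (F w)) / d by rewrite divr_ge0// ?addr_ge0// ltW.
exists (cmod (quo w) + 1 + (`|M| + cmod (F w)) / d); first by lra.
move=> z zr; have [zd|zd] := ltP (cmod (z - w)) d.
  have := Hd _ zd; rewrite subrKC; lra.
have zw : z != w by rewrite -subr_eq0 -cmod_gt0 (lt_le_trans d0).
rewrite /quo (negbTE zw) cmodM cmodV.
apply: (@le_trans _ _ ((`|M| + cmod (F w)) / d)); last by rewrite /quo eqxx in h1 *; lra.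
apply: ler_pM; rewrite ?invr_ge0 ?cmod_ge0//.
  by rewrite (le_trans (cmodD _ _))// cmodN lerD2r (le_trans (HM _ zr))// ler_norm.
by rewrite lef_pV2 ?posrE// (lt_le_trans d0).
Qed.

(** The factor [cexp u] is dz divided by i times the angular differential: the mean of [Kq] is the
    contour integral of [quo] dz divided by i. *)
Let Kq u : C := cexp u * quo (cexp u).

Let Kq_cont : ccont Kq.
Proof.
move=> u; apply: (@ccont_atM _ (@cexp R) (fun v => quo (cexp v))).
  exact/cdiff_ccont_at/cdiff_cexp.
apply: (@ccont_at_comp _ (@cexp R) quo); last exact: quo_cont.
exact/cdiff_ccont_at/cdiff_cexp.
Qed.

Let Kq_period u : Kq (u + (0 +i* twopi)%C) = Kq u.
Proof. by rewrite /Kq cexp_2pi. Qed.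

Let Kq_diff u : cexp u != w -> cdiff Kq u.
Proof.
move=> uw; apply: (@cdiffM _ (@cexp R) (fun v => quo (cexp v))).
  exact: cdiff_cexp.
by apply: (@cdiff_comp _ (@cexp R) quo); [exact: cdiff_cexp|exact: quo_diff].
Qed.

Let Kq_bnd s : exists M : R, forall u, complex.Re u <= s ->
  cmod (Kq u) <= M * expR (complex.Re u).
Proof.
have [M M0 HM] := quo_bnd (expR s); exists M => u us.
rewrite /Kq cmodM cmod_cexp mulrC ler_wpM2r ?expR_ge0// HM// cmod_cexp.
by rewrite ler_expR.
Qed.

(** Inside the circle through [w] the integral vanishes by shrinking to 0; outside it is constant in
    the radius. Continuity at the critical radius joins the two values. *)
Let Kq_mean0 s : cmod w < expR s -> vmean Kq s = 0.
Proof.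
move=> ws; have [w0|w0] := eqVneq w 0.
  have [M HM] := Kq_bnd s.
  apply: (@const_vmean_eq0 _ _ _ M) => //; move=> u us; split; last exact: HM.
  by apply: Kq_diff; rewrite w0 cexp_neq0.
have mw : 0 < cmod w by rewrite cmod_gt0.
pose s0 := ln (cmod w).
have es0 : expR s0 = cmod w by rewrite lnK.
have ne u : complex.Re u != s0 -> cexp u != w.
  apply: contra_neq => uw; apply: expR_inj.
  by rewrite -cmod_cexp uw.
have ss0 : s0 < s by rewrite -ltr_expR es0.
have left t : t < s0 -> vmean Kq t = 0.
  move=> ts; have [M HM] := Kq_bnd t.
  apply: (@const_vmean_eq0 _ _ _ M) => //; move=> u ut; split; last exact: HM.
  by apply/Kq_diff/ne; rewrite lt_eqF// (le_lt_trans ut).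
have right t : s0 < t -> vmean Kq t = vmean Kq s.
  have cst s1 s2 : s0 < s1 -> s1 <= s2 -> vmean Kq s1 = vmean Kq s2.
    move=> s01 s12; apply: vmean_const => // u /andP[us1 _].
    by apply/Kq_diff/ne; rewrite gt_eqF// (lt_le_trans s01).
  move=> t0; case: (leP t s) => [ts|/ltW ts]; first exact: cst.
  by apply: esym; exact: cst.
have [M HM] := Kq_bnd (s0 + 1).
have HM' u : s0 - 1 < complex.Re u < s0 + 1 -> cmod (Kq u) <= `|M| * expR (s0 + 1).
  move=> /andP[_ /ltW h]; rewrite (le_trans (HM _ h))//.
  apply: (@le_trans _ _ (`|M| * expR (complex.Re u))).
    by rewrite ler_wpM2r ?expR_ge0 ?ler_norm.
  by rewrite ler_wpM2l ?ler_expR.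
apply/eqP; rewrite -cmod_eq0 eq_le cmod_ge0 andbT; apply/ler_addgt0Pl => e e0.
have e20 : 0 < e / 2 by lra.
have [d d0 Hd] := vmean_continuous Kq_cont HM' e20.
have h1 := Hd (s0 - d / 2); rewrite left in h1; last by lra.
have h2 := Hd (s0 + d / 2); rewrite right in h2; last by lra.
have {}h1 : cmod (0 - vmean Kq s0) <= e / 2.
  by apply: h1; rewrite addrAC subrr add0r normrN ger0_norm; lra.
have {}h2 : cmod (vmean Kq s - vmean Kq s0) <= e / 2.
  by apply: h2; rewrite addrAC subrr add0r ger0_norm; lra.
rewrite addr0 -[vmean Kq s](subrK (vmean Kq s0)) (le_trans (cmodD _ _))//.
by move: h1; rewrite sub0r cmodN; lra.
Qed.

(* Cauchy's formula on the circle of radius e^s: expand z/(z - w) in powers of w/z. *)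
Lemma taylor_remainder (s : R) : cmod w < expR s ->
  exists M : R, forall N, (0 < N)%N ->
    cmod (F w - \sum_(n < N) taylor_coef n * w ^+ n) <= M * (cmod w / expR s) ^+ N.
Proof.
move=> ws; have [M HM] := Kq_bnd s.
exists (2 * (M * expR s)) => N N0.
pose E u := w ^+ N * (expn_opp N u * Kq u).
have cE : ccont E.
  by apply: ccontM; [exact: ccont_cst|apply: ccontM => //; exact: ccont_expn_opp].
(* Pointwise identity on the circle: the geometric sum in w / z splits z (F z - F w) / (z - w) into
   its first N terms and the tail [E]. *)
have mE : vmean (fun u => \sum_(n < N) w ^+ n * (Kn n u + (- F w) * expn_opp n u) + E u) s =
          vmean Kq s.
  apply: eq_vmean => u us; rewrite /E /Kq /Kn.
  have uw : cexp u != w.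
    by apply/negP => /eqP uw; move: ws; rewrite -uw cmod_cexp us ltxx.
  rewrite /quo (negbTE uw); have z0 := cexp_neq0 u.
  have zw : cexp u - w != 0 by rewrite subr_eq0.
  set z := cexp u in uw z0 zw *.
  have eo n : expn_opp n u = z^-1 ^+ n by rewrite /expn_opp cexpN.
  have -> : \sum_(n < N) w ^+ n * (F z * expn_opp n u + (- F w) * expn_opp n u) =
      (F z - F w) * \sum_(n < N) (w / z) ^+ n.
    by rewrite mulr_sumr; apply: eq_bigr => i _; rewrite eo exprMn; ring.
  have := subrX1 (w / z) N; have wz : w / z - 1 != 0.
    by rewrite subr_eq0 -(inj_eq (mulIf z0)) divfK// mul1r eq_sym.
  move=> /esym/(canRL (mulKf wz)) ->.
  rewrite eo exprMn; set a := w ^+ N; set b := z^-1 ^+ N.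
  have wz' : w - z != 0 by rewrite -opprB oppr_eq0.
  by field; rewrite z0 zw mulN1r wz'.
move: mE; rewrite (Kq_mean0 ws) vmeanD//; last first.
  apply: ccont_sum => i; apply: ccontM; first exact: ccont_cst.
  apply: ccontD; first exact: Kn_cont.
  by apply: ccontM; [exact: ccont_cst|exact: ccont_expn_opp].
rewrite vmean_sum; last first.
  move=> i; apply: ccontM; first exact: ccont_cst.
  apply: ccontD; first exact: Kn_cont.
  by apply: ccontM; [exact: ccont_cst|exact: ccont_expn_opp].
have tc n : vmean (Kn n) s = ofreal twopi * taylor_coef n.
  rewrite Kn_mean /taylor_coef mulrA divff ?mul1r//.
  by rewrite -cmod_eq0 cmod_ofreal normr_eq0 gt_eqF.
have -> : \sum_(i < N) vmean (fun u => w ^+ i * (Kn i u + - F w * expn_opp i u)) s =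
    ofreal twopi * (\sum_(n < N) taylor_coef n * w ^+ n - F w).
  transitivity (\sum_(i < N) (ofreal twopi * (taylor_coef i * w ^+ i) +
      - F w * (w ^+ i * vmean (expn_opp i) s))).
    apply: eq_bigr => i _; rewrite vmeanZ; last first.
      apply: ccontD; first exact: Kn_cont.
      by apply: ccontM; [exact: ccont_cst|exact: ccont_expn_opp].
    rewrite vmeanD ?vmeanZ ?tc//; try exact: ccont_expn_opp; try exact: Kn_cont.
      by ring.
    by apply: ccontM; [exact: ccont_cst|exact: ccont_expn_opp].
  rewrite big_split /= -mulr_sumr -mulr_sumr mulrBr; congr (_ + _).
  (* Only z^0 has a nonzero circle mean, so F w is collected exactly once; this is where 0 < N
     enters. *)
  case: N N0 {E cE} => // N _; rewrite big_ord_recl /= big1 => [|i _].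
    by rewrite vmean_expn_opp /= expr0 -/twopi; ring.
  by rewrite vmean_expn_opp mulr0.
move=> /eqP; rewrite addr_eq0 => /eqP H.
have t0 : ofreal twopi != 0 :> C by rewrite -cmod_eq0 cmod_ofreal normr_eq0 gt_eqF.
have -> : F w - \sum_(n < N) taylor_coef n * w ^+ n = (ofreal twopi)^-1 * vmean E s.
  by apply: (mulfI t0); rewrite mulVKf// -[vmean E s]opprK -H; ring.
rewrite cmodM cmodV cmod_ofreal (ger0_norm (ltW twopi0)) mulrC ler_pdivrMr//.
rewrite (_ : _ * twopi = 2 * (M * expR s * (cmod w / expR s) ^+ N) * twopi); last by ring.
apply: cmod_vmean_le => // u us; rewrite /E cmodM cmodX (cmodM (expn_opp N u)) cmod_expn_opp us expRN.
rewrite exprMn !exprVn.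
rewrite [leLHS](_ : _ = cmod (Kq u) * (cmod w ^+ N / expR s ^+ N)); last by ring.
apply: ler_wpM2r.
  by rewrite mulr_ge0// ?invr_ge0 exprn_ge0// ?cmod_ge0// expR_ge0.
by have := HM u; rewrite us => /(_ (lexx _)).
Qed.

End AtPoint.
End EntireTaylor.

(** * Functions of exponential type on the real line *)

Section DerivativeFamilies.
Variable R : realType.
Implicit Types (f g h : R -> R) (D E : nat -> R -> R) (rho A x y t : R).

Lemma der_cst (c x : R) : is_derive x 1 (fun=> c) 0.
Proof. exact: is_derive_cst. Qed.

Lemma der_id x : is_derive x 1 (fun y : R => y) 1.
Proof. exact: is_derive_id. Qed.

Lemma der_add f g x (a b : R) : is_derive x 1 f a -> is_derive x 1 g b ->
  is_derive x 1 (fun y => f y + g y) (a + b).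
Proof. by move=> df dg; exact: is_deriveD. Qed.

Lemma der_sub f g x (a b : R) : is_derive x 1 f a -> is_derive x 1 g b ->
  is_derive x 1 (fun y => f y - g y) (a - b).
Proof. by move=> df dg; exact: is_deriveB. Qed.

Lemma der_mul f g x (a b : R) : is_derive x 1 f a -> is_derive x 1 g b ->
  is_derive x 1 (fun y => f y * g y) (a * g x + f x * b).
Proof.
move=> df dg; apply: (is_derive_eq (is_deriveM df dg)).
by rewrite /GRing.scale /= addrC (mulrC a).
Qed.

Lemma der_scale f x (c a : R) : is_derive x 1 f a -> is_derive x 1 (fun y => c * f y) (c * a).
Proof. by move=> df; exact: is_deriveZ. Qed.

Lemma der_comp f g x (a b : R) : is_derive (g x) 1 f a -> is_derive x 1 g b ->
  is_derive x 1 (fun y => f (g y)) (a * b).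
Proof. by move=> df dg; exact: is_derive1_comp. Qed.

Lemma der_pow f n x (a : R) : is_derive x 1 f a ->
  is_derive x 1 (fun y => f y ^+ n) (n%:R * f x ^+ n.-1 * a).
Proof. by move=> df; have := is_deriveX n df; rewrite exprfctE. Qed.

(** Mean value theorem for g - f and g + f; it stands in for integrating the inequality between the
    derivatives. *)
Lemma deriv_dominated f f' g g' (b x : R) : b <= x ->
  (forall y, b <= y <= x -> is_derive y 1 f (f' y)) ->
  (forall y, b <= y <= x -> is_derive y 1 g (g' y)) ->
  (forall y, b <= y <= x -> `|f' y| <= g' y) ->
  `|f x - f b| <= g x - g b.
Proof.
move=> bx df dg fg.
have cont (k k' : R -> R) : (forall y, b <= y <= x -> is_derive y 1 k (k' y)) ->
    {within `[b, x], continuous k}.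
  move=> dk; apply: derivable_within_continuous => y; rewrite in_itv/= => /dk dky.
  exact: ex_derive.
have key (s : R) : s = 1 \/ s = - 1 -> s * (f x - f b) <= g x - g b.
  move=> s1; pose k y := g y - s * f y.
  have dk y : b <= y <= x -> is_derive y 1 k (g' y - s * f' y).
    move=> yb; have := df _ yb; have := dg _ yb => ? ?.
    by apply: der_sub => //; exact: der_scale.
  have [|c cI H] := @MVT_segment R k (fun y => g' y - s * f' y) b x bx _ (cont _ _ dk).
    by move=> y yI; apply: dk; move: yI; rewrite in_itv/= => /andP[/ltW -> /ltW ->].
  have : 0 <= k x - k b.
    rewrite H mulr_ge0 ?subr_ge0//.
    move: cI; rewrite in_itv/= => /fg; rewrite ler_norml => /andP[h1 h2].
    by case: s1 => ->; lra.
  rewrite /k; lra.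
rewrite ler_norml; have := key 1 (or_introl erefl); have := key (-1) (or_intror erefl).
by move=> h1 h2; apply/andP; split; lra.
Qed.

Lemma taylor_flat_right D N (b x M : R) : b <= x ->
  (forall n y, b <= y <= x -> is_derive y 1 (D n) (D n.+1 y)) ->
  (forall n, D n b = 0) ->
  (forall y, b <= y <= x -> `|D N y| <= M) ->
  `|D 0%N x| <= M * (x - b) ^+ N / N`!%:R.
Proof.
elim: N D x => [|N IH] D x bx dD D0 DM.
  by rewrite expr0 mulr1 fact0 divr1; apply: DM; rewrite lexx bx.
pose g' y := M * (y - b) ^+ N / N`!%:R.
pose g y := M * (y - b) ^+ N.+1 / N.+1`!%:R.
have -> : D 0%N x = D 0%N x - D 0%N b by rewrite D0 subr0.
rewrite -[leRHS]subr0 (_ : 0 = g b); last by rewrite /g subrr expr0n mulr0 mul0r.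
apply: (@deriv_dominated _ (D 1%N) g g') => // [y yb|y /andP[yb yx]].
- have FE : N.+1`!%:R = N.+1%:R * N`!%:R :> R by rewrite factS natrM.
  have F0 : N`!%:R != 0 :> R by rewrite pnatr_eq0 -lt0n fact_gt0.
  have N0 : N.+1%:R != 0 :> R by rewrite pnatr_eq0.
  rewrite /g /g' FE; under [X in is_derive _ _ X]eq_fun do rewrite mulrAC.
  apply: (is_derive_eq (der_scale _ (der_pow N.+1 (der_sub (der_id y) (der_cst b y))))).
  by rewrite /=; field; rewrite ?nat1r ?natr1 F0 N0.
- apply: (IH (fun n => D n.+1)) => // [n z /andP[zb zy]|z /andP[zb zy]].
    by apply: dD; rewrite zb (le_trans zy).
  by apply: DM; rewrite zb (le_trans zy).
Qed.

Lemma is_derive_reflect f x df : is_derive (- x) 1 f df ->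
  is_derive x 1 (fun y => f (- y)) (- df).
Proof.
move=> dfx.
have dN : is_derive x 1 (fun y : R => - y) (- 1).
  exact: is_deriveN.
by have := der_comp dfx dN; rewrite mulrN1.
Qed.

Lemma taylor_flat_left D N (b x M : R) : x <= b ->
  (forall n y, x <= y <= b -> is_derive y 1 (D n) (D n.+1 y)) ->
  (forall n, D n b = 0) ->
  (forall y, x <= y <= b -> `|D N y| <= M) ->
  `|D 0%N x| <= M * (b - x) ^+ N / N`!%:R.
Proof.
move=> xb dD D0 DM.
pose E n y := (-1) ^+ n * D n (- y).
have := @taylor_flat_right E N (- b) (- x) M.
rewrite /E expr0 mul1r !opprK (addrC (- x)); apply.
- by rewrite lerN2.
- move=> n y /andP[by_ yx].
  have yb : x <= - y <= b by apply/andP; split; lra.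
  have := is_derive_reflect (dD n (- y) yb) => dDy.
  rewrite exprS mulN1r mulNr -mulrN.
  exact: der_scale.
- by move=> n; rewrite ?opprK D0 mulr0.
- move=> y /andP[by_ yx]; rewrite normrM normrX normrN1 expr1n mul1r.
  by apply: DM; apply/andP; split; lra.
Qed.

(** A function is carried together with all its derivatives: sums, products and dilations are formed
    on whole sequences, so smoothness is never proved separately. *)
Definition fam D := forall n x, is_derive x 1 (D n) (D n.+1 x).

(** The same [rho] governs the order of differentiation and the growth in x: Taylor coefficients at
    0 bounded by [A * rho ^+ n] yield exactly this at every point, and types add under products. *)
Definition ebound rho A D :=
  forall n x, `|D n x| <= A * rho ^+ n * expR (rho * `|x|).

(* Restrictions to the real line of entire functions of exponential type rho,
   described through their derivatives. *)
Definition etype rho A h := exists D, [/\ D 0%N = h, fam D & ebound rho A D].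

Lemma fam_derive1n D n : fam D -> derive1n n (D 0%N) = D n.
Proof.
move=> fD; elim: n => [//|n IH]; rewrite derive1nS IH.
by apply/funext => x; rewrite derive1E; have := fD n x => ?; exact: derive_val.
Qed.

Lemma fam_continuous D n : fam D -> continuous (D n).
Proof.
move=> fD x; apply/differentiable_continuous/derivable1_diffP.
by have := fD n x => ?; exact: ex_derive.
Qed.

Lemma etype_continuous rho A h : etype rho A h -> continuous h.
Proof. by move=> [D [<- fD _]]; exact: fam_continuous. Qed.

Lemma etype_ge0 rho A h : etype rho A h -> 0 <= A.
Proof.
move=> [D [_ _ /(_ 0%N 0)]]; rewrite normr0 mulr0 expR0 mulr1 expr0 mulr1.
exact: le_trans.
Qed.

Lemma etype_le rho A rho' A' h : 0 <= rho <= rho' -> A <= A' ->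
  etype rho A h -> etype rho' A' h.
Proof.
move=> /andP[r0 rr'] AA' eh; have A0 := etype_ge0 eh.
case: eh => D [D0 fD bD]; exists D; split => // n x.
rewrite (le_trans (bD n x))//; apply: ler_pM; rewrite ?expR_ge0//.
- by rewrite mulr_ge0// exprn_ge0.
- by apply: ler_pM; rewrite ?exprn_ge0// lerXn2r// nnegrE (le_trans r0).
- by rewrite ler_expR ler_wpM2r.
Qed.

Lemma etypeD rho A B h k : etype rho A h -> etype rho B k ->
  etype rho (A + B) (fun x => h x + k x).
Proof.
move=> [D [<- fD bD]] [E [<- fE bE]]; exists (fun n x => D n x + E n x); split => //.
- move=> n x; have := fD n x; have := fE n x => ? ?.
  exact: der_add.
- by move=> n x; rewrite (le_trans (ler_normD _ _))// !mulrDl lerD.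
Qed.

Lemma etypeZ rho A h (c : R) : etype rho A h -> etype rho (`|c| * A) (fun x => c * h x).
Proof.
move=> [D [<- fD bD]]; exists (fun n x => c * D n x); split => //.
- move=> n x; have := fD n x => ?.
  exact: der_scale.
- by move=> n x; rewrite normrM -!mulrA ler_wpM2l// mulrA.
Qed.

Lemma etype_scale rho A h (l : R) : etype rho A h ->
  etype (`|l| * rho) A (fun x => h (l * x)).
Proof.
move=> [D [<- fD bD]]; exists (fun n x => l ^+ n * D n (l * x)); split => //.
- by apply/funext => x; rewrite expr0 mul1r.
- move=> n x.
  have d1 : is_derive x 1 (fun y => l * y) l by have := der_scale l (der_id x); rewrite mulr1.
  have := der_scale (l ^+ n) (der_comp (fD n (l * x)) d1).
  by rewrite exprSr mulrA mulrAC.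
- move=> n x; rewrite normrM normrX exprMn (_ : _ * _ * expR _ =
    `|l| ^+ n * (A * rho ^+ n * expR (rho * `|l * x|))).
    by rewrite ler_wpM2l ?exprn_ge0.
  by rewrite normrM (_ : `|l| * rho * `|x| = rho * (`|l| * `|x|)); ring.
Qed.

(** The n-th derivative of a product as a sum of 2^n terms, without binomial coefficients: both the
    derivative rule and the bound by (rho + sig)^n become direct inductions. *)
Fixpoint leibniz n D E x : R :=
  if n is m.+1 then leibniz m (fun i => D i.+1) E x + leibniz m D (fun i => E i.+1) x
  else D 0%N x * E 0%N x.

Lemma etypeM rho sig A B h k : 0 <= rho -> 0 <= sig -> etype rho A h -> etype sig B k ->
  etype (rho + sig) (A * B) (fun x => h x * k x).
Proof.
move=> r0 s0 eh ek; have A0 := etype_ge0 eh; have B0 := etype_ge0 ek.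
case: eh => D [<- fD bD]; case: ek => E [<- fE bE].
exists (fun n => leibniz n D E); split => //.
- move=> n x; elim: n D E fD fE {bD bE} => [|n IH] D E fD fE.
    have := fD 0%N x; have := fE 0%N x => ? ?.
    exact: der_mul.
  have := IH (fun i => D i.+1) E (fun n x => fD n.+1 x) fE.
  have := IH D (fun i => E i.+1) fD (fun n x => fE n.+1 x) => ? ?.
  exact: der_add.
- move=> n x; elim: n D E A B A0 B0 {fD fE} bD bE => [|n IH] D E A B A0 B0 bD bE.
    rewrite expr0 mulr1 /= normrM mulrDl expRD mulrACA; apply: ler_pM => //.
      by have := bD 0%N x; rewrite expr0 mulr1.
    by have := bE 0%N x; rewrite expr0 mulr1.
  rewrite /= (le_trans (ler_normD _ _))//.
  have h1 := IH (fun i => D i.+1) E (A * rho) B (mulr_ge0 A0 r0) B0.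
  have h2 := IH D (fun i => E i.+1) A (B * sig) A0 (mulr_ge0 B0 s0).
  rewrite (_ : A * B * _ * _ = A * rho * B * (rho + sig) ^+ n * expR ((rho + sig) * `|x|) +
    A * (B * sig) * (rho + sig) ^+ n * expR ((rho + sig) * `|x|)); last by rewrite exprS; ring.
  by rewrite lerD// ?h1 ?h2// => m y; rewrite -?(mulrA _ rho) -?(mulrA _ sig) -exprS.
Qed.

Lemma etype_derive rho A h : etype rho A h -> etype rho (A * rho) (derive1 h).
Proof.
move=> [D [<- fD bD]]; exists (fun n => D n.+1); split.
- by rewrite -derive1n1 fam_derive1n.
- by move=> n x; exact: fD.
- by move=> n x; rewrite -(mulrA A) -exprS.
Qed.

Lemma etype_cst rho (c : R) : 0 <= rho -> etype rho `|c| (fun=> c).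
Proof.
move=> r0; exists (fun n => if n is 0%N then cst c else cst 0); split => //.
- by case=> [|n] x; exact: is_derive_cst.
- case=> [|n] x /=; last by rewrite normr0 !mulr_ge0 ?expR_ge0 ?exprn_ge0.
  by rewrite expr0 mulr1 ler_peMr// -expR0 ler_expR mulr_ge0.
Qed.

(** A polynomial factor costs an arbitrarily small type, at the price of a large constant. *)
Lemma etype_id rho : 0 < rho -> etype rho rho^-1 id.
Proof.
move=> r0; have rV : 0 <= rho^-1 by rewrite invr_ge0 ltW.
exists (fun n => if n is m.+1 then if m is 0%N then cst 1 else cst 0 else id); split => //.
- by case=> [|[|n]] x; [exact: is_derive_id|exact: is_derive_cst|exact: is_derive_cst].
- have e1 x : 1 + rho * `|x| <= expR (rho * `|x|) by exact: expR_ge1Dx.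
  have r1 x : 0 <= rho * `|x| by rewrite mulr_ge0// ltW.
  case=> [|[|n]] x /=.
  + rewrite expr0 mulr1 -(ler_pM2l r0) mulVKf ?gt_eqF//.
    by have := e1 x; lra.
  + by rewrite expr1 mulVf ?gt_eqF// mul1r normr1; have := e1 x; have := r1 x; lra.
  + by rewrite normr0 mulr_ge0 ?expR_ge0// mulr_ge0// exprn_ge0// ltW.
Qed.

(** Exponential generating function: the power series whose n-th derivative at 0 is [d n]. *)
Definition ev (d : nat -> R) x : R := limn (pseries (fun n => d n / n`!%:R) x).

Lemma exp_coeff_series_le (d : nat -> R) rho A x : (forall n, `|d n| <= A * rho ^+ n) ->
  forall n, `|d n / n`!%:R * x ^+ n| <= A * exp_coeff (rho * `|x|) n.
Proof.
move=> dA n; rewrite /exp_coeff /= exprMn !normrM normrX normfV [`|n`!%:R|]ger0_norm//.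
rewrite mulrAC !mulrA; apply: ler_wpM2r; first by rewrite invr_ge0.
by apply: ler_wpM2r => //; exact: exprn_ge0.
Qed.

Lemma is_cvg_ev_norm (d : nat -> R) rho A x : (forall n, `|d n| <= A * rho ^+ n) ->
  cvgn (series (fun n => `|d n / n`!%:R * x ^+ n|)).
Proof.
move=> dA; apply: (@series_le_cvg _ _ (fun n => A * exp_coeff (rho * `|x|) n)) => //.
- move=> n; rewrite (le_trans _ (exp_coeff_series_le x dA n))//.
- exact: exp_coeff_series_le.
- exact: (@is_cvg_seriesZ _ _ A (is_cvg_series_exp_coeff (rho * `|x|))).
Qed.

Lemma is_cvg_ev (d : nat -> R) rho A x : (forall n, `|d n| <= A * rho ^+ n) ->
  cvgn (pseries (fun n => d n / n`!%:R) x).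
Proof. by move=> dA; apply: normed_cvg; exact: is_cvg_ev_norm dA. Qed.

Lemma ev_le (d : nat -> R) rho A x : (forall n, `|d n| <= A * rho ^+ n) ->
  `|ev d x| <= A * expR (rho * `|x|).
Proof.
move=> dA; rewrite (le_trans (lim_series_norm (is_cvg_ev_norm (x := x) dA)))//.
have cZ : cvgn (series (fun n => A * exp_coeff (rho * `|x|) n)).
  exact: (@is_cvg_seriesZ _ _ A (is_cvg_series_exp_coeff (rho * `|x|))).
rewrite (le_trans (lim_series_le (is_cvg_ev_norm (x := x) dA) cZ _))//.
  exact: exp_coeff_series_le.
have := lim_seriesZ A (is_cvg_series_exp_coeff (rho * `|x|)).
by rewrite /GRing.scale /= => ->.
Qed.

Lemma ev0 (d : nat -> R) : ev d 0 = d 0%N.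
Proof.
apply/cvg_lim => //; rewrite -(cvg_shiftn 1).
rewrite (_ : (fun _ => _) = fun=> d 0%N); first exact: cvg_cst.
apply/funext => n; rewrite addn1 /pseries /series /= big_nat_recl// big1 => [|i _].
  by rewrite expr0 fact0 divr1 mulr1 addr0.
by rewrite exprS mul0r mulr0.
Qed.

Lemma fam_ev (d : nat -> R) rho A : (forall n, `|d n| <= A * rho ^+ n) ->
  fam (fun n => ev (fun m => d (n + m)%N)).
Proof.
have shift (c : nat -> R) r B : (forall n, `|c n| <= B * r ^+ n) ->
    (forall n, `|c n.+1| <= (B * r) * r ^+ n).
  by move=> cB n; rewrite -mulrA -exprS.
have diffs (c : nat -> R) : pseries_diffs (fun n => c n / n`!%:R) =
    fun n => c n.+1 / n`!%:R.
  apply/funext => n; rewrite /pseries_diffs factS natrM invfM.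
  have F0 : n`!%:R != 0 :> R by rewrite pnatr_eq0 -lt0n fact_gt0.
  have N0 : n.+1%:R != 0 :> R by rewrite pnatr_eq0.
  by field; rewrite ?nat1r ?natr1 F0 N0.
have key (c : nat -> R) r B x : (forall n, `|c n| <= B * r ^+ n) ->
    is_derive x 1 (ev c) (ev (fun m => c m.+1) x).
  move=> cB; rewrite /ev -diffs.
  apply: (@pseries_snd_diffs R _ (`|x| + 1)).
  - exact: is_cvg_ev cB.
  - by rewrite diffs; exact: is_cvg_ev (shift _ _ _ cB).
  - rewrite diffs; have := diffs (fun n => c n.+1) => ->.
    exact: is_cvg_ev (shift _ _ _ (shift _ _ _ cB)).
  - by rewrite [`|_ + 1|]ger0_norm ?addr_ge0// ltrDl.
move=> dA n x.
have := key (fun m => d (n + m)%N) rho (A * rho ^+ n) x.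
rewrite (_ : (fun m => d (n + m.+1)%N) = (fun m => d (n.+1 + m)%N)); last first.
  by apply/funext => m; rewrite addnS.
by apply => m; rewrite -mulrA -exprD.
Qed.

Lemma etype_ev (d : nat -> R) rho A : (forall n, `|d n| <= A * rho ^+ n) ->
  etype rho A (ev d).
Proof.
move=> dA; exists (fun n => ev (fun m => d (n + m)%N)); split => //.
- exact: fam_ev dA.
- move=> n x; apply: ev_le => m.
  by rewrite -mulrA -exprD.
Qed.

(** The Taylor remainder of order N at 0 is at most a constant times (rho |x|)^N / N!, which tends
    to 0. *)
Lemma etype_flat0 rho A D : fam D -> ebound rho A D -> 0 <= rho -> 0 <= A ->
  (forall n, D n 0 = 0) -> forall x, D 0%N x = 0.
Proof.
move=> fD bD r0 A0 D0 x.
have H N : `|D 0%N x| <= A * expR (rho * `|x|) * exp_coeff (rho * `|x|) N.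
  have M y : `|y| <= `|x| -> `|D N y| <= A * rho ^+ N * expR (rho * `|x|).
    move=> yx; rewrite (le_trans (bD _ _))// ler_wpM2l ?mulr_ge0 ?exprn_ge0//.
    by rewrite ler_expR ler_wpM2l.
  rewrite (_ : _ * exp_coeff _ _ = A * rho ^+ N * expR (rho * `|x|) * `|x| ^+ N / N`!%:R).
    have [x0|x0] := leP 0 x.
      have -> : `|x| ^+ N = (x - 0) ^+ N by rewrite subr0 ger0_norm.
      apply: taylor_flat_right => // y /andP[y0 yx]; apply: M.
      by rewrite !ger0_norm// (le_trans y0).
    have -> : `|x| ^+ N = (0 - x) ^+ N by rewrite sub0r ltr0_norm.
    apply: taylor_flat_left => // [|y /andP[y0 yx]]; first exact: ltW.
    by apply: M; rewrite (ltr0_norm x0) ler0_norm// lerN2.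
  rewrite /exp_coeff /= exprMn; ring.
apply/eqP; rewrite -normr_eq0 eq_le normr_ge0 andbT.
have c0 : (fun N => A * expR (rho * `|x|) * exp_coeff (rho * `|x|) N) @ \oo --> (0 : R).
  rewrite -(mulr0 (A * expR (rho * `|x|))); apply: cvgM; first exact: cvg_cst.
  exact: (cvg_series_cvg_0 (is_cvg_series_exp_coeff _)).
rewrite -(cvg_lim _ c0)//; apply: limr_ge; first by apply/cvg_ex; exists 0.
exact: nearW.
Qed.

(** The difference between h(x + t) and the Taylor series is, as a function of t, again of
    exponential type, and it is flat at 0. *)
Lemma etype_taylor rho A D x t : 0 <= rho -> fam D -> ebound rho A D ->
  D 0%N (x + t) = ev (fun n => D n x) t.
Proof.
move=> r0 fD bD.
have A0 : 0 <= A by apply: (@etype_ge0 rho A (D 0%N)); exists D.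
pose B := A * expR (rho * `|x|).
have B0 : 0 <= B by rewrite mulr_ge0 ?expR_ge0.
have dB n : `|D n x| <= B * rho ^+ n by rewrite mulrAC.
pose E n t := D n (x + t) - ev (fun m => D (n + m)%N x) t.
suff : E 0%N t = 0 by move/eqP; rewrite subr_eq0 => /eqP.
apply: (@etype_flat0 rho (B + B)) => //.
- move=> n y; rewrite /E; have := fam_ev dB n y => de.
  have ds : is_derive y 1 (fun t => x + t) 1.
    by have := der_add (der_cst x y) (der_id y); rewrite add0r.
  have := der_comp (fD n (x + y)) ds.
  rewrite mulr1 => dc; exact: der_sub.
- move=> n y; rewrite (le_trans (ler_normB _ _))// !mulrDl lerD//.
    rewrite (le_trans (bD _ _))// [leRHS](_ : _ =
      A * rho ^+ n * (expR (rho * `|x|) * expR (rho * `|y|))); last by rewrite /B; ring.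
    apply: ler_wpM2l; first by rewrite mulr_ge0// exprn_ge0.
    by rewrite -expRD ler_expR -mulrDr ler_wpM2l// ler_normD.
  by apply: ev_le => m; rewrite -mulrA -exprD.
- exact: addr_ge0.
- by move=> n; rewrite /E addr0 ev0 addn0 subrr.
Qed.

Lemma ev_recl (d : nat -> R) rho A t : (forall n, `|d n| <= A * rho ^+ n) -> 0 <= rho ->
  ev d t = d 0%N + t * ev (fun m => d m.+1 / m.+1%:R) t.
Proof.
move=> dA r0.
have A0 : 0 <= A by have := dA 0%N; rewrite expr0 mulr1; exact: le_trans.
have dA' n : `|d n.+1 / n.+1%:R| <= A * rho * rho ^+ n.
  rewrite normrM -mulrA -exprS; apply: le_trans (dA n.+1).
  by rewrite ler_piMr// normfV invf_le1 ?normr_gt0// ger0_norm// ler1n.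
apply/cvg_lim => //; rewrite -(cvg_shiftn 1).
rewrite (_ : (fun _ => _) = fun n => d 0%N +
    t * pseries (fun n => d n.+1 / n.+1%:R / n`!%:R) t n).
  apply: cvgD; first exact: cvg_cst.
  by apply: cvgM; [exact: cvg_cst|exact: is_cvg_ev dA'].
apply/funext => n; rewrite addn1 /pseries /series /= big_nat_recl//.
rewrite expr0 fact0 divr1 mulr1; congr (_ + _).
rewrite mulr_sumr; apply: eq_bigr => i _.
have F0 : i`!%:R != 0 :> R by rewrite pnatr_eq0 -lt0n fact_gt0.
have N0 : i.+1%:R != 0 :> R by rewrite pnatr_eq0.
by rewrite factS natrM exprS; field; rewrite ?nat1r ?natr1 F0 N0.
Qed.

Lemma evB (d e : nat -> R) rho A x : (forall n, `|d n| <= A * rho ^+ n) ->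
  (forall n, `|e n| <= A * rho ^+ n) -> ev d x - ev e x = ev (fun n => d n - e n) x.
Proof.
move=> dA eA; apply/esym/cvg_lim => //.
rewrite (_ : pseries _ x = fun n => pseries (fun n => d n / n`!%:R) x n -
   pseries (fun n => e n / n`!%:R) x n).
  exact: (cvgB (is_cvg_ev (x := x) dA) (is_cvg_ev (x := x) eA)).
apply/funext => n; rewrite /pseries /series /= -sumrB; apply: eq_bigr => i _.
by rewrite -mulrBl -mulrBl.
Qed.

(* The difference quotient (h(x + t) - h(x)) / t as a function of t. *)
Definition diffquot D x := ev (fun m => D m.+1 x / m.+1%:R).

(** Dividing by t only shifts the Taylor coefficients and divides them by m + 1, so the type does
    not grow. *)
Lemma etype_diffquot rho A D x : 0 <= rho -> fam D -> ebound rho A D ->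
  etype rho (A * rho * expR (rho * `|x|)) (diffquot D x).
Proof.
move=> r0 fD bD; apply: etype_ev => n.
have -> : A * rho * expR (rho * `|x|) * rho ^+ n = A * rho ^+ n.+1 * expR (rho * `|x|).
  by rewrite exprS; ring.
rewrite normrM (le_trans _ (bD n.+1 x))//.
by rewrite ler_piMr// normfV invf_le1 ?normr_gt0// ger0_norm// ler1n.
Qed.

Lemma diffquotE rho A D x t : 0 <= rho -> fam D -> ebound rho A D ->
  t * diffquot D x t = D 0%N (x + t) - D 0%N x.
Proof.
move=> r0 fD bD; rewrite (etype_taylor x t r0 fD bD).
rewrite (@ev_recl _ rho (A * expR (rho * `|x|)))//; first by rewrite addrAC subrr add0r.
by move=> n; rewrite mulrAC.
Qed.

Lemma diffquot0 D x : diffquot D x 0 = D 1%N x.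
Proof. by rewrite /diffquot ev0 divr1. Qed.

End DerivativeFamilies.

(** * Entire functions of exponential type *)

Section EntireExponentialType.
Variable R : realType.
Local Notation C := (Cplx R).

Lemma bernoulli_le (x : R) n : 0 <= x -> 1 + n%:R * x <= (1 + x) ^+ n.
Proof.
move=> x0; elim: n => [|n IH]; first by rewrite mul0r addr0 expr0.
have h : 0 <= n%:R * x * x by rewrite !mulr_ge0.
rewrite exprS (le_trans _ (ler_wpM2l _ IH)) ?addr_ge0//.
rewrite -natr1 mulrDl; set y := n%:R * x in h *; lra.
Qed.

(** Stirling in the form n! <= e n (n / e)^n. The induction step is e (1 - 1 / (n + 2))^(n + 2) <=
    1, from 1 - y <= exp (- y). *)
Lemma fact_stirling_le n :
  n.+1`!%:R * expR n.+1%:R <= expR 1 * n.+1%:R ^+ n.+2 :> R.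
Proof.
elim: n => [|n IH]; first by rewrite (_ : 1`! = 1%N)// mul1r expr1n mulr1.
have n0 : 0 < n.+2%:R :> R by rewrite ltr0n.
have key : expR 1 * n.+1%:R ^+ n.+2 <= n.+2%:R ^+ n.+2 :> R.
  rewrite mulrC -ler_pdivlMr ?expR_gt0// mulrC -expRN -ler_pdivrMr ?exprn_gt0//.
  rewrite -expr_div_n.
  have -> : - 1 = n.+2%:R * - n.+2%:R^-1 :> R by rewrite mulrN divff// gt_eqF.
  rewrite expRM_natl lerXn2r ?nnegrE ?divr_ge0 ?expR_ge0//.
  rewrite (le_trans _ (expR_ge1Dx _))// ler_pdivrMr// mulrDl mul1r mulNr mulVf ?gt_eqF//.
  by rewrite -[n.+2%:R]natr1 addrK.
rewrite factS natrM -[in expR _](@natr1 _ n.+1) expRD.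
have -> : n.+2%:R * n.+1`!%:R * (expR n.+1%:R * expR 1) =
  n.+2%:R * expR 1 * (n.+1`!%:R * expR n.+1%:R) :> R by ring.
rewrite (le_trans (ler_wpM2l _ IH)) ?mulr_ge0 ?expR_ge0//.
rewrite [leLHS](_ : _ = n.+2%:R * expR 1 * (expR 1 * n.+1%:R ^+ n.+2)); last by ring.
rewrite (le_trans (ler_wpM2l _ key)) ?mulr_ge0 ?expR_ge0//.
by rewrite le_eqVlt; apply/orP; left; apply/eqP; rewrite [in RHS]exprS; ring.
Qed.

Lemma geometric_cvg0 (M q : R) : 0 <= q < 1 -> (fun n => M * q ^+ n) @ \oo --> (0 : R).
Proof.
move=> /andP[q0 q1]; rewrite -(mulr0 M); apply: cvgM; first exact: cvg_cst.
by apply: cvg_expr; rewrite ger0_norm.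
Qed.

Section Restriction.
Variables (F : C -> C) (tau : R).
Hypothesis tau0 : 0 < tau.
Hypothesis Fentire : entire F.
Hypothesis Ftype : exp_type_le tau F.

Let Fdiff z : cdiff F z. Proof. exact: derivable_cdiff. Qed.

Let Fbnd (r : R) : exists M : R, forall z, cmod z <= r -> cmod (F z) <= M.
Proof.
have [A HA] := Ftype (@ltr01 R); exists (`|A| * expR ((tau + 1) * r)) => z zr.
rewrite (le_trans (HA z))// (le_trans (ler_wpM2r (expR_ge0 _) (ler_norm A)))//.
by rewrite ler_wpM2l// ler_expR ler_wpM2l// addr_ge0// ltW.
Qed.

Let a := taylor_coef F.

(** Fix r1 strictly between tau and rho. Cauchy's estimate at radius n / r1, the minimiser of exp
    (r1 r) / r^n, and Stirling give n! |a_n| = O(n r1^n); Bernoulli's inequality absorbs the factor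
    n into (rho / r1)^n. *)
Lemma entire_coef_bound (rho : R) : tau < rho -> exists2 A : R, 0 <= A &
  forall n, cmod (a n) * n`!%:R <= A * rho ^+ n.
Proof.
move=> tr; pose r1 := tau + (rho - tau) / 2.
have t0 := tau0; have r10 : 0 < r1 by rewrite /r1; lra.
have r1r : r1 < rho by rewrite /r1; lra.
have rho0 : 0 < rho by lra.
have e0 : 0 < (rho - tau) / 2 by lra.
have [A HA] := Ftype e0; rewrite -/r1 in HA.
pose x := rho / r1 - 1.
have x0 : 0 < x by rewrite /x subr_gt0 ltr_pdivlMr// mul1r.
have xV : 0 <= x^-1 by rewrite invr_ge0 ltW.
have rho0' := ltW rho0; have r10' := ltW r10.
pose B := 2 * `|A|; have B0 : 0 <= B by rewrite mulr_ge0.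
exists (B * expR r1 + B * expR 1 / x).
  by rewrite addr_ge0 ?mulr_ge0 ?expR_ge0.
have bnd n (r : R) : 0 < r -> cmod (a n) <= B * expR (r1 * r) / r ^+ n.
  move=> rp; rewrite -(mulrA 2); apply: taylor_coef_le => // z <-.
  rewrite (le_trans (HA z))// ler_wpM2r ?expR_ge0//; exact: ler_norm.
case=> [|n].
  rewrite fact0 !expr0 !mulr1; have := bnd 0%N 1 ltr01; rewrite expr0 divr1 mulr1 => h.
  by rewrite (le_trans h)// lerDl !mulr_ge0 ?expR_ge0.
pose r := n.+1%:R / r1; have rp : 0 < r by rewrite divr_gt0.
have -> : (B * expR r1 + B * expR 1 / x) * rho ^+ n.+1 =
  B * expR r1 * rho ^+ n.+1 + B * expR 1 / x * rho ^+ n.+1 by ring.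
rewrite ler_wpDl ?mulr_ge0 ?expR_ge0 ?exprn_ge0//.
apply: (@le_trans _ _ (B * (expR 1 * n.+1%:R) * r1 ^+ n.+1)).
  rewrite (le_trans (ler_wpM2r _ (bnd n.+1 r rp)))//.
  rewrite /r mulrCA divff ?gt_eqF// mulr1 expr_div_n.
  rewrite [leLHS](_ : _ = B * r1 ^+ n.+1 * (n.+1`!%:R * expR n.+1%:R / n.+1%:R ^+ n.+1)).
    rewrite [leRHS](_ : _ = B * r1 ^+ n.+1 * (expR 1 * n.+1%:R)); last by ring.
    rewrite ler_wpM2l ?mulr_ge0 ?exprn_ge0//.
    rewrite ler_pdivrMr ?exprn_gt0 ?ltr0n// (le_trans (fact_stirling_le n))//.
    by rewrite [in leLHS]exprS mulrA.
  by field; rewrite ?nat1r ?natr1 !expf_neq0 ?gt_eqF ?ltr0n.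
have -> : r1 ^+ n.+1 = rho ^+ n.+1 / (1 + x) ^+ n.+1.
  rewrite /x (addrC 1) subrK expr_div_n; field.
  by rewrite !expf_neq0 ?gt_eqF.
have := bernoulli_le n.+1 (ltW x0) => hb.
have p0 : 0 < (1 + x) ^+ n.+1 by rewrite exprn_gt0// addr_gt0.
rewrite [leLHS](_ : _ = B * expR 1 * rho ^+ n.+1 * (n.+1%:R / (1 + x) ^+ n.+1)); last by ring.
rewrite [leRHS](_ : _ = B * expR 1 * rho ^+ n.+1 * x^-1); last by ring.
rewrite ler_wpM2l ?mulr_ge0 ?expR_ge0 ?exprn_ge0//.
rewrite ler_pdivrMr// mulrC ler_pdivlMr// (le_trans _ hb)// lerDr//.
Qed.

Lemma entire_taylor_cvg (w : C) : exists M : R, exists2 q : R, 0 <= q < 1 &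
  forall N, (0 < N)%N -> cmod (F w - \sum_(n < N) a n * w ^+ n) <= M * q ^+ N.
Proof.
have ws : cmod w < expR (cmod w).
  by rewrite (lt_le_trans _ (expR_ge1Dx _))// ltrDr.
have [M HM] := taylor_remainder Fdiff Fbnd ws.
exists M, (cmod w / expR (cmod w)) => //.
by rewrite divr_ge0 ?cmod_ge0 ?expR_ge0//= ltr_pdivrMr ?expR_gt0// mul1r.
Qed.

Lemma entire_real_ev (x : R) :
  complex.Re (F (ofreal x)) = ev (fun n => complex.Re (a n) * n`!%:R) x /\
  complex.Im (F (ofreal x)) = ev (fun n => complex.Im (a n) * n`!%:R) x.
Proof.
have [M [q q01 HM]] := entire_taylor_cvg (ofreal x).
have ofX n : (ofreal x : C) ^+ n = ofreal (x ^+ n) by rewrite /ofreal rmorphXn.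
have key (P : C -> R) : (forall z w, P (z + w) = P z + P w) -> (forall z, `|P z| <= cmod z) ->
    (forall z (t : R), P (z * ofreal t) = P z * t) -> (forall z, P (- z) = - P z) ->
    P (F (ofreal x)) = ev (fun n => P (a n) * n`!%:R) x.
  move=> PD Pn PZ PN; apply/esym/cvg_lim => //.
  have P0 : P 0 = 0 by have := Pn 0; rewrite cmod0 normr_le0 => /eqP.
  have psE N : pseries (fun n => P (a n) * n`!%:R / n`!%:R) x N =
      P (\sum_(n < N) a n * ofreal x ^+ n).
    rewrite /pseries /series /= big_mkord; elim: N => [|N IH]; first by rewrite !big_ord0 P0.
    by rewrite !big_ord_recr /= PD IH ofX PZ mulfK// pnatr_eq0 -lt0n fact_gt0.
  apply/cvgrPdist_le => e e0.
  have /cvgrPdist_le/(_ _ e0) := geometric_cvg0 M q01.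
  move=> [N0 _ HN0]; exists N0.+1 => // N /= hN.
  rewrite psE -PN -PD (le_trans (Pn _))//.
  have hN' : (0 < N)%N by exact: leq_ltn_trans hN.
  rewrite (le_trans (HM _ hN'))//.
  by have := HN0 N (ltnW hN); rewrite /= sub0r normrN; apply: le_trans; exact: ler_norm.
split; apply: key => *; rewrite ?cRe_D ?cIm_D ?cRe_N ?cIm_N ?cRe_M ?cIm_M //=.
- exact: normr_Re_cmod.
- by rewrite mulr0 subr0.
- exact: normr_Im_cmod.
- by rewrite mulr0 add0r.
Qed.

Lemma coef_part_bound (P : C -> R) (rho A : R) : (forall z, `|P z| <= cmod z) ->
  (forall n, cmod (a n) * n`!%:R <= A * rho ^+ n) ->
  forall n, `|P (a n) * n`!%:R| <= A * rho ^+ n.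
Proof.
move=> Pn H n; rewrite normrM [`|n`!%:R|]ger0_norm// (le_trans _ (H n))//.
by rewrite ler_wpM2r.
Qed.

(** On the real line Re F and Im F are power series with coefficients Re a_n and Im a_n, so the
    squared modulus is a sum of two squares and the type doubles. *)
Lemma entire_sqr_etype (rho : R) : tau < rho -> exists A : R,
  etype (rho + rho) A (fun x => cmod (F (ofreal x)) ^+ 2).
Proof.
move=> tr; have [A A0 HA] := entire_coef_bound tr.
have t0 := tau0; have r0 : 0 <= rho by lra.
have e1 := etype_ev (coef_part_bound (@normr_Re_cmod R) HA).
have e2 := etype_ev (coef_part_bound (@normr_Im_cmod R) HA).
exists (A * A + A * A).
have -> : (fun x => cmod (F (ofreal x)) ^+ 2) = fun x =>
   ev (fun n => complex.Re (a n) * n`!%:R) x * ev (fun n => complex.Re (a n) * n`!%:R) x +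
   ev (fun n => complex.Im (a n) * n`!%:R) x * ev (fun n => complex.Im (a n) * n`!%:R) x.
  apply/funext => x; rewrite cmod_sqr; have [-> ->] := entire_real_ev x.
  by rewrite !expr2.
by apply: etypeD; exact: etypeM.
Qed.

Lemma entire_eq0_real : (forall x : R, F (ofreal x) = 0) -> forall z, F z = 0.
Proof.
move=> F0 z.
have tr : tau < tau + 1 by lra.
have [A A0 HA] := entire_coef_bound tr.
have key (P : C -> R) : (forall z, `|P z| <= cmod z) ->
    (forall x, ev (fun n => P (a n) * n`!%:R) x = 0) -> forall n, P (a n) = 0.
  move=> Pn H n.
  have fE := fam_ev (coef_part_bound Pn HA).
  have := @fam_derive1n R _ n fE.
  rewrite (_ : ev (fun m => P (a (0 + m)%N) * (0 + m)`!%:R) = cst 0); last first.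
    by apply/funext => x; exact: H.
  move=> /(congr1 (fun f => f 0)); rewrite ev0 addn0.
  have -> : derive1n n (cst 0 : R -> R) = cst 0.
    elim: n => // n IH; rewrite derive1nS IH; apply/funext => x.
    by rewrite derive1_cst.
  move=> /esym/eqP; rewrite mulf_eq0 => /orP[/eqP//|].
  by rewrite pnatr_eq0 -leqn0 leqNgt fact_gt0.
have an n : a n = 0.
  apply: eq_ReIm.
    by apply: (key (@complex.Re R) (@normr_Re_cmod R)) => x; rewrite -(entire_real_ev x).1 F0.
  by apply: (key (@complex.Im R) (@normr_Im_cmod R)) => x; rewrite -(entire_real_ev x).2 F0.
have [M [q q01 HM]] := entire_taylor_cvg z.
apply/eqP; rewrite -cmod_eq0 eq_le cmod_ge0 andbT.
have c0 := geometric_cvg0 M q01.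
rewrite -(cvg_lim _ c0)//; apply: limr_ge; first by apply/cvg_ex; exists 0.
exists 1%N => // N /= N0; have := HM N N0.
by rewrite big1 ?subr0// => i _; rewrite an mul0r.
Qed.

End Restriction.
End EntireExponentialType.

(** * A Bernstein-type inequality *)

Section DerivativeBound.
Variable R : realType.
Implicit Types (f h : R -> R) (D : nat -> R -> R) (rho A s x y : R).

Fixpoint fdiff n s f y : R :=
  if n is m.+1 then fdiff m s f (y + s) - fdiff m s f y else f y.

Lemma fdiff_derive D n s k y : fam D ->
  is_derive y 1 (fdiff n s (D k)) (fdiff n s (D k.+1) y).
Proof.
move=> fD; elim: n y => [|n IH] y /=; first exact: fD.
apply: der_sub => //.
have ds : is_derive y 1 (fun t => t + s) 1.
  by have := der_add (der_id y) (der_cst s y); rewrite addr0.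
by have := der_comp (g := fun t => t + s) (IH (y + s)) ds; rewrite mulr1.
Qed.

Lemma fdiff_le D n s k y (M : R) : 0 <= s -> fam D ->
  (forall z, y <= z <= y + n%:R * s -> `|D (k + n)%N z| <= M) ->
  `|fdiff n s (D k) y| <= s ^+ n * M.
Proof.
move=> s0 fD; elim: n k y => [|n IH] k y HM.
  by rewrite expr0 mul1r; have := HM y; rewrite mul0r addr0 addn0 lexx; apply.
rewrite /=.
have := @deriv_dominated R (fdiff n s (D k)) (fdiff n s (D k.+1))
  (fun z => s ^+ n * M * z) (fun=> s ^+ n * M) y (y + s).
rewrite lerDl => /(_ s0); rewrite -mulrBr (addrAC y) subrr add0r.
rewrite exprSr mulrAC; apply.
- by move=> z _; exact: fdiff_derive.
- by move=> z _; have := der_scale (s ^+ n * M) (der_id z); rewrite mulr1.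
- move=> z /andP[yz zy]; apply: IH => v /andP[zv vz].
  rewrite addSnnS; apply: HM; rewrite (le_trans yz zv)/= (le_trans vz)//.
  by rewrite -[n.+1%:R]nat1r mulrDl mul1r addrA lerD2r.
Qed.

Lemma alternating_bin_sumS n (F : nat -> R) :
  \sum_(i < n.+2) (-1) ^+ (n.+1 + i) * 'C(n.+1, i)%:R * F i =
  \sum_(i < n.+1) (-1) ^+ (n + i) * 'C(n, i)%:R * F i.+1 -
  \sum_(i < n.+1) (-1) ^+ (n + i) * 'C(n, i)%:R * F i.
Proof.
pose A := \sum_(i < n.+1) (-1) ^+ (n + i) * 'C(n, i.+1)%:R * F i.+1.
pose B := \sum_(i < n.+1) (-1) ^+ (n + i) * 'C(n, i)%:R * F i.+1.
have -> : \sum_(i < n.+1) (-1) ^+ (n + i) * 'C(n, i)%:R * F i = (-1) ^+ n * F 0%N - A.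
  transitivity (\sum_(i < n.+2) (-1) ^+ (n + i) * 'C(n, i)%:R * F i).
    by rewrite [RHS]big_ord_recr /= bin_small// mulr0 mul0r addr0.
  rewrite big_ord_recl /= addn0 bin0 mulr1 /A -sumrN; congr (_ + _).
  by apply: eq_bigr => i _; rewrite /bump /= add1n addnS exprS; ring.
have -> : \sum_(i < n.+2) (-1) ^+ (n.+1 + i) * 'C(n.+1, i)%:R * F i =
    (-1) ^+ n.+1 * F 0%N + (A + B).
  rewrite big_ord_recl /= addn0 bin0 mulr1 /A /B -big_split /=; congr (_ + _).
  by apply: eq_bigr => i _; rewrite /bump /= add1n binS natrD addSn addnS !exprS; ring.
by rewrite -/B exprS; ring.
Qed.

Lemma fdiffE n s f y : fdiff n s f y =
  \sum_(i < n.+1) (-1) ^+ (n + i) * 'C(n, i)%:R * f (y + i%:R * s).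
Proof.
elim: n y => [|n IH] y /=.
  by rewrite big_ord_recr big_ord0 /= add0r expr0 bin0 !mul1r mul0r addr0.
rewrite !IH (@alternating_bin_sumS n (fun i => f (y + i%:R * s))); congr (_ - _).
by apply: eq_bigr => i _; rewrite -[i.+1%:R]nat1r mulrDl mul1r addrA.
Qed.

(** Induction through (n + 1) C(2n + 2, n + 1) = 2 (2n + 1) C(2n, n). *)
Lemma bin_mid_ge n : (4 ^ n <= (n.*2).+1 * 'C(n.*2, n))%N.
Proof.
elim: n => [//|n IH].
have f1 := @bin_fact n.*2 n; have f2 := @bin_fact (n.+1).*2 n.+1.
have h1 : (n.*2 - n = n)%N by rewrite -addnn addnK.
have h2 : ((n.+1).*2 - n.+1 = n.+1)%N by rewrite -addnn addnK.
rewrite h1 in f1; rewrite h2 in f2.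
have {}f1 := f1 (leq_trans (leq_addr n n) (eq_leq (addnn n))).
have {}f2 := f2 (leq_trans (leq_addr n.+1 n.+1) (eq_leq (addnn n.+1))).
have F0 := fact_gt0 n.
have E : ('C((n.+1).*2, n.+1) * n.+1 = 2 * (n.*2).+1 * 'C(n.*2, n))%N.
  apply/eqP; rewrite -(@eqn_pmul2r (n.+1 * (n`! * n`!)))//; last by rewrite !muln_gt0 F0.
  apply/eqP; move: f2; rewrite doubleS !factS -f1 => f2.
  have -> : ('C((n.*2).+2, n.+1) * n.+1 * (n.+1 * (n`! * n`!)) =
     'C((n.*2).+2, n.+1) * (n.+1 * n`! * (n.+1 * n`!)))%N by ring.
  rewrite f2 (_ : (n.*2).+2 = 2 * n.+1)%N; last by rewrite -doubleS -mul2n.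
  by ring.
rewrite -(@leq_pmul2r n.+1)// -mulnA E expnS.
rewrite (@leq_trans (4 * ((n.*2).+1 * 'C(n.*2, n)) * n.+1))//.
  by rewrite leq_mul2r leq_mul2l IH orbT.
rewrite (_ : 4 * _ * n.+1 = (n.+1).*2 * (2 * (n.*2).+1 * 'C(n.*2, n)))%N.
  by rewrite leq_mul2r leqnSn orbT.
have -> : ((n.+1).*2 = 2 * n.+1)%N by rewrite mul2n.
set u := (n.*2).+1; set v := 'C(_, _); lia.
Qed.

Lemma sum_bin_row n : \sum_(i < n.+1) 'C(n, i)%:R = 2 ^+ n :> R.
Proof.
have := exprDn (1 : R) 1 n; rewrite -[1 + 1]/(2 : R) => ->.
by apply: eq_bigr => i _; rewrite !expr1n mulr1.
Qed.

(** In the 2n-th difference centred at 0 the coefficients sum to 4^n in modulus and the middle one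
    is at least 4^n / (2n + 1). Hence f 0 is controlled by the other samples, with only a linear
    loss, and by the difference itself. *)
Lemma center_le_fdiff n s f (M : R) :
  (forall i, (i <= n.*2)%N -> i != n -> `|f (- (n%:R * s) + i%:R * s)| <= M) -> 0 <= M ->
  `|f 0| <= (n.*2).+1%:R * (M + `|fdiff n.*2 s f (- (n%:R * s))| / 4 ^+ n).
Proof.
move=> HM M0.
have nn : (n < (n.*2).+1)%N by rewrite ltnS -addnn leq_addr.
pose c := Ordinal nn.
have := fdiffE n.*2 s f (- (n%:R * s)).
rewrite (bigD1 c)//= addNr; set S := \sum_(i < _ | _) _ => E.
have SM : `|S| <= 4 ^+ n * M.
  rewrite (le_trans (ler_norm_sum _ _ _))//.
  apply: (@le_trans _ _ (\sum_(i < (n.*2).+1) 'C(n.*2, i)%:R * M)).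
    rewrite [leRHS](bigD1 c)//= ler_wpDl ?mulr_ge0//.
    apply: ler_sum => i ic; rewrite !normrM normrX normrN1 expr1n mul1r.
    by rewrite [`|_%:R|]ger0_norm// ler_wpM2l// HM// -ltnS.
  by rewrite -mulr_suml sum_bin_row -mul2n exprM -natrX.
have C4 : 4 ^+ n <= (n.*2).+1%:R * 'C(n.*2, n)%:R :> R.
  by rewrite -natrX -natrM ler_nat bin_mid_ge.
have H : 'C(n.*2, n)%:R * `|f 0| <= `|fdiff n.*2 s f (- (n%:R * s))| + 4 ^+ n * M.
  have -> : 'C(n.*2, n)%:R * `|f 0| = `|(-1) ^+ (n.*2 + n) * 'C(n.*2, n)%:R * f 0|.
    by rewrite !normrM normrX normrN1 expr1n mul1r [`|_%:R|]ger0_norm.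
  rewrite -[X in `|X|](addrK S) -E (le_trans (ler_normB _ _))// lerD2l//.
have p4 : 0 < 4 ^+ n :> R by rewrite exprn_gt0.
rewrite -(ler_pM2l p4) (le_trans (ler_wpM2r (normr_ge0 _) C4))//.
rewrite -mulrA (le_trans (ler_wpM2l _ H))//.
rewrite le_eqVlt; apply/orP; left; apply/eqP; field.
exact: lt0r_neq0.
Qed.

Lemma double_succ_le_expn4 n : ((n.*2).+1 <= 4 ^ n)%N.
Proof.
elim: n => // m IH; rewrite expnS doubleS (@leq_trans (4 * (m.*2).+1))//.
  rewrite mulnS; exact: (leq_add (isT : (3 <= 4)%N) (leq_pmull m.*2 (isT : (0 < 4)%N))).
by rewrite leq_mul2l IH.
Qed.

Lemma expR1_le4 : expR 1 <= 4 :> R.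
Proof.
have h : (2^-1 : R) <= expR (- 2^-1).
  by rewrite (le_trans _ (expR_ge1Dx _))//; lra.
have h2 : expR (2^-1 : R) <= 2.
  by rewrite -[2 in leRHS]invrK -lef_pV2 ?posrE ?invr_gt0 ?expR_gt0// invrK -expRN.
have -> : expR 1 = expR 2^-1 * expR 2^-1 :> R by rewrite -expRD; congr expR; lra.
have -> : 4 = 2 * 2 :> R by ring.
by rewrite ler_pM ?expR_ge0.
Qed.

(** h'(x) is the value at t = 0 of q(t) = (h(x + t) - h(x)) / t, and at the other points of a grid
    of mesh s one has |q| <= 2 M / s. So [center_le_fdiff] applies; the 2n-th difference of q is
    tiny because q has type rho and s rho is small. *)
Lemma etype_derive_le rho A h : 0 < rho -> etype rho A h -> exists2 K : R, 0 <= K &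
  forall x (M : R), (forall y, `|y - x| <= (`|x| + 1) / 2 -> `|h y| <= M) ->
    `|derive1 h x| <= K * (1 + `|x|) * M + K * expR (- `|x|).
Proof.
move=> r0 eh; have A0 := etype_ge0 eh; case: eh => D [D0 fD bD].
have r0' := ltW r0.
(* With n about N0 |x|, the margin over rho lets exp n absorb both exp (rho |x|) and exp |x|. The
   mesh 1 / (8 N0) gives s rho <= 1/8 and keeps the n samples on each side within (|x| + 1) / 2 of
   x. *)
pose N0 := (Num.truncn (rho + 2)).+1.
have N0r : rho + 2 < N0%:R by rewrite truncnS_gt.
have N0p : 0 < N0%:R :> R by rewrite ltr0n.
pose s := (8 * N0%:R)^-1 : R.
have s0 : 0 < s by rewrite invr_gt0 mulr_gt0.
have sr : s * rho <= 8^-1.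
  rewrite /s invfM -mulrA ler_piMr ?invr_ge0// mulrC ler_pdivrMr// mul1r; lra.
exists (48 * N0%:R ^+ 2 + A * rho); first by rewrite addr_ge0 ?mulr_ge0 ?sqr_ge0.
move=> x M HM.
have M0 : 0 <= M.
  by apply: le_trans (HM x _); rewrite ?subrr ?normr0 ?divr_ge0 ?addr_ge0.
pose n := (N0 * (Num.truncn `|x|).+1)%N.
have nx1 : N0%:R * `|x| <= n%:R.
  by rewrite /n natrM ler_wpM2l// ltW// truncnS_gt.
have nx2 : n%:R <= N0%:R * (`|x| + 1).
  by rewrite /n natrM ler_wpM2l// -natr1 lerD2r truncn_le.
have n1 : 1 <= n%:R :> R by rewrite ler1n /n muln_gt0.
have [q [q0 fq bq]] := etype_diffquot x r0' fD bD.
have qE t : t * q 0%N t = h (x + t) - h x by rewrite q0 (diffquotE x t r0' fD bD) D0.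
have h'E : derive1 h x = q 0%N 0.
  by rewrite q0 diffquot0 -D0 -derive1n1 fam_derive1n.
rewrite h'E.
have ns : n%:R * s <= (`|x| + 1) / 2.
  rewrite /s ler_pdivrMr ?mulr_gt0//.
  have : 0 <= `|x| by []. nra.
have hc := @center_le_fdiff n s (q 0%N) (2 * M / s).
have {hc} hc : `|q 0%N 0| <= (n.*2).+1%:R *
    (2 * M / s + `|fdiff n.*2 s (q 0%N) (- (n%:R * s))| / 4 ^+ n).
  apply: hc; last by rewrite divr_ge0 ?mulr_ge0// ltW.
  move=> i i2 ine; set t := - _ + _.
  have tE : t = (i%:R - n%:R) * s by rewrite /t; ring.
  have st : s <= `|t|.
    rewrite tE normrM (gtr0_norm s0); apply: ler_peMl; first exact: ltW.
    move: ine; rewrite neq_ltn => /orP[lt|lt].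
      by rewrite distrC -natrB ?(ltnW lt)// normr_nat ler1n subn_gt0.
    by rewrite -natrB ?(ltnW lt)// normr_nat ler1n subn_gt0.
  have tn : `|t| <= n%:R * s.
    rewrite tE normrM (gtr0_norm s0) ler_wpM2r ?(ltW s0)//.
    rewrite ler_norml lerBrDr addrC subrr ler0n /= lerBlDr -natrD ler_nat addnn.
    exact: i2.
  have t0 : 0 < `|t| by exact: lt_le_trans st.
  rewrite -(ler_pM2l t0) -normrM qE (le_trans (ler_normB _ _))//.
  have hx : `|h x| <= M by apply: HM; rewrite subrr normr0 divr_ge0 ?addr_ge0.
  have hxt : `|h (x + t)| <= M.
    by apply: HM; rewrite (addrC x) addrK (le_trans tn).
  apply: (@le_trans _ _ (M * 2)); first by rewrite mulr2n mulrDr mulr1 lerD.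
  rewrite (_ : `|t| * _ = M * 2 * (`|t| / s)); last by ring.
  by rewrite ler_peMr ?mulr_ge0// ler_pdivlMr// mul1r.
rewrite (le_trans hc)// mulrDr; apply: lerD.
  have -> : 2 * M / s = 16 * N0%:R * M by rewrite /s invrK; ring.
  have n3 : (n.*2).+1%:R <= 3 * (N0%:R * (`|x| + 1)) :> R.
    by rewrite -natr1 -mul2n natrM; lra.
  have Ar : 0 <= A * rho by rewrite mulr_ge0.
  rewrite (le_trans (ler_wpM2r _ n3)) ?mulr_ge0//.
  rewrite [leLHS](_ : _ = 48 * N0%:R ^+ 2 * (1 + `|x|) * M); last by ring.
  by rewrite !ler_wpM2r ?addr_ge0// lerDl.
have err : `|fdiff n.*2 s (q 0%N) (- (n%:R * s))| <=
    s ^+ n.*2 * (A * rho * expR (rho * `|x|) * rho ^+ n.*2 * expR n%:R).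
  apply: fdiff_le => //; first exact: ltW.
  move=> z /andP[z1 z2]; rewrite add0n (le_trans (bq _ _))//.
  apply: ler_wpM2l; first by rewrite mulr_ge0 ?exprn_ge0// mulr_ge0 ?expR_ge0// mulr_ge0.
  rewrite ler_expR.
  have zn : `|z| <= n%:R * s.
    rewrite ler_norml z1 /= (le_trans z2)// -mul2n natrM.
    by rewrite le_eqVlt; apply/orP; left; apply/eqP; ring.
  rewrite (le_trans (ler_wpM2l r0' zn))// mulrC -mulrA ler_piMr//; lra.
have p4 : 0 < 4 ^+ n :> R by rewrite exprn_gt0.
apply: (@le_trans _ _ (A * rho * expR (- `|x|))); last first.
  by rewrite ler_wpM2r ?expR_ge0// lerDr mulr_ge0 ?sqr_ge0.
have ex : expR (rho * `|x|) <= 4 ^+ n * expR (- `|x|).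
  rewrite -ler_pdivrMr ?expR_gt0// -expRN opprK -expRD.
  apply: (@le_trans _ _ (expR n%:R)).
    by rewrite ler_expR; apply: le_trans nx1; have : 0 <= `|x| by []; nra.
  by rewrite -[n%:R]mulr1 expRM_natl lerXn2r ?nnegrE ?expR_ge0// expR1_le4.
have en : expR n%:R <= 4 ^+ n :> R.
  by rewrite -[n%:R]mulr1 expRM_natl lerXn2r ?nnegrE ?expR_ge0// expR1_le4.
have n4 : (n.*2).+1%:R <= 4 ^+ n :> R.
  by have := double_succ_le_expn4 n; rewrite -(@ler_nat R) natrX.
(* 64 = 4^3 pays for 2n + 1, for exp n and for exp (rho |x|) exp |x|, each at most 4^n. *)
have sr2 : (s * rho) ^+ n.*2 <= (64 ^+ n)^-1.
  rewrite -mul2n exprM -exprVn; apply: lerXn2r; rewrite ?nnegrE ?sqr_ge0 ?invr_ge0//.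
  rewrite (_ : 64^-1 = 8^-1 ^+ 2 :> R); last by field.
  by apply: lerXn2r; rewrite ?nnegrE ?invr_ge0// mulr_ge0// ltW.
have sp : 0 <= (s * rho) ^+ n.*2 by rewrite exprn_ge0// mulr_ge0// ltW.
rewrite (le_trans (ler_wpM2l _ (ler_wpM2r _ err))) ?invr_ge0 ?(ltW p4)//.
rewrite [leLHS](_ : _ = A * rho * ((n.*2).+1%:R * (s * rho) ^+ n.*2 *
   (expR (rho * `|x|) * expR n%:R) / 4 ^+ n)); last by rewrite exprMn; ring.
apply: ler_wpM2l; first exact: mulr_ge0.
rewrite ler_pdivrMr//.
apply: (@le_trans _ _ (4 ^+ n * (64 ^+ n)^-1 * ((4 ^+ n * expR (- `|x|)) * 4 ^+ n))).
  have q1 : (n.*2).+1%:R * (s * rho) ^+ n.*2 <= 4 ^+ n * (64 ^+ n)^-1 by apply: ler_pM.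
  have q2 : expR (rho * `|x|) * expR n%:R <= 4 ^+ n * expR (- `|x|) * 4 ^+ n.
    by apply: ler_pM; rewrite ?expR_ge0.
  by apply: ler_pM => //; rewrite mulr_ge0 ?expR_ge0.
rewrite (_ : 64 = 4 * 4 * 4 :> R); last by ring.
rewrite !exprMn [leLHS](_ : _ = expR (- `|x|)).
  by rewrite ler_peMr ?expR_ge0// exprn_ege1//; lra.
by field; rewrite gt_eqF.
Qed.

End DerivativeBound.

(** * The multiplier *)

Section Multiplier.
Variable R : realType.
Implicit Types (x : R).

Definition sin_fam n x : R := sin (x + n%:R * (pi / 2)).

Lemma fam_sin : fam sin_fam.
Proof.
move=> n x; rewrite /sin_fam.
have -> : x + n.+1%:R * (pi / 2) = x + n%:R * (pi / 2) + pi / 2 :> R.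
  by rewrite -[n.+1%:R]natr1; ring.
rewrite sinDpihalf.
have ds : is_derive x 1 (fun t => t + n%:R * (pi / 2)) 1.
  by have := der_add (der_id x) (der_cst (n%:R * (pi / 2)) x); rewrite addr0.
by have := der_comp (g := fun t => t + n%:R * (pi / 2)) (is_derive_sin (x + n%:R * (pi / 2))) ds; rewrite mulr1.
Qed.

Lemma ebound_sin : ebound 1 1 sin_fam.
Proof.
move=> n x; rewrite expr1n !mul1r (le_trans (sin_max _))//.
by rewrite -expR0 ler_expR.
Qed.

(** sin x / x as the difference quotient of sin at 0, so that no case distinction is needed at 0 and
    type 1 is inherited. *)
Definition sinc x : R := diffquot sin_fam 0 x.

Lemma sincE x : x * sinc x = sin x.
Proof.
rewrite /sinc (diffquotE 0 x ler01 fam_sin ebound_sin) /sin_fam.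
by rewrite mul0r !addr0 add0r sin0 subr0.
Qed.

Lemma sinc0 : sinc 0 = 1.
Proof. by rewrite /sinc diffquot0 /sin_fam add0r mul1r sin_pihalf. Qed.

Lemma etype_sinc : etype 1 1 sinc.
Proof.
have := etype_diffquot 0 ler01 fam_sin ebound_sin.
by rewrite normr0 mulr0 expR0 !mulr1.
Qed.

Lemma norm_sin_le x : `|sin x| <= `|x|.
Proof.
wlog x0 : x / 0 <= x => [H|].
  have [/H//|/ltW x0] := leP 0 x.
  by rewrite -normrN -sinN -[`|x|]normrN; apply: H; rewrite oppr_ge0.
have := @deriv_dominated R sin cos id (fun=> 1) 0 x x0.
by rewrite sin0 !subr0 (ger0_norm x0); apply=> y _; exact: cos_max.
Qed.

Lemma sinc_le1 x : `|sinc x| <= 1.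
Proof.
have [->|x0] := eqVneq x 0; first by rewrite sinc0 normr1.
rewrite -(@ler_pM2l _ `|x|) ?normr_gt0// -normrM sincE mulr1.
exact: norm_sin_le.
Qed.

Lemma sinc_leV x : `|x| * `|sinc x| <= 1.
Proof. by rewrite -normrM sincE sin_max. Qed.

(** The dilation factors add up to 1 - 2^-N, so every partial product has type at most 1. *)
Definition sinc_prod N x : R := \prod_(k < N) sinc (2 ^- k.+1 * x).

Lemma sinc_prodS N x : sinc_prod N.+1 x = sinc_prod N x * sinc (2 ^- N.+1 * x).
Proof. by rewrite /sinc_prod big_ord_recr. Qed.

Lemma halfS N : 2 ^- N.+1 = 2 ^- N / 2 :> R.
Proof. by rewrite exprSr invfM. Qed.

Lemma etype_sinc_prod N : etype (1 - 2 ^- N) 1 (sinc_prod N).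
Proof.
elim: N => [|N IH].
  rewrite expr0 invr1 subrr; have := etype_cst (1 : R) (lexx (0 : R)).
  rewrite normr1; congr etype; apply/funext => x.
  by rewrite /sinc_prod big_ord0.
have p : 0 < 2 ^- N.+1 :> R by rewrite invr_gt0 exprn_gt0.
have es := etype_scale (2 ^- N.+1) etype_sinc.
have h : 0 <= 1 - 2 ^- N :> R.
  by rewrite subr_ge0 invf_le1 ?exprn_gt0// exprn_ege1//; lra.
rewrite mulr1 (gtr0_norm p) in es.
have := etypeM h (ltW p) IH es.
rewrite mulr1 (_ : 1 - 2 ^- N + 2 ^- N.+1 = 1 - 2 ^- N.+1).
  by congr etype; apply/funext => x; rewrite sinc_prodS.
by rewrite halfS; field; rewrite expf_neq0.
Qed.

Lemma etype_sinc_prod1 N : etype 1 1 (sinc_prod N).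
Proof.
apply: etype_le (etype_sinc_prod N) => //.
rewrite subr_ge0 gerBl invr_ge0 exprn_ge0// andbT invf_le1 ?exprn_gt0//.
by rewrite exprn_ege1//; lra.
Qed.

(** The constant [l] measures how fast a new factor of the product tends to 1. Type 2 rather than 1
    pays for |x| exp |x| <= exp (2 |x|). *)
Lemma etype_sinc_sub1 (l : R) : 0 < l <= 1 -> etype 2 l (fun x => sinc (l * x) - 1).
Proof.
move=> /andP[l0 l1]; have [D [D0 fD bD]] := etype_sinc.
have E1 x : is_derive x 1 (fun y => l * y) l.
  by have := der_scale l (der_id x); rewrite mulr1.
exists (fun n x => if n is 0%N then D 0%N (l * x) - 1 else l ^+ n * D n (l * x)); split.
- by apply/funext => x; rewrite D0.
- case=> [|n] x.
    have := der_sub (der_comp (fD 0%N (l * x)) (E1 x)) (der_cst 1 x).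
    by rewrite subr0 mulrC expr1.
  have := der_scale (l ^+ n.+1) (der_comp (fD n.+1 (l * x)) (E1 x)).
  by rewrite mulrC -mulrA (mulrC _ (_ ^+ _)) mulrC -exprSr mulrC.
have ex x : expR `|l * x| <= expR `|x|.
  by rewrite ler_expR normrM gtr0_norm// ler_piMl.
case=> [|n] x.
  rewrite expr0 mulr1.
  have h : `|D 0%N (l * x) - 1| <= `|l * x| * expR `|x|.
    have -> : (1 : R) = D 0%N 0 by rewrite D0 sinc0.
    have bb y : `|y| <= `|l * x| -> `|D 1%N y| <= expR `|x|.
      move=> yl; rewrite (le_trans (bD _ _))// expr1n !mul1r.
      by rewrite (le_trans _ (ex x))// ler_expR.
    have gE (y : R) : is_derive y 1 (fun y => expR `|x| * y) (expR `|x|).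
      by have := der_scale (expR `|x|) (der_id y); rewrite mulr1.
    have [p|p] := leP 0 (l * x).
      have := @deriv_dominated R (D 0%N) (D 1%N) (fun y => expR `|x| * y) (fun=> expR `|x|) 0 (l * x)
        p (fun y _ => fD 0%N y) (fun y _ => gE y).
      rewrite mulr0 subr0 (mulrC (expR _)) (ger0_norm p); apply=> y /andP[y0 yl].
      by apply: bb; rewrite !ger0_norm.
    have := @deriv_dominated R (D 0%N) (D 1%N) (fun y => expR `|x| * y) (fun=> expR `|x|) (l * x) 0
      (ltW p) (fun y _ => fD 0%N y) (fun y _ => gE y).
    rewrite mulr0 sub0r -mulrN (mulrC (expR _)) (ltr0_norm p) distrC; apply=> y /andP[y0 yl].
    by apply: bb; rewrite (ltr0_norm p) ler0_norm// lerN2.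
  rewrite (le_trans h)// normrM (gtr0_norm l0) -mulrA; apply: ler_wpM2l; first exact: ltW.
  rewrite mulr_natl mulr2n expRD; apply: ler_wpM2r; first exact: expR_ge0.
  by rewrite (le_trans _ (expR_ge1Dx _))// lerDr.
rewrite normrM normrX (gtr0_norm l0) -mulrA exprS -mulrA; apply: ler_wpM2l; first exact: ltW.
apply: (@le_trans _ _ (1 * expR `|x|)).
  apply: ler_pM; rewrite ?exprn_ge0 ?(ltW l0)// ?exprn_ile1 ?(ltW l0)//.
  by rewrite (le_trans (bD _ _))// expr1n !mul1r.
apply: ler_pM; rewrite ?expR_ge0 ?exprn_ege1//; first by lra.
by rewrite ler_expR mulr_natl mulr2n lerDl.
Qed.

Let c N n : R := derive1n n (sinc_prod N) 0.

Let c_le N n : `|c N n| <= 1 * 1 ^+ n.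
Proof.
have [D [D0 fD bD]] := etype_sinc_prod1 N.
by have := bD n 0; rewrite -(fam_derive1n n fD) D0 normr0 mulr0 expR0 mulr1.
Qed.

(** Consecutive products differ by the old product times a factor sinc - 1: the type is 1 + 2 = 3
    and the constant 2^-(N + 1). *)
Let c_step N n : `|c N.+1 n - c N n| <= 2 ^- N.+1 * 3 ^+ n.
Proof.
have p : 0 < 2 ^- N.+1 :> R by rewrite invr_gt0 exprn_gt0.
have p1 : 0 < (2 ^- N.+1 : R) <= 1.
  by rewrite p /= invf_le1 ?exprn_gt0// exprn_ege1//; lra.
have := etypeM ler01 (ler0n _ 2) (etype_sinc_prod1 N) (etype_sinc_sub1 p1).
rewrite mul1r => -[E [E0 fE bE]].
have [D [D0 fD _]] := etype_sinc_prod1 N.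
have fDE : fam (fun n x => D n x + E n x).
  by move=> m x; apply: der_add; [exact: fD|exact: fE].
have := fam_derive1n n fDE.
rewrite (_ : (fun x => D 0%N x + E 0%N x) = sinc_prod N.+1); last first.
  by apply/funext => x; rewrite D0 E0 sinc_prodS; ring.
move=> /(congr1 (fun f => f 0)) => H.
rewrite /c H -D0 (fam_derive1n n fD) addrC addKr.
have := bE n 0; rewrite normr0 mulr0 expR0 mulr1.
by rewrite (_ : 1 + 2 = 3 :> R)//; lra.
Qed.

Let c_lim n : exists l : R, forall N, `|c N n - l| <= 2 ^- N * 3 ^+ n.
Proof.
pose b N := 2 ^- N * 3 ^+ n : R.
have b0 N : 0 <= b N by rewrite mulr_ge0 ?invr_ge0 ?exprn_ge0.
have bS N : b N.+1 = b N / 2 by rewrite /b halfS; ring.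
have st N : `|c N.+1 n - c N n| <= b N / 2 by rewrite -bS; exact: c_step.
have inc N m : c N n - b N <= c (N + m)%N n - b (N + m)%N.
  elim: m => [|m IH]; first by rewrite addn0.
  rewrite addnS (le_trans IH)// bS; have := st (N + m)%N.
  rewrite ler_norml => /andP[]; lra.
have dec N m : c (N + m)%N n + b (N + m)%N <= c N n + b N.
  elim: m => [|m IH]; first by rewrite addn0.
  rewrite addnS (le_trans _ IH)// bS; have := st (N + m)%N.
  rewrite ler_norml => /andP[]; lra.
have bnd N m : c m n - b m <= c N n + b N.
  rewrite (le_trans (inc m N))// (le_trans _ (dec N m))// addnC.
  by have := b0 (N + m)%N; lra.
pose S := range (fun N => c N n - b N).
have hS : has_sup S.
  by split; [exists (c 0%N n - b 0%N), 0%N|exists (c 0%N n + b 0%N) => _ [m _ <-]].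
exists (sup S) => N; rewrite -/(b N) ler_norml.
have h1 : c N n - b N <= sup S by apply: ub_le_sup; [case: hS|exists N].
have h2 : sup S <= c N n + b N by apply: ge_sup => [|_ [m _ <-]//]; case: hS.
by apply/andP; split; lra.
Qed.

(* Infinite product of dilated sinc functions: it decays faster than any power. *)
Lemma multiplier_exists : exists g : R -> R, [/\ etype 1 1 g, g 0 = 1,
  forall x, `|g x| <= 1 & forall j, exists C, forall x, `|x| ^+ j * `|g x| <= C].
Proof.
have [l Hl] := choice c_lim.
have l_le n : `|l n| <= 1 * 1 ^+ n.
  rewrite expr1n mulr1; apply/ler_addgt0Pr => e e0.
  have [N HN] : exists N, 2 ^- N * 3 ^+ n < e.
    have h : (fun N => 3 ^+ n * (2^-1 : R) ^+ N) @ \oo --> (3 ^+ n * 0 : R).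
      apply: cvgM; first exact: cvg_cst.
      by apply: cvg_expr; rewrite ger0_norm ?invr_ge0//; lra.
    rewrite mulr0 in h.
    have /cvgrPdist_lt/(_ _ e0)[N _ /(_ N (leqnn N))] := h.
    rewrite /= sub0r normrN exprVn mulrC => H; exists N.
    exact: le_lt_trans (ler_norm _) H.
  have := Hl n N; have := c_le N n; rewrite expr1n mulr1.
  have := ler_normB (c N n) (c N n - l n); rewrite opprB addrC subrK; lra.
have cN N n : `|c N n - l n| <= 2 ^- N * 3 ^+ n by exact: Hl.
(* The infinite product is introduced through its limiting Taylor coefficients: type 1 is then
   immediate, and [close] compares its values with the partial products. *)
exists (ev l).
have prodE N x : sinc_prod N x = ev (c N) x.
  have [D [D0 fD bD]] := etype_sinc_prod1 N.
  rewrite -D0 -[x in LHS]add0r (etype_taylor 0 x ler01 fD bD).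
  by congr ev; apply/funext => n; rewrite /c -D0 fam_derive1n.
have close N x : `|sinc_prod N x - ev l x| <= 2 ^- N * expR (3 * `|x|).
  by rewrite prodE (evB _ (c_le N) l_le); apply: ev_le => n; exact: cN.
have lim (x b : R) N0 : (forall N, (N0 <= N)%N -> `|sinc_prod N x| <= b) -> `|ev l x| <= b.
  move=> H; apply/ler_addgt0Pr => e e0.
  have [N HN] : exists N, expR (3 * `|x|) / 2 ^+ N < e.
    have h : (fun N => expR (3 * `|x|) * (2^-1 : R) ^+ N) @ \oo --> (expR (3 * `|x|) * 0 : R).
      apply: cvgM; first exact: cvg_cst.
      by apply: cvg_expr; rewrite ger0_norm ?invr_ge0//; lra.
    rewrite mulr0 in h.
    have /cvgrPdist_lt/(_ _ e0)[N _ /(_ N (leqnn N))] := h.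
    rewrite /= sub0r normrN exprVn => H'; exists N.
    exact: le_lt_trans (ler_norm _) H'.
  have h1 := close (N0 + N)%N x; have h2 := H (N0 + N)%N (leq_addr _ _).
  have h3 : 2 ^- (N0 + N) * expR (3 * `|x|) <= expR (3 * `|x|) / 2 ^+ N.
    rewrite mulrC ler_wpM2l ?expR_ge0// lef_pV2 ?posrE ?exprn_gt0//.
    by rewrite ler_eXn2l ?leq_addl//; lra.
  have := ler_normB (sinc_prod (N0 + N) x) (sinc_prod (N0 + N) x - ev l x).
  by rewrite opprB addrC subrK; lra.
have le1 N x : `|sinc_prod N x| <= 1.
  elim: N => [|N IH]; first by rewrite /sinc_prod big_ord0 normr1.
  by rewrite sinc_prodS normrM mulr_ile1// sinc_le1.
split.
- exact: etype_ev.
- have P0 N : sinc_prod N 0 = 1 by rewrite /sinc_prod big1// => i _; rewrite mulr0 sinc0.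
  apply/eqP; rewrite eq_sym -subr_eq0 -normr_eq0 eq_le normr_ge0 andbT.
  apply/ler_addgt0Pr => e e0.
  have h : (fun N => (2^-1 : R) ^+ N) @ \oo --> (0 : R).
    by apply: cvg_expr; rewrite ger0_norm ?invr_ge0//; lra.
  have /cvgrPdist_lt/(_ _ e0)[N _ /(_ N (leqnn N))] := h.
  rewrite /= sub0r normrN exprVn => /(le_lt_trans (ler_norm _))/ltW H.
  by have := close N 0; rewrite P0 normr0 mulr0 expR0 mulr1 add0r => /le_trans; apply.
- by move=> x; apply: (lim x 1 0%N) => N _; exact: le1.
(* Each of the first j factors contributes 2^(k + 1) / |x|; the later ones are at most 1. *)
- move=> j; exists (\prod_(k < j) 2 ^+ k.+1) => x.
  have Pj : `|x| ^+ j * `|sinc_prod j x| <= \prod_(k < j) 2 ^+ k.+1.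
    elim: (j) => [|m IH]; first by rewrite expr0 mul1r /sinc_prod !big_ord0 normr1.
    rewrite big_ord_recr /= sinc_prodS normrM exprSr mulrACA.
    apply: ler_pM; rewrite ?mulr_ge0 ?exprn_ge0//.
    have := sinc_leV (2 ^- m.+1 * x); rewrite normrM [`|2 ^- _|]ger0_norm ?invr_ge0 ?exprn_ge0//.
    by rewrite -mulrA mulrC ler_pdivrMr ?exprn_gt0// mul1r.
  have mono N : (j <= N)%N -> `|sinc_prod N x| <= `|sinc_prod j x|.
    move=> /subnK <-; elim: (N - j)%N => [//|m IH].
    rewrite addSn sinc_prodS normrM (le_trans _ IH)// ler_piMr//.
    exact: sinc_le1.
  rewrite (le_trans _ Pj)// ler_wpM2l ?exprn_ge0//.
  exact: (lim x _ j mono).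
Qed.

End Multiplier.

(** * Laplace integrals on the half-line *)

Section HalfLineIntegrals.
Variable R : realType.
Local Notation mu := (@lebesgue_measure R).
Local Notation H := `[(0 : R), +oo[%classic.
Implicit Types (f g G : R -> R) (c K x y : R).

Lemma cvg_expR_decay c : 0 < c -> expR (- (c * x)) @[x --> +oo] --> (0 : R).
Proof.
move=> c0; apply/cvgrPdist_lt => e e0.
exists (c^-1 * e^-1); split; first exact: num_real.
move=> x xe; rewrite sub0r normrN ger0_norm ?expR_ge0// expRN.
rewrite invf_plt ?posrE ?expR_gt0//.
have h : e^-1 < c * x by rewrite -(ltr_pM2l (_ : 0 < c^-1)) ?invr_gt0// mulKf ?gt_eqF.
by rewrite (lt_le_trans h)// (le_trans _ (expR_ge1Dx _))// lerDr.
Qed.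

Lemma der_expNM c x : is_derive x 1 (fun y => expR (- (c * y))) (- c * expR (- (c * x))).
Proof.
have d1 : is_derive x 1 (fun y => - (c * y)) (- c).
  by have := der_scale (- c) (der_id x); rewrite mulr1; under eq_fun do rewrite mulNr.
have := der_comp (f := expR) (g := fun y => - (c * y)) (is_derive_expR (- (c * x))) d1.
by rewrite mulrC.
Qed.

Lemma der_continuous f (f' : R -> R) : (forall x, is_derive x 1 f (f' x)) -> continuous f.
Proof.
move=> df x; apply/differentiable_continuous/derivable1_diffP.
by have := df x => ?; exact: ex_derive.
Qed.

Lemma continuous_expNM c : continuous (fun x => expR (- (c * x))).
Proof. by apply: der_continuous => x; exact: der_expNM. Qed.

Lemma ge0_FTC_halfline f G (l : R) : continuous f -> (forall x, 0 <= x -> 0 <= f x) ->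
  (forall x, is_derive x 1 G (f x)) -> G x @[x --> +oo] --> l ->
  (\int[mu]_(x in H) (f x)%:E = (l - G 0)%:E)%E.
Proof.
move=> cf f0 dG Gl.
have cG := der_continuous dG.
have dG' x : 0 < x -> derivable G x 1 by move=> _; have := dG x => ?; exact: ex_derive.
have Ga : G x @[x --> 0^'+] --> G 0 by apply: cvg_at_right_filter; exact: cG.
have dE : {in `]0, +oo[, derive1 G =1 f}.
  by move=> x _; rewrite derive1E; have := dG x => ?; exact: derive_val.
have cf' : {within H, continuous f} by exact: continuous_subspaceT.
by rewrite (ge0_continuous_FTC2y f0 cf' Gl dG' Ga dE) EFinB.
Qed.

Lemma integral_expNM c : 0 < c -> (\int[mu]_(x in H) (expR (- (c * x)))%:E = (c^-1)%:E)%E.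
Proof.
move=> c0; pose G x := - c^-1 * expR (- (c * x)).
have dG x : is_derive x 1 G (expR (- (c * x))).
  have := der_scale (- c^-1) (der_expNM c x).
  by rewrite mulrA mulrNN mulVf ?gt_eqF// mul1r.
have cv : G x @[x --> +oo] --> (0 : R).
  rewrite -(mulr0 (- c^-1)); apply: cvgM; first exact: cvg_cst.
  exact: cvg_expR_decay.
have := ge0_FTC_halfline (continuous_expNM (c := c)) (fun x _ => expR_ge0 _) dG cv.
by rewrite /G mulr0 oppr0 expR0 mulr1 sub0r opprK.
Qed.

Lemma integrable_expNM c : 0 < c -> mu.-integrable H (EFin \o (fun x => expR (- (c * x)))).
Proof.
move=> c0; apply/integrableP; split.
  apply/measurable_EFinP; apply: measurable_funTS.
  by apply: continuous_measurable_fun; exact: continuous_expNM.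
have -> : (\int[mu]_(x in H) `|(EFin \o (fun x => expR (- (c * x)))) x| =
    \int[mu]_(x in H) (expR (- (c * x)))%:E)%E.
  by apply: eq_integral => x _ /=; rewrite ger0_norm// expR_ge0.
by rewrite integral_expNM// ltry.
Qed.

Lemma integrable_dominated f g : continuous f -> mu.-integrable H (EFin \o g) ->
  (forall x, 0 <= x -> `|f x| <= g x) -> mu.-integrable H (EFin \o f).
Proof.
move=> cf ig fg; apply: (@le_integrable _ _ _ mu H _ _ (EFin \o g)) => //.
- apply/measurable_EFinP; apply: measurable_funTS.
  exact: continuous_measurable_fun.
- move=> x; rewrite /= in_itv/= andbT => x0; rewrite lee_fin.
  by rewrite (le_trans (fg _ x0))// ler_norm.
Qed.

Lemma Rintegral_dominated f g : continuous f -> mu.-integrable H (EFin \o g) ->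
  (forall x, 0 <= x -> `|f x| <= g x) ->
  `|\int[mu]_(x in H) f x| <= \int[mu]_(x in H) g x.
Proof.
move=> cf ig fg; have itf := integrable_dominated cf ig fg.
rewrite (le_trans (le_normr_Rintegral _ itf))//.
apply: le_Rintegral => //.
- exact: (integrable_norm itf).
- by move=> x; rewrite /= in_itv/= andbT => x0; exact: fg.
Qed.

Lemma integrable_scale_expNM K c : 0 < c ->
  mu.-integrable H (EFin \o (fun x => K * expR (- (c * x)))).
Proof.
move=> c0; rewrite (_ : EFin \o _ = fun x => (K%:E * (expR (- (c * x)))%:E)%E).
  by apply: integrableZl => //; exact: integrable_expNM.
by apply/funext => x /=; rewrite EFinM.
Qed.

Lemma Rintegral_scale_expNM K c : 0 < c -> \int[mu]_(x in H) (K * expR (- (c * x))) = K / c.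
Proof.
move=> c0; rewrite RintegralZl//; last exact: integrable_expNM.
by rewrite /Rintegral integral_expNM.
Qed.

Lemma integrable_exp_decay f K c : continuous f -> 0 < c ->
  (forall x, 0 <= x -> `|f x| <= K * expR (- (c * x))) -> mu.-integrable H (EFin \o f).
Proof.
move=> cf c0 fK; apply: integrable_dominated fK => //.
exact: integrable_scale_expNM.
Qed.

Lemma Rintegral_exp_decay_le f K c : continuous f -> 0 < c ->
  (forall x, 0 <= x -> `|f x| <= K * expR (- (c * x))) ->
  `|\int[mu]_(x in H) f x| <= K / c.
Proof.
move=> cf c0 fK; rewrite -Rintegral_scale_expNM//.
by apply: Rintegral_dominated fK => //; exact: integrable_scale_expNM.
Qed.

Lemma integrable_sub f g : mu.-integrable H (EFin \o f) -> mu.-integrable H (EFin \o g) ->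
  mu.-integrable H (EFin \o (fun x => f x - g x)).
Proof.
move=> itf itg; have mH : measurable (H : set (measurableTypeR R)) by exact: measurable_itv.
have := integrableB mH itf itg.
by apply: eq_integrable => // x _; rewrite /= EFinB.
Qed.

(** Adding K exp (- c x) makes the integrand nonnegative, where [ge0_FTC_halfline] applies; the
    integral of the added term is explicit. *)
Lemma FTC_halfline f G K c : 0 < c -> continuous f -> (forall x, is_derive x 1 G (f x)) ->
  (forall x, 0 <= x -> `|f x| <= K * expR (- (c * x))) ->
  (forall x, 0 <= x -> `|G x| <= K * expR (- (c * x))) ->
  \int[mu]_(x in H) f x = - G 0.
Proof.
move=> c0 cf dG fK GK.
have cE := continuous_expNM (c := c).
pose f1 x := f x + K * expR (- (c * x)).
pose G1 x := G x + (- (K / c)) * expR (- (c * x)).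
have cvgZ k : k * expR (- (c * x)) @[x --> +oo] --> (0 : R).
  have := cvgM (cvg_cst k) (cvg_expR_decay c0); rewrite mulr0; exact.
have cvgG : G x @[x --> +oo] --> (0 : R).
  apply/cvgrPdist_le => e e0.
  have /cvgrPdist_le/(_ _ e0)[N [Nr HN]] := cvgZ K.
  exists (Num.max N 0); split; first by rewrite num_real.
  move=> x; rewrite gt_max => /andP[Nx x0].
  rewrite sub0r normrN (le_trans (GK _ (ltW x0)))//.
  by have := HN _ Nx; rewrite sub0r normrN; apply: le_trans; exact: ler_norm.
have cvgG1 : G1 x @[x --> +oo] --> (0 : R).
  by have := cvgD cvgG (cvgZ (- (K / c))); rewrite addr0; exact.
have cf1 : continuous f1.
  by move=> x; apply: cvgD; [exact: cf|apply: cvgM; [exact: cvg_cst|exact: cE]].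
have I1 : \int[mu]_(x in H) f1 x = - G1 0.
  have f10 x : 0 <= x -> 0 <= f1 x.
    by move=> x0; have := fK x x0; rewrite ler_norml /f1 => /andP[h _]; lra.
  have dG1 x : is_derive x 1 G1 (f1 x).
    have := der_add (dG x) (der_scale (- (K / c)) (der_expNM c x)).
    by rewrite /f1 mulrA mulrNN divfK ?gt_eqF.
  by rewrite /Rintegral (ge0_FTC_halfline cf1 f10 dG1 cvgG1) /= sub0r.
have I2 : \int[mu]_(x in H) f1 x = \int[mu]_(x in H) f x + K / c.
  rewrite /f1 RintegralD//; first by rewrite Rintegral_scale_expNM.
  - exact: integrable_exp_decay fK.
  - exact: integrable_scale_expNM.
have : \int[mu]_(x in H) f x = - G1 0 - K / c by rewrite -I1 I2 addrK.
by move=> ->; rewrite /G1 mulr0 oppr0 expR0 mulr1; ring.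
Qed.

Lemma is_derive_Rintegral (f f1 : R -> R -> R) (g : R -> R) (a u v : R) :
  u < a < v -> (forall s, u < s < v -> mu.-integrable H (EFin \o f s)) ->
  (forall s y, u < s < v -> is_derive s 1 (f ^~ y) (f1 s y)) ->
  (forall y, 0 <= g y) -> mu.-integrable H (EFin \o g) ->
  (forall s y, u < s < v -> 0 <= y -> `|f1 s y| <= g y) ->
  is_derive a 1 (fun s => \int[mu]_(y in H) f s y) (\int[mu]_(y in H) f1 a y).
Proof.
move=> ua itf df g0 ig f1g.
have Ia : `]u, v[%classic a by rewrite /= in_itv.
have itf' s : `]u, v[%classic s -> mu.-integrable H (EFin \o f s).
  by rewrite /= in_itv/=; exact: itf.
have df' s y : `]u, v[%classic s -> H y -> derivable (f ^~ y) s 1.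
  by rewrite /= in_itv/= => us _; have := df s y us => ?; exact: ex_derive.
have d1E s y : `]u, v[%classic s -> partial1of2 f s y = f1 s y.
  rewrite /= in_itv/= => us; rewrite partial1of2E; have := df s y us => ?; exact: derive_val.
have gub s y : `]u, v[%classic s -> H y -> `|partial1of2 f s y| <= g y.
  move=> us; rewrite d1E//; move: us; rewrite /= !in_itv/= andbT; exact: f1g.
have D := @derivable_under_integral R _ _ mu f H (measurable_itv _) a u v Ia itf' df' g g0 ig gub.
have E := @differentiation_under_integral R _ _ mu f H (measurable_itv _) a u v Ia itf' df' g g0 ig gub.
split => //; rewrite -derive1E E; apply: eq_Rintegral => y _.
exact: d1E.
Qed.

(** Half of the exponent absorbs x^n through y^n / n! <= exp y. A constant of the form n! q^n is
    what later gives a radius of analyticity in the Laplace parameter. *)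
Lemma pow_exp_le (c x : R) n : 0 < c -> 0 <= x ->
  x ^+ n * expR (- (c * x)) <= n`!%:R * (2 / c) ^+ n * expR (- (c / 2 * x)).
Proof.
move=> c0 x0.
have y0 : 0 <= c / 2 * x by rewrite mulr_ge0// divr_ge0// ltW.
have h : (c / 2 * x) ^+ n / n`!%:R <= expR (c / 2 * x).
  case: n => [|n]; first by rewrite expr0 fact0 divr1 (le_trans _ (expR_ge1Dx _))// lerDl.
  by rewrite (le_trans _ (expR_ge1Dxn n y0))// lerDr.
have F0 : 0 < n`!%:R :> R by rewrite ltr0n fact_gt0.
have -> : x ^+ n * expR (- (c * x)) =
    n`!%:R * (2 / c) ^+ n * ((c / 2 * x) ^+ n / n`!%:R) * expR (- (c * x)).
  have -> : x ^+ n = (2 / c) ^+ n * (c / 2 * x) ^+ n.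
    by rewrite -exprMn; congr (_ ^+ _); field; rewrite gt_eqF.
  by field; rewrite gt_eqF.
have -> : - (c / 2 * x) = c / 2 * x + - (c * x) by field.
rewrite expRD [leRHS]mulrA; apply: ler_wpM2r; first exact: expR_ge0.
by apply: ler_wpM2l => //; rewrite mulr_ge0// exprn_ge0// divr_ge0// ltW.
Qed.

End HalfLineIntegrals.

(** * Damped sines and two integrations by parts *)

Section BandLimited.
Variable R : realType.
Implicit Types (c w x rho B : R) (j n : nat) (D : nat -> R -> R).
Local Notation mu := (@lebesgue_measure R).
Local Notation H := `[(0 : R), +oo[%classic.

(** The imaginary part of i^j exp (- (c - i w) x): a damped sine for j = 0, a damped cosine for j =
    1. *)
Definition expsin (c w : R) (j : nat) (x : R) : R := expR (- (c * x)) * @sin_fam R j (w * x).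

Lemma der_expsin c w j x : is_derive x 1 (expsin c w j)
  (- c * expsin c w j x + w * expsin c w j.+1 x).
Proof.
have d1 : is_derive x 1 (fun y => w * y) w by have := der_scale w (der_id x); rewrite mulr1.
apply: (is_derive_eq (der_mul (der_expNM c x)
  (der_comp (g := fun y => w * y) (fam_sin j (w * x)) d1))).
by rewrite /expsin; ring.
Qed.

Lemma expsinS2 c w j x : expsin c w j.+2 x = - expsin c w j x.
Proof.
rewrite /expsin /sin_fam.
have -> : w * x + j.+2%:R * (pi / 2) = w * x + j%:R * (pi / 2) + pi :> R.
  by rewrite -[j.+2%:R]natr1 -[j.+1%:R]natr1; field.
by rewrite sinDpi mulrN.
Qed.

Lemma expsin_le c w j x : `|expsin c w j x| <= expR (- (c * x)).
Proof.
by rewrite normrM ger0_norm ?expR_ge0// ler_piMr ?expR_ge0// sin_max.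
Qed.

Lemma continuous_expsin c w j : continuous (expsin c w j).
Proof. by apply: der_continuous => x; exact: der_expsin. Qed.

Lemma continuous_mul (f g : R -> R) : continuous f -> continuous g ->
  continuous (fun x => f x * g x).
Proof. by move=> cf cg x; apply: cvgM; [exact: cf|exact: cg]. Qed.

Lemma half_line_exp_bound rho B D c w j n : 0 <= B -> ebound rho B D ->
  forall x, 0 <= x -> `|D n x * expsin c w j x| <= B * rho ^+ n * expR (- ((c - rho) * x)).
Proof.
move=> B0 bD x x0; rewrite normrM.
rewrite (_ : - ((c - rho) * x) = rho * `|x| + - (c * x)); last by rewrite ger0_norm//; ring.
by rewrite expRD mulrA; apply: ler_pM => //; exact: expsin_le.
Qed.

(** Real form of the rule that the Laplace transform of h'' at p = c - i w is p^2 times that of h,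
    minus p h(0) + h'(0). The condition h'(0) = 0 holds for the derivatives of even order of an even
    function. *)
Lemma integral_by_parts2 rho B D c w j : 0 <= rho < c -> 0 <= B -> fam D -> ebound rho B D ->
  D 1%N 0 = 0 ->
  \int[mu]_(x in H) (D 2%N x * expsin c w j x) =
  (c ^+ 2 - w ^+ 2) * \int[mu]_(x in H) (D 0%N x * expsin c w j x)
  - 2 * c * w * \int[mu]_(x in H) (D 0%N x * expsin c w j.+1 x)
  + D 0%N 0 * (- c * expsin c w j 0 + w * expsin c w j.+1 0).
Proof.
move=> /andP[r0 rc] B0 fD bD D10.
have c0 : 0 < c - rho by rewrite subr_gt0.
have cD n i : continuous (fun x => D n x * expsin c w i x).
  by apply: continuous_mul; [exact: fam_continuous|exact: continuous_expsin].
have itD n i : mu.-integrable H (EFin \o (fun x => D n x * expsin c w i x)).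
  by apply: (integrable_exp_decay _ c0 (half_line_exp_bound _ _ _ _ B0 bD)); exact: cD.
pose G x := D 1%N x * expsin c w j x
  - D 0%N x * (- c * expsin c w j x + w * expsin c w j.+1 x).
pose g x := D 2%N x * expsin c w j x - (c ^+ 2 - w ^+ 2) * (D 0%N x * expsin c w j x)
  + 2 * c * w * (D 0%N x * expsin c w j.+1 x).
pose K := B * rho ^+ 2 + `|c ^+ 2 - w ^+ 2| * B + `|2 * c * w| * B
  + (B * rho ^+ 1 + `|c| * B + `|w| * B).
have h0 n i x : 0 <= x -> `|D n x * expsin c w i x| <= B * rho ^+ n * expR (- ((c - rho) * x)).
  exact: half_line_exp_bound.
have e0 x : 0 <= expR (- ((c - rho) * x)) by exact: expR_ge0.
have IG : \int[mu]_(x in H) g x = - G 0.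
  apply: (@FTC_halfline R g G K (c - rho)) => //.
  - move=> x; apply: cvgD; [apply: cvgB; [exact: cD|]|];
      by apply: cvgM; [exact: cvg_cst|exact: cD].
  - move=> x.
    have dG1 := der_mul (fD 1%N x) (der_expsin c w j x).
    have dG2 := der_add (der_scale (- c) (der_expsin c w j x)) (der_scale w (der_expsin c w j.+1 x)).
    have dG3 := der_mul (fD 0%N x) dG2.
    apply: (is_derive_eq (der_sub dG1 dG3)).
    by rewrite /g !expsinS2; ring.
  - move=> x x0; rewrite /g.
    have h1 := h0 2%N j x x0; have h2 := h0 0%N j x x0; have h3 := h0 0%N j.+1 x x0.
    rewrite expr0 mulr1 in h2 h3.
    rewrite (le_trans (ler_normD _ _))// (le_trans (lerD (ler_normB _ _) (lexx _)))//.
    apply: (@le_trans _ _ ((B * rho ^+ 2 + `|c ^+ 2 - w ^+ 2| * B + `|2 * c * w| * B)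
        * expR (- ((c - rho) * x)))).
      rewrite !(mulrDl _ _ (expR _)); apply: lerD; [apply: lerD => //|].
        by rewrite (normrM (c ^+ 2 - w ^+ 2)) -[leRHS]mulrA; apply: ler_wpM2l.
      by rewrite (normrM (2 * c * w)) -[leRHS]mulrA; apply: ler_wpM2l.
    by rewrite ler_wpM2r// /K lerDl !addr_ge0 ?mulr_ge0// exprn_ge0.
  - move=> x x0; rewrite /G.
    have h1 := h0 1%N j x x0; have h2 := h0 0%N j x x0; have h3 := h0 0%N j.+1 x x0.
    rewrite expr0 mulr1 in h2 h3.
    have -> : D 0%N x * (- c * expsin c w j x + w * expsin c w j.+1 x) =
      - c * (D 0%N x * expsin c w j x) + w * (D 0%N x * expsin c w j.+1 x) by ring.
    rewrite (le_trans (ler_normB _ _))// (le_trans (lerD (lexx _) (ler_normD _ _)))//.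
    apply: (@le_trans _ _ ((B * rho ^+ 1 + `|c| * B + `|w| * B) * expR (- ((c - rho) * x)))).
      rewrite !(mulrDl _ _ (expR _)) -addrA; apply: lerD => //; apply: lerD.
        by rewrite (normrM (- c)) normrN -[leRHS]mulrA; apply: ler_wpM2l.
      by rewrite (normrM w) -[leRHS]mulrA; apply: ler_wpM2l.
    by rewrite ler_wpM2r// /K lerDr !addr_ge0 ?mulr_ge0// exprn_ge0.
have : \int[mu]_(x in H) g x = \int[mu]_(x in H) (D 2%N x * expsin c w j x)
    - (c ^+ 2 - w ^+ 2) * \int[mu]_(x in H) (D 0%N x * expsin c w j x)
    + 2 * c * w * \int[mu]_(x in H) (D 0%N x * expsin c w j.+1 x).
  have itZ k n i : mu.-integrable H (EFin \o (fun x => k * (D n x * expsin c w i x))).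
    rewrite (_ : EFin \o _ = fun x => (k%:E * (D n x * expsin c w i x)%:E)%E).
      by apply: integrableZl => //; exact: itD.
    by apply/funext => x /=; rewrite EFinM.
  have mH : measurable (H : set (measurableTypeR R)) by exact: measurable_itv.
  have i1 := itD 2%N j; have i2 := itZ (c ^+ 2 - w ^+ 2) 0%N j.
  have i3 := itZ (2 * c * w) 0%N j.+1.
  rewrite /g (RintegralD mH (integrable_sub i1 i2) i3) (RintegralB mH i1 i2).
  by rewrite !RintegralZl//; exact: itD.
rewrite IG /G D10 mul0r sub0r opprK; lra.
Qed.

End BandLimited.

(** * Fourier support of functions of exponential type *)

(** The real part of i^m. *)
Fixpoint altc {R : realType} (m : nat) : R :=
  match m with 0%N => 1 | 1%N => 0 | m'.+2 => - altc m' end.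

Section FourierSupport.
Variable R : realType.
Implicit Types (c w x y s a u v : R) (j n : nat).
Local Notation mu := (@lebesgue_measure R).
Local Notation H := `[(0 : R), +oo[%classic.

Lemma altc_pair_le m : `|altc m| <= 1 :> R /\ `|altc m.+1| <= 1 :> R.
Proof.
elim: m => [|m [IH1 IH2]]; first by rewrite /= normr1 normr0.
by split => //; rewrite /= normrN.
Qed.

Lemma altc_double n : altc n.*2 = (-1) ^+ n :> R.
Proof.
elim: n => [|n IH]; first by rewrite expr0.
by rewrite doubleS /= IH exprS mulN1r.
Qed.

Lemma eq_derive0 (f : R -> R) (a b df : R) : a < b ->
  (forall x, a < x -> f x = 0) -> is_derive b 1 f df -> df = 0.
Proof.
move=> ab f0 [dv <-]; rewrite -(derive_cst (0 : R) b 1).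
apply: near_eq_derive.
apply/nbhs_ballP; exists (b - a) => /=; first by rewrite subr_gt0.
move=> x; rewrite /ball /= ltr_norml => /andP[_ h]; apply: f0; lra.
Qed.

Variables (rho A C t : R) (D : nat -> R -> R).
Hypothesis rho0 : 0 < rho.
Hypothesis fD : fam D.
Hypothesis bD : ebound rho A D.
Hypothesis Deven : forall x, D 0%N (- x) = D 0%N x.
Hypothesis Ddecay : forall x, `|D 0%N x| * (1 + `|x|) <= C * (oneDsqr x)^-1.
Hypothesis rt : rho < t.

Let A0 : 0 <= A. Proof. by apply: (@etype_ge0 _ rho A (D 0%N)); exists D. Qed.
Let r0 : 0 <= rho. Proof. exact: ltW. Qed.
Let t0 : 0 < t. Proof. exact: lt_trans rt. Qed.
Let trho : 0 < t - rho. Proof. by rewrite subr_gt0. Qed.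

Let D_parity n x : D n (- x) = (-1) ^+ n * D n x.
Proof.
pose D' n y := (-1) ^+ n * D n (- y).
have fD' : fam D'.
  move=> m y; have := der_scale ((-1) ^+ m) (is_derive_reflect (fD m (- y))).
  by rewrite /D' exprS mulN1r mulNr mulrN.
have E : D' 0%N = D 0%N by apply/funext => y; rewrite /D' expr0 mul1r Deven.
have := fam_derive1n n fD'; rewrite E (fam_derive1n n fD).
by move=> /(congr1 (fun f => f (- x))); rewrite /D' opprK.
Qed.

Let D_odd0 n : D (n.*2).+1 0 = 0.
Proof.
have := D_parity (n.*2).+1 0; rewrite oppr0 exprS -mul2n exprM sqrrN !expr1n mulr1 mulN1r.
lra.
Qed.

(* The function y |-> h(iy), which is real because h is even. *)
Let E n := ev (fun m => altc (n + m) * D (n + m)%N 0).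

Let altD_le n : `|altc n * D n 0| <= A * rho ^+ n.
Proof.
have := bD n 0; rewrite normr0 mulr0 expR0 mulr1 normrM; apply: le_trans.
by rewrite ler_piMl//; case: (altc_pair_le n).
Qed.

Let fE : fam E. Proof. exact: fam_ev altD_le. Qed.

Let bE : ebound rho A E.
Proof. by move=> n x; apply: ev_le => m; rewrite -mulrA -exprD; exact: altD_le. Qed.

Let E0 n : E n 0 = altc n * D n 0.
Proof. by rewrite /E ev0 addn0. Qed.

Let cexps (F : nat -> R -> R) n c w j : fam F -> continuous (fun x => F n x * expsin c w j x).
Proof.
by move=> fF; apply: continuous_mul; [exact: fam_continuous|exact: continuous_expsin].
Qed.

Let itF (F : nat -> R -> R) n c w j : fam F -> ebound rho A F -> rho < c ->
  mu.-integrable H (EFin \o (fun x => F n x * expsin c w j x)).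
Proof.
move=> fF bF rc; have c0 : 0 < c - rho by rewrite subr_gt0.
apply: (integrable_exp_decay _ c0 (half_line_exp_bound _ _ _ _ A0 bF)).
exact: cexps.
Qed.

Let W (F : nat -> R -> R) n c w j := \int[mu]_(x in H) (F n x * expsin c w j x).

Let W_le (F : nat -> R -> R) n c w j : fam F -> ebound rho A F -> rho < c ->
  `|W F n c w j| <= A * rho ^+ n / (c - rho).
Proof.
move=> fF bF rc; have c0 : 0 < c - rho by rewrite subr_gt0.
apply: (Rintegral_exp_decay_le _ c0 (half_line_exp_bound _ _ _ _ A0 bF)).
exact: cexps.
Qed.

Let W_S2 (F : nat -> R -> R) n c w j : fam F -> ebound rho A F -> rho < c ->
  W F n c w j.+2 = - W F n c w j.
Proof.
move=> fF bF rc; rewrite -mulN1r -RintegralZl//; last exact: itF.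
by apply: eq_Rintegral => x _; rewrite expsinS2; ring.
Qed.

Let W_rec (F : nat -> R -> R) n c w j : fam F -> ebound rho A F -> rho < c ->
  F n.+1 0 = 0 ->
  W F n.+2 c w j = (c ^+ 2 - w ^+ 2) * W F n c w j - 2 * c * w * W F n c w j.+1
  + F n 0 * (- c * expsin c w j 0 + w * expsin c w j.+1 0).
Proof.
move=> fF bF rc F0.
have fG : fam (fun i => F (n + i)%N) by move=> i x; rewrite addnS; exact: fF.
have bG : ebound rho (A * rho ^+ n) (fun i => F (n + i)%N).
  by move=> i x; rewrite -(mulrA A) -exprD; exact: bF.
have B0 : 0 <= A * rho ^+ n by rewrite mulr_ge0// exprn_ge0.
have rc' : 0 <= rho < c by rewrite r0.
have F0' : F (n + 1)%N 0 = 0 by rewrite addn1.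
have := integral_by_parts2 w j rc' B0 fG bG F0'.
by rewrite addn0 addn2.
Qed.

Let expsin0 c w : expsin c w 0 0 = 0 :> R.
Proof. by rewrite /expsin /sin_fam !mulr0 mul0r addr0 sin0 mulr0. Qed.
Let expsin1 c w : expsin c w 1 0 = 1 :> R.
Proof. by rewrite /expsin /sin_fam !mulr0 oppr0 expR0 mul1r mul1r add0r sin_pihalf. Qed.

(** Putting x = i y in the integral of h(x) exp (- (s - i t) x) gives i times the integral of h(i y)
    exp (- t y) exp (- i s y). [V] and [U] are the real and imaginary parts of the difference of the
    two, for the 2n-th derivative of h; the sign relates it to the 2n-th derivative of h(i y) in
    y. *)
Let V s n := W D n.*2 s t 1 - (-1) ^+ n * W E n.*2 t s 0.
Let U s n := W D n.*2 s t 0 - (-1) ^+ n * W E n.*2 t s 1.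

(** Two more derivatives multiply V + i U by (s - i t)^2: the boundary terms at 0 of the two
    integrals cancel. *)
Let VU_rec s n : rho < s ->
  V s n.+1 = (s ^+ 2 - t ^+ 2) * V s n + 2 * s * t * U s n /\
  U s n.+1 = (s ^+ 2 - t ^+ 2) * U s n - 2 * s * t * V s n.
Proof.
move=> rs.
have Eo : E (n.*2).+1 0 = 0 by rewrite E0 D_odd0 mulr0.
have Ee : E n.*2 0 = (-1) ^+ n * D n.*2 0 by rewrite E0 altc_double.
have sg : (-1) ^+ n * ((-1) ^+ n * D n.*2 0) = D n.*2 0.
  by rewrite mulrA -exprD addnn -mul2n exprM sqrrN !expr1n mul1r.
rewrite /V /U doubleS exprS.
rewrite (W_rec t 1 fD bD rs (D_odd0 n)) (W_rec t 0 fD bD rs (D_odd0 n)).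
rewrite (W_rec s 0 fE bE rt Eo) (W_rec s 1 fE bE rt Eo).
rewrite (W_S2 n.*2 t 0 fD bD rs) (W_S2 n.*2 s 0 fE bE rt).
rewrite !expsinS2 !expsin0 !expsin1 Ee.
set x := (-1) ^+ n in sg *; set a := D n.*2 0 in sg *.
set w1 := W _ _ _ _ _; set w2 := W _ _ _ _ _; set w3 := W _ _ _ _ _; set w4 := W _ _ _ _ _.
split.
  rewrite [LHS](_ : _ = (s ^+ 2 - t ^+ 2) * (w1 - x * w3) + 2 * s * t * (w2 - x * w4)
    + s * (x * (x * a) - a)); last by ring.
  by rewrite sg subrr mulr0 addr0.
rewrite [LHS](_ : _ = (s ^+ 2 - t ^+ 2) * (w2 - x * w4) - 2 * s * t * (w1 - x * w3)
  + t * (a - x * (x * a))); last by ring.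
by rewrite sg subrr mulr0 addr0.
Qed.

(** At each step |V + i U|^2 is multiplied by (s^2 + t^2)^2, yet the derivative bounds let it grow
    only like rho^(4n). As rho < t, it must be 0. *)
Let V0_large s : rho < s -> V s 0 = 0.
Proof.
move=> rs; have s0 : 0 < s - rho by rewrite subr_gt0.
pose e n := V s n ^+ 2 + U s n ^+ 2.
have eS n : e n.+1 = (s ^+ 2 + t ^+ 2) ^+ 2 * e n.
  by rewrite /e; have [-> ->] := VU_rec n rs; ring.
pose K := A / (s - rho) + A / (t - rho).
have K0 : 0 <= K by rewrite addr_ge0// divr_ge0// ltW.
have bnd n j : `|W D n.*2 s t j| + `|(-1) ^+ n * W E n.*2 t s (1 - j)| <= K * rho ^+ n.*2.
  rewrite /K mulrDl lerD//.
    by rewrite (le_trans (W_le _ _ _ fD bD rs))// mulrAC.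
  rewrite normrM normrX normrN1 expr1n mul1r.
  by rewrite (le_trans (W_le _ _ _ fE bE rt))// mulrAC.
have sqle (x y : R) : `|x| <= y -> x ^+ 2 <= y ^+ 2.
  move=> xy; rewrite -[x ^+ 2]real_normK ?num_real//.
  by apply: lerXn2r; rewrite ?nnegrE// (le_trans _ xy).
have eK n : e n <= 2 * (K * rho ^+ n.*2) ^+ 2.
  rewrite mulr_natl mulr2n lerD//; apply: sqle.
    by rewrite (le_trans (ler_normB _ _))//; exact: (bnd n 1%N).
  by rewrite (le_trans (ler_normB _ _))//; exact: (bnd n 0%N).
pose q := (rho ^+ 2 / (s ^+ 2 + t ^+ 2)) ^+ 2.
have st : 0 < s ^+ 2 + t ^+ 2.
  by rewrite ltr_wpDl ?sqr_ge0// exprn_gt0.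
have q01 : 0 <= q < 1.
  rewrite /q sqr_ge0 /= expr_lt1//; last by rewrite divr_ge0 ?sqr_ge0// ltW.
  rewrite ltr_pdivrMr// mul1r ltr_wpDl ?sqr_ge0//.
  by rewrite ltr_pXn2r ?nnegrE ?ltW.
have key n : e 0%N <= 2 * K ^+ 2 * q ^+ n.
  have en : e n = (s ^+ 2 + t ^+ 2) ^+ 2 ^+ n * e 0%N.
    elim: n => [|n IH]; first by rewrite expr0 mul1r.
    by rewrite eS IH (exprS _ n) mulrA.
  rewrite /q expr_div_n expr_div_n mulrA ler_pdivlMr; last by rewrite !exprn_gt0.
  rewrite mulrC -en (le_trans (eK n))// le_eqVlt; apply/orP; left; apply/eqP.
  rewrite exprMn [LHS]mulrA; congr (_ * _).
  by rewrite -!exprM; congr (_ ^+ _); lia.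
have e0 : e 0%N <= 0.
  have cv : (fun n => 2 * K ^+ 2 * q ^+ n) @ \oo --> (0 : R).
    rewrite -(mulr0 (2 * K ^+ 2)); apply: cvgM; first exact: cvg_cst.
    by case/andP: q01 => q0 q1; apply: cvg_expr; rewrite ger0_norm.
  rewrite -(cvg_lim _ cv)//; apply: limr_ge; first by apply/cvg_ex; exists 0.
  exact: nearW.
apply/eqP; rewrite -sqrf_eq0 eq_le sqr_ge0 andbT (le_trans _ e0)//.
by rewrite lerDl sqr_ge0.
Qed.

(** [fI] and [fJ] are the n-th derivatives in s of the integrands on the real and on the rotated
    ray. *)
Let fI n s x : R := D 0%N x * @sin_fam R 1 (t * x) * ((- x) ^+ n * expR (- (s * x))).
Let fJ n s y : R := E 0%N y * expR (- (t * y)) * (y ^+ n * @sin_fam R n (s * y)).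

Let C0 x : `|D 0%N x| <= C.
Proof.
have := Ddecay x; have h : (oneDsqr x)^-1 <= 1 by exact: oneDsqrV_le1.
have h0 : 0 < (oneDsqr x)^-1 by rewrite invr_gt0 (lt_le_trans ltr01).
have hC : 0 <= C.
  rewrite -(pmulr_lge0 _ h0) (le_trans _ (Ddecay x))// mulr_ge0// addr_ge0//.
have : 0 <= `|D 0%N x| * `|x| by rewrite mulr_ge0.
have : C * (oneDsqr x)^-1 <= C by rewrite ler_piMr.
by rewrite mulrDr mulr1; lra.
Qed.

Let Cge0 : 0 <= C. Proof. exact: le_trans (C0 0). Qed.

Let cont_fI n s : continuous (fI n s).
Proof.
apply: continuous_mul; apply: continuous_mul.
- exact: fam_continuous.
- move=> x; apply: (@continuous_comp _ _ _ (fun x => t * x) (@sin_fam R 1)).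
    by apply: cvgM; [exact: cvg_cst|exact: cvg_id].
  by apply: fam_continuous; exact: fam_sin.
- by apply: der_continuous => x; apply: der_pow; exact: is_deriveN.
- exact: continuous_expNM.
Qed.

Let cont_fJ n s : continuous (fJ n s).
Proof.
apply: continuous_mul; apply: continuous_mul.
- exact: fam_continuous.
- exact: continuous_expNM.
- by apply: der_continuous => x; apply: der_pow; exact: der_id.
- move=> x; apply: (@continuous_comp _ _ _ (fun x => s * x) (@sin_fam R n)).
    by apply: cvgM; [exact: cvg_cst|exact: cvg_id].
  by apply: fam_continuous; exact: fam_sin.
Qed.

Let fI_le n s1 s x : 0 < s1 -> s1 <= s -> 0 <= x ->
  `|fI n s x| <= C * (n`!%:R * (2 / s1) ^+ n) * expR (- (s1 / 2 * x)).
Proof.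
move=> s10 ss x0; rewrite /fI !normrM normrX normrN (ger0_norm x0).
rewrite [`|expR _|]ger0_norm ?expR_ge0// -mulrA.
rewrite -[leRHS]mulrA; apply: ler_pM => //; first by rewrite !mulr_ge0 ?expR_ge0 ?exprn_ge0.
apply: (@le_trans _ _ (x ^+ n * expR (- (s1 * x)))); last exact: pow_exp_le.
rewrite -[leRHS]mul1r; apply: ler_pM; rewrite ?mulr_ge0 ?expR_ge0 ?exprn_ge0//.
  exact: sin_max.
by apply: ler_wpM2l; rewrite ?exprn_ge0// ler_expR lerN2 ler_wpM2r.
Qed.

Let fJ_le n s y : 0 <= y ->
  `|fJ n s y| <= A * (n`!%:R * (2 / (t - rho)) ^+ n) * expR (- ((t - rho) / 2 * y)).
Proof.
move=> y0; rewrite /fJ !normrM normrX (ger0_norm y0).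
rewrite [`|expR _|]ger0_norm ?expR_ge0//.
apply: (@le_trans _ _ (A * (y ^+ n * expR (- ((t - rho) * y))))); last first.
  by rewrite -[leRHS]mulrA ler_wpM2l//; exact: pow_exp_le.
have := bE 0%N y; rewrite expr0 mulr1 (ger0_norm y0) => h.
have -> : - ((t - rho) * y) = rho * y + - (t * y) by ring.
rewrite expRD.
apply: (@le_trans _ _ (A * expR (rho * y) * expR (- (t * y)) * (y ^+ n * 1))).
  apply: ler_pM; rewrite ?mulr_ge0 ?expR_ge0 ?exprn_ge0//.
    by apply: ler_wpM2r => //; exact: expR_ge0.
  by apply: ler_wpM2l; rewrite ?exprn_ge0// sin_max.
by rewrite le_eqVlt; apply/orP; left; apply/eqP; ring.
Qed.

Let half_gt0 (x : R) : 0 < x -> 0 < x / 2. Proof. by move=> ?; rewrite divr_gt0. Qed.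

Let it_fI n s : 0 < s -> mu.-integrable H (EFin \o fI n s).
Proof.
move=> s0; apply: (integrable_exp_decay (@cont_fI n s) (half_gt0 s0)) => x x0.
exact: fI_le.
Qed.

Let it_fJ n s : mu.-integrable H (EFin \o fJ n s).
Proof.
apply: (integrable_exp_decay (@cont_fJ n s) (half_gt0 trho)) => x x0.
exact: fJ_le.
Qed.

Let Dn n s := \int[mu]_(x in H) fI n s x - \int[mu]_(x in H) fJ n s x.

Let der_Dn n s : 0 < s -> is_derive s 1 (Dn n) (Dn n.+1 s).
Proof.
move=> s0; rewrite /Dn; apply: der_sub.
  have s2 := half_gt0 s0.
  apply: (@is_derive_Rintegral R (fI n) (fI n.+1)
    (fun x => C * (n.+1`!%:R * (2 / (s / 2)) ^+ n.+1) * expR (- (s / 2 / 2 * x))) s (s / 2) (s + 1)).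
  - by apply/andP; split; lra.
  - by move=> u /andP[su _]; apply: it_fI; exact: lt_trans su.
  - move=> u y _; rewrite /fI.
    have d1 : is_derive u 1 (fun v => - (v * y)) (- y).
      rewrite (_ : (fun v => - (v * y)) = (fun v => - y * v)).
        by have := der_scale (- y) (der_id u); rewrite mulr1.
      by apply/funext => v; rewrite mulNr mulrC.
    apply: (is_derive_eq (der_scale (D 0%N y * sin_fam 1 (t * y)) (der_scale ((- y) ^+ n)
      (der_comp (f := expR) (g := fun v => - (v * y)) (is_derive_expR (- (u * y))) d1)))).
    by rewrite exprS; ring.
  - move=> y; rewrite mulr_ge0 ?expR_ge0// mulr_ge0// mulr_ge0// exprn_ge0// divr_ge0//.
    exact: ltW.
  - by apply: integrable_scale_expNM; exact: half_gt0.
  - by move=> u y /andP[su _] y0; apply: fI_le => //; exact: ltW.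
apply: (@is_derive_Rintegral R (fJ n) (fJ n.+1)
    (fun x => A * (n.+1`!%:R * (2 / (t - rho)) ^+ n.+1) * expR (- ((t - rho) / 2 * x))) s (s / 2) (s + 1)).
- by apply/andP; split; lra.
- by move=> u _; exact: it_fJ.
- move=> u y _; rewrite /fJ.
  have d1 : is_derive u 1 (fun v => v * y) y.
    rewrite (_ : (fun v => v * y) = (fun v => y * v)).
      by have := der_scale y (der_id u); rewrite mulr1.
    by apply/funext => v; rewrite mulrC.
  apply: (is_derive_eq (der_scale (E 0%N y * expR (- (t * y))) (der_scale (y ^+ n)
    (der_comp (g := fun v => v * y) (fam_sin n (u * y)) d1)))).
  by rewrite exprS; ring.
- move=> y; rewrite mulr_ge0 ?expR_ge0// mulr_ge0// mulr_ge0// exprn_ge0// divr_ge0//.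
  exact: ltW.
- by apply: integrable_scale_expNM; exact: half_gt0.
- by move=> u y _ y0; exact: fJ_le.
Qed.

(** Uniformity in s >= s1 is the point: the Taylor series of [Dn 0] has radius of convergence at
    least 1 / q at every such s. *)
Let Dn_le s1 : 0 < s1 -> exists K q : R, [/\ 0 <= K, 0 < q &
  forall n s, s1 <= s -> `|Dn n s| <= K * n`!%:R * q ^+ n].
Proof.
move=> s10; have p1 : 0 < 2 / s1 by rewrite divr_gt0.
have p2 : 0 < 2 / (t - rho) by rewrite divr_gt0.
exists (C * (2 / s1) + A * (2 / (t - rho))), (2 / s1 + 2 / (t - rho)); split.
- by rewrite addr_ge0// mulr_ge0// ltW.
- exact: addr_gt0.
move=> n s ss; rewrite /Dn (le_trans (ler_normB _ _))//.
have h1 := Rintegral_exp_decay_le (@cont_fI n s) (half_gt0 s10) (fun x => @fI_le n s1 s x s10 ss).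
have h2 := Rintegral_exp_decay_le (@cont_fJ n s) (half_gt0 trho) (fun x => @fJ_le n s x).
rewrite (le_trans (lerD h1 h2))//.
have q1 : 2 / s1 <= 2 / s1 + 2 / (t - rho) by rewrite lerDl ltW.
have q2 : 2 / (t - rho) <= 2 / s1 + 2 / (t - rho) by rewrite lerDr ltW.
rewrite (invf_div s1) (invf_div (t - rho)).
move: p1 p2 q1 q2; set u := 2 / s1; set v := 2 / (t - rho); set q := u + v => p1 p2 q1 q2.
have pw x : 0 < x -> x <= q -> x ^+ n <= q ^+ n.
  by move=> x0 xq; apply: lerXn2r; rewrite ?nnegrE ?addr_ge0 ?(ltW p1) ?(ltW p2) ?(ltW x0).
rewrite [leRHS](_ : _ = C * u * n`!%:R * q ^+ n + A * v * n`!%:R * q ^+ n); last by ring.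
apply: lerD.
  rewrite [leLHS](_ : _ = C * u * n`!%:R * u ^+ n); last by ring.
  apply: ler_wpM2l; last exact: pw.
  by rewrite mulr_ge0// mulr_ge0// ltW.
rewrite [leLHS](_ : _ = A * v * n`!%:R * v ^+ n); last by ring.
apply: ler_wpM2l; last exact: pw.
by rewrite mulr_ge0// mulr_ge0// ltW.
Qed.

Let Dn0_large s : rho < s -> Dn 0 s = 0.
Proof.
move=> rs; rewrite -(V0_large rs) /V /W /Dn expr0 mul1r; congr (_ - _).
  by apply: eq_Rintegral => x _; rewrite /fI /expsin expr0; ring.
by apply: eq_Rintegral => x _; rewrite /fJ /expsin expr0; ring.
Qed.

Let Dn_vanish a : (forall s, a < s -> Dn 0 s = 0) -> 0 <= a ->
  forall n s, a < s -> Dn n s = 0.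
Proof.
move=> Ha a0; elim=> [|n IH] s as_; first exact: Ha.
apply: (eq_derive0 as_ IH); apply: der_Dn; exact: le_lt_trans as_.
Qed.

(** Analytic continuation leftward from s > rho. If [Dn 0] vanishes beyond [a], it is flat at u +
    eta > a, and the N-th Taylor remainder at [u] is at most K 2^-N. All steps have the same length
    [eta], half of 1 / q, since [K] and [q] serve the whole half-line from s / 2. *)
Let Dn0_pos s : 0 < s -> Dn 0 s = 0.
Proof.
move=> s0; have s10 := half_gt0 s0.
have [K [q [K0 q0 HK]]] := Dn_le s10.
pose eta := (2 * q)^-1; have eta0 : 0 < eta by rewrite invr_gt0 mulr_gt0.
have step k : forall u, s / 2 < u -> rho - k%:R * eta < u -> Dn 0 u = 0.
  elim: k => [|k IH] u su ru; first by apply: Dn0_large; move: ru; rewrite mul0r subr0.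
  pose a := Num.max (s / 2) (rho - k%:R * eta).
  have a0 : 0 <= a by rewrite le_max ltW.
  have Ha v : a < v -> Dn 0 v = 0 by rewrite gt_max => /andP[h1 h2]; exact: IH.
  have ab : a < u + eta.
    rewrite gt_max; apply/andP; split; first by lra.
    by move: ru; rewrite -[k.+1%:R]natr1 mulrDl mul1r; lra.
  have Db n : Dn n (u + eta) = 0 by exact: (Dn_vanish Ha a0).
  have uu : u <= u + eta by rewrite lerDl ltW.
  have bnd N : `|Dn 0 u| <= K * (2^-1) ^+ N.
    have := @taylor_flat_left R Dn N (u + eta) u (K * N`!%:R * q ^+ N) uu.
    rewrite (addrAC u) subrr add0r => /(_ _ Db) h.
    rewrite (_ : K * 2^-1 ^+ N = K * N`!%:R * q ^+ N * eta ^+ N / N`!%:R).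
      apply: h => [n y /andP[uy _]|y /andP[uy _]]; first by apply: der_Dn; lra.
      by apply: HK; lra.
    have F0 : N`!%:R != 0 :> R by rewrite pnatr_eq0 -lt0n fact_gt0.
    have -> : 2^-1 = q * eta by rewrite /eta; field; rewrite gt_eqF.
    by rewrite exprMn; field.
  apply/eqP; rewrite -normr_eq0 eq_le normr_ge0 andbT.
  have cv : (fun n => K * 2^-1 ^+ n) @ \oo --> (0 : R).
    rewrite -(mulr0 K); apply: cvgM; first exact: cvg_cst.
    by apply: cvg_expr; rewrite ger0_norm ?invr_ge0//; lra.
  rewrite -(cvg_lim _ cv)//; apply: limr_ge; first by apply/cvg_ex; exists 0.
  exact: nearW.
pose k := (Num.truncn (rho / eta)).+1.
apply: (step k); first by lra.
have : rho / eta < k%:R by exact: truncnS_gt.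
by rewrite ltr_pdivrMr//; lra.
Qed.

Lemma integrable_oneDsqrV : mu.-integrable H (EFin \o (fun x : R => (oneDsqr x)^-1)).
Proof.
apply/integrableP; split.
  apply/measurable_EFinP; apply: measurable_funTS.
  by apply: continuous_measurable_fun; exact: continuous_oneDsqrV.
have -> : (\int[mu]_(x in H) `|(EFin \o (fun x : R => (oneDsqr x)^-1)%R) x| =
    \int[mu]_(x in H) ((oneDsqr x)^-1)%:E)%E.
  by apply: eq_integral => x _ /=; rewrite ger0_norm// invr_ge0.
by rewrite integral0y_oneDsqr ltry.
Qed.

(** Let s tend to 0 in the rotated identity. Replacing exp (- s x) by 1 costs at most s x, which the
    weight 1 + |x| in [Ddecay] makes integrable, and the rotated integral is O(s) because |sin (s
    y)| <= s y. *)
Lemma band_limited_cos_integral0 : \int[mu]_(x in H) (D 0%N x * cos (t * x)) = 0.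
Proof.
have cosE x : cos (t * x) = @sin_fam R 1 (t * x) by rewrite /sin_fam mul1r sinDpihalf.
pose f0 x := D 0%N x * cos (t * x).
have cf0 : continuous f0.
  have -> : f0 = fI 0 0.
    by apply/funext => x; rewrite /f0 /fI cosE expr0 mul0r oppr0 expR0 mul1r mulr1.
  exact: cont_fI.
have f0_le x : `|f0 x| <= C * (oneDsqr x)^-1.
  apply: le_trans (Ddecay x); rewrite normrM ler_wpM2l//.
  by rewrite (le_trans (cos_max _))// lerDl.
have itC : mu.-integrable H (EFin \o (fun x : R => C * (oneDsqr x)^-1)).
  rewrite (_ : EFin \o _ = fun x => (C%:E * ((oneDsqr x)^-1)%:E)%E).
    by apply: integrableZl => //; exact: integrable_oneDsqrV.
  by apply/funext => x /=; rewrite EFinM.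
have itf0 : mu.-integrable H (EFin \o f0) by apply: integrable_dominated itC _.
pose K1 := \int[mu]_(x in H) (C * (oneDsqr x)^-1).
pose K2 := A * (1`!%:R * (2 / (t - rho)) ^+ 1) / ((t - rho) / 2).
have bnd s : 0 < s -> `|\int[mu]_(x in H) f0 x| <= s * (K1 + K2).
  move=> s0.
  have E1 : \int[mu]_(x in H) fI 0 s x = \int[mu]_(x in H) fJ 0 s x.
    by apply/eqP; rewrite -subr_eq0; apply/eqP; exact: Dn0_pos.
  have -> : \int[mu]_(x in H) f0 x =
      \int[mu]_(x in H) (f0 x - fI 0 s x) + \int[mu]_(x in H) fJ 0 s x.
    by rewrite RintegralB//; [rewrite E1 subrK|exact: it_fI].
  rewrite (le_trans (ler_normD _ _))// mulrDr lerD//.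
    rewrite /K1 -RintegralZl//; apply: Rintegral_dominated.
    - by move=> x; apply: cvgB; [exact: cf0|exact: cont_fI].
    - rewrite (_ : EFin \o _ = fun x => (s%:E * (C * (oneDsqr x)^-1)%:E)%E).
        exact: integrableZl.
      by apply/funext => x /=; rewrite EFinM.
    - move=> x x0.
      have -> : f0 x - fI 0 s x = f0 x * (1 - expR (- (s * x))).
        by rewrite /f0 /fI cosE expr0; ring.
      have h1 : 0 <= 1 - expR (- (s * x)).
        by rewrite subr_ge0 expR_le1 oppr_le0 mulr_ge0// ltW.
      have h2 : 1 - expR (- (s * x)) <= s * x by have := expR_ge1Dx (- (s * x)); lra.
      rewrite normrM (ger0_norm h1).
      apply: (@le_trans _ _ (`|D 0%N x| * (s * x))).
        apply: ler_pM => //; rewrite normrM ler_piMr//; exact: cos_max.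
      rewrite mulrCA ler_wpM2l ?(ltW s0)//; apply: le_trans (Ddecay x).
      by rewrite ler_wpM2l// (ger0_norm x0) lerDr.
  rewrite /K2 mulrA; apply: (Rintegral_exp_decay_le (@cont_fJ 0 s) (half_gt0 trho)) => y y0.
  apply: (@le_trans _ _ (s * `|fJ 1 0 y|)).
    rewrite /fJ !normrM [leRHS]mulrCA; apply: ler_wpM2l; first by rewrite mulr_ge0.
    rewrite expr0 expr1 normr1 mul1r.
    rewrite (_ : @sin_fam R 1 (0 * y) = 1); last by rewrite /sin_fam mul0r add0r mul1r sin_pihalf.
    rewrite normr1 mulr1 /sin_fam mul0r addr0 (le_trans (norm_sin_le _))//.
    by rewrite normrM (gtr0_norm s0).
  by rewrite -mulrA ler_wpM2l ?(ltW s0)//; exact: fJ_le.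
have K120 : 0 <= K1 + K2.
  by have := le_trans (normr_ge0 _) (bnd 1 ltr01); rewrite mul1r.
apply/eqP; rewrite -normr_eq0 eq_le normr_ge0 andbT.
apply/ler_addgt0Pr => e e0; rewrite add0r.
have d0 : 0 < e / (K1 + K2 + 1) by rewrite divr_gt0// ltr_wpDl.
rewrite (le_trans (bnd _ d0))// mulrAC ler_pdivrMr ?ltr_wpDl//.
by rewrite ler_wpM2l ?(ltW e0)// lerDl.
Qed.

End FourierSupport.

(** * Rapid decay *)

Section RapidDecay.
Variable R : realType.
Local Notation mu := (@lebesgue_measure R).
Local Notation H := `[(0 : R), +oo[%classic.
Implicit Types (f g h P : R -> R) (x y : R).

Definition rapid f := forall j, exists C : R, forall x, `|x| ^+ j * `|f x| <= C.

Lemma rapid_scale g (e : R) : 0 < e -> rapid g -> rapid (fun x => g (e * x)).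
Proof.
move=> e0 rg j; have [C HC] := rg j; exists (C / e ^+ j) => x.
rewrite ler_pdivlMr ?exprn_gt0// mulrC mulrA -exprMn.
by rewrite -{1}(gtr0_norm e0) -normrM.
Qed.

Lemma rapid_poly_mul f h k (K : R) : (forall x, `|h x| <= K * (1 + `|x|) ^+ k) ->
  rapid f -> rapid (fun x => h x * f x).
Proof.
move=> hK rf j; have [C1 H1] := rf j; have [C2 H2] := rf (j + k)%N.
have K0 : 0 <= K by have := hK 0; rewrite normr0 addr0 expr1n mulr1; exact: le_trans.
exists (K * 2 ^+ k * (C1 + C2)) => x.
have p : (1 + `|x|) ^+ k <= 2 ^+ k * (1 + `|x| ^+ k).
  have [x1|x1] := leP `|x| 1.
    apply: (@le_trans _ _ (2 ^+ k * 1)).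
      by rewrite mulr1; apply: lerXn2r; rewrite ?nnegrE ?addr_ge0//; lra.
    by rewrite ler_wpM2l ?exprn_ge0// lerDl exprn_ge0.
  apply: (@le_trans _ _ (2 ^+ k * `|x| ^+ k)).
    by rewrite -exprMn; apply: lerXn2r; rewrite ?nnegrE ?addr_ge0 ?mulr_ge0//; lra.
  by rewrite ler_wpM2l ?exprn_ge0// lerDr.
rewrite normrM mulrCA.
apply: (@le_trans _ _ (K * (2 ^+ k * (1 + `|x| ^+ k)) * (`|x| ^+ j * `|f x|))).
  apply: ler_wpM2r; first by rewrite mulr_ge0// exprn_ge0.
  by rewrite (le_trans (hK x))// ler_wpM2l.
rewrite [leLHS](_ : _ = K * 2 ^+ k * (`|x| ^+ j * `|f x| + `|x| ^+ (j + k) * `|f x|)).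
  by apply: ler_wpM2l; rewrite ?mulr_ge0 ?exprn_ge0// lerD.
by rewrite exprD; ring.
Qed.

Lemma rapidD f g : rapid f -> rapid g -> rapid (fun x => f x + g x).
Proof.
move=> rf rg j; have [C1 H1] := rf j; have [C2 H2] := rg j; exists (C1 + C2) => x.
rewrite (le_trans _ (lerD (H1 x) (H2 x)))// -mulrDr ler_wpM2l ?exprn_ge0//.
exact: ler_normD.
Qed.

Lemma rapid_reflect f : rapid f -> rapid (fun x => f (- x)).
Proof.
by move=> rf j; have [C HC] := rf j; exists C => x; rewrite -[`|x|]normrN.
Qed.

Lemma rapid_bound f : rapid f -> exists C : R, forall x,
  `|f x| * (1 + `|x|) <= C * (oneDsqr x)^-1.
Proof.
move=> rf.
have [C0 H0] := rf 0%N; have [C1 H1] := rf 1%N; have [C2 H2] := rf 2%N; have [C3 H3] := rf 3%N.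
exists (C0 + C1 + C2 + C3) => x.
have p : 0 < oneDsqr x by rewrite (lt_le_trans ltr01).
rewrite -(ler_pM2r p) divfK ?gt_eqF//.
rewrite [leLHS](_ : _ = `|x| ^+ 0 * `|f x| + `|x| ^+ 1 * `|f x| + `|x| ^+ 2 * `|f x| +
   `|x| ^+ 3 * `|f x|).
  by rewrite !lerD.
by rewrite /oneDsqr -(real_normK (num_real x)); ring.
Qed.

(** Decay of order j + 1 for h yields order j for h', as the Bernstein-type bound loses a factor 1 +
    |x|. *)
Lemma rapid_derive rho A h : 0 < rho -> etype rho A h -> rapid h -> rapid (derive1 h).
Proof.
move=> r0 eh rh j.
have [K K0 HK] := etype_derive_le r0 eh.
have [D [_ _ bD]] := etype_derive eh.
have A0 := etype_ge0 (etype_derive eh).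
have [C HC] := rh j.+1.
have C0 : 0 <= C.
  by have := HC 0; rewrite normr0 expr0n mul0r.
have [_ [D' [D0' _ bD']]] := (0%N, etype_derive eh).
pose Cs := 2 ^+ j * (A * rho * expR (rho * 2)).
pose Cl := 2 * K * C * 4 ^+ j.+1 + K * j`!%:R.
have Cs0 : 0 <= Cs by rewrite mulr_ge0 ?exprn_ge0// mulr_ge0 ?expR_ge0.
have Cl0 : 0 <= Cl by rewrite addr_ge0 ?mulr_ge0 ?exprn_ge0.
(* From |x| >= 2 on, the window of radius (|x| + 1) / 2 around x stays at distance at least |x| / 4
   from 0; smaller x are handled by the exponential type alone. *)
exists (Cs + Cl) => x; have [x2|x2] := ltP `|x| 2.
  rewrite (@le_trans _ _ Cs) ?lerDl// /Cs; apply: ler_pM; rewrite ?exprn_ge0//.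
    by apply: lerXn2r; rewrite ?nnegrE// ltW.
  have := bD' 0%N x; rewrite D0' expr0 mulr1 => /le_trans; apply.
  by rewrite ler_wpM2l// ler_expR ler_pM2l// ltW.
rewrite (@le_trans _ _ Cl) ?lerDr//.
have x0 : 0 < `|x| by lra.
pose M := C * 4 ^+ j.+1 / `|x| ^+ j.+1.
have hM y : `|y - x| <= (`|x| + 1) / 2 -> `|h y| <= M.
  move=> yx; have y4 : `|x| / 4 <= `|y|.
    by have := ler_normB y (y - x); rewrite opprB addrC subrK; lra.
  have y0 : 0 < `|y| by rewrite (lt_le_trans _ y4)// divr_gt0.
  apply: (@le_trans _ _ (C / `|y| ^+ j.+1)).
    by rewrite ler_pdivlMr ?exprn_gt0// mulrC.
  rewrite /M -mulrA ler_wpM2l// -expr_div_n -exprVn; apply: lerXn2r.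
  - by rewrite nnegrE invr_ge0.
  - by rewrite nnegrE divr_ge0.
  - by rewrite -[4 / _]invf_div lef_pV2 ?posrE// divr_gt0.
have := HK x M hM => hx.
apply: (@le_trans _ _ (`|x| ^+ j * (K * (1 + `|x|) * M + K * expR (- `|x|)))).
  by rewrite ler_wpM2l ?exprn_ge0.
rewrite mulrDr /Cl lerD//.
  apply: (@le_trans _ _ (`|x| ^+ j * (K * (2 * `|x|) * M))).
    rewrite ler_wpM2l ?exprn_ge0// ler_wpM2r//.
      by rewrite /M divr_ge0 ?mulr_ge0 ?exprn_ge0.
    by rewrite ler_wpM2l//; lra.
  rewrite /M (exprSr `|x|); set u := 4 ^+ j.+1; set v := `|x| in x0 *.
  have v0 : v != 0 by rewrite gt_eqF.
  have w0 : v ^+ j != 0 by rewrite expf_neq0.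
  rewrite le_eqVlt; apply/orP; left; apply/eqP; field.
  by rewrite v0 w0.
rewrite mulrCA ler_wpM2l//.
have := pow_exp_le j ltr01 (normr_ge0 x).
case: (j) => [|i _].
  by rewrite expr0 fact0 !mul1r expR_le1 oppr_le0.
rewrite expRN ler_pdivrMr ?expR_gt0// mulrC -ler_pdivrMr ?ltr0n ?fact_gt0//.
by rewrite (le_trans _ (expR_ge1Dxn i (normr_ge0 x)))// lerDr.
Qed.

Lemma etype_rapid_schwartz rho A h : 0 < rho -> etype rho A h -> rapid h -> schwartz h.
Proof.
move=> r0 eh rh k.
have [Ak ek rk] : exists2 Ak, etype rho Ak (derive1n k h) & rapid (derive1n k h).
  elim: k => [|k [Ak ek rk]]; first by exists A.
  exists (Ak * rho); first exact: etype_derive.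
  exact: rapid_derive ek rk.
split.
- case: ek => D [D0 fD _] x; rewrite -D0; have := fD 0%N x => ?; exact: ex_derive.
- by move=> j; have [C HC] := rk j; exists C => x; rewrite normrM normrX.
Qed.

Lemma etype_primitive rho A P : 0 < rho -> etype rho A P -> exists S : R -> R,
  etype rho (A / rho) S /\ forall x, is_derive x 1 S (P x).
Proof.
move=> r0 eP; have A0 := etype_ge0 eP; case: eP => D [D0 fD bD].
pose d n := if n is m.+1 then D m 0 else 0.
have dA n : `|d n| <= A / rho * rho ^+ n.
  case: n => [|n]; first by rewrite normr0 mulr_ge0 ?exprn_ge0 ?divr_ge0// ltW.
  have := bD n 0; rewrite normr0 mulr0 expR0 mulr1 exprS mulrA divfK// gt_eqF//.
exists (ev d); split; first exact: etype_ev.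
move=> x; have := fam_ev dA 0 x.
rewrite (_ : ev (fun m => d (1 + m)%N) x = P x)//.
by rewrite -D0 -[x in RHS]add0r (etype_taylor 0 x (ltW r0) fD bD).
Qed.

(** A primitive [S] has the same type and is bounded, its increments being integrals of [P]; the
    Bernstein-type bound for [S] is then a linear bound for P = S'. *)
Lemma etype_integrable_growth rho A P : 0 < rho -> etype rho A P -> (forall x, 0 <= P x) ->
  (\int[mu]_x (P x)%:E < +oo)%E -> exists C : R, forall x, P x <= C * (1 + `|x|).
Proof.
move=> r0 eP P0 Pfin.
have cP := etype_continuous eP.
have mP : measurable_fun setT (EFin \o P).
  by apply/measurable_EFinP; exact: continuous_measurable_fun.
have [S [eS dS]] := etype_primitive r0 eP.
pose I := fine (\int[mu]_x (P x)%:E).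
have IE : (\int[mu]_x (P x)%:E = I%:E)%E.
  rewrite /I fineK// ge0_fin_numE//; apply: integral_ge0 => x _; rewrite lee_fin//.
have inc a b : a < b -> `|S b - S a| <= I.
  move=> ab.
  have cS := der_continuous dS.
  have F : (\int[mu]_(x in `[a, b]) (P x)%:E = (S b)%:E - (S a)%:E)%E.
    apply: continuous_FTC2 => //.
    - exact: continuous_subspaceT.
    - split.
      + by move=> x _; have := dS x => ?; exact: ex_derive.
      + by apply: cvg_at_right_filter; exact: cS.
      + by apply: cvg_at_left_filter; exact: cS.
    - by move=> x _; rewrite derive1E; have := dS x => ?; exact: derive_val.
  have h1 : (0 <= (S b - S a)%:E)%E.
    by rewrite EFinB -F; apply: integral_ge0 => x _; rewrite lee_fin.
  rewrite lee_fin in h1; rewrite ger0_norm// -lee_fin EFinB -F -IE.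
  apply: ge0_subset_integral => //= x _; rewrite lee_fin//.
have I0 : 0 <= I by apply: le_trans (inc 0 1 ltr01).
have Sb x : `|S x| <= I + `|S 0|.
  have [x0|x0|->] := ltgtP x 0; last by rewrite lerDr.
    by have := inc _ _ x0; have := ler_normB (S 0) (S 0 - S x); rewrite opprB addrC subrK; lra.
  by have := inc _ _ x0; have := ler_normD (S x - S 0) (S 0); rewrite subrK; lra.
have [K K0 HK] := etype_derive_le r0 eS.
exists (K * (I + `|S 0|) + K) => x.
have := HK x _ (fun y _ => Sb y).
rewrite derive1E; have := dS x => dSx; rewrite (@derive_val _ _ _ _ _ _ _ dSx) ger0_norm//.
have e1 : expR (- `|x|) <= 1 by rewrite expR_le1 oppr_le0.
have x0 := normr_ge0 x.
have t1 : K * expR (- `|x|) <= K * 1 by rewrite ler_wpM2l.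
have t2 : 0 <= K * `|x| by rewrite mulr_ge0.
move/le_trans; apply.
rewrite [leRHS](_ : _ = K * (1 + `|x|) * (I + `|S 0|) + (K * 1 + K * `|x|)); last by ring.
by rewrite lerD2l; lra.
Qed.

End RapidDecay.

(** * Folding integrals over the line onto the half-line *)

Section Folding.
Variable R : realType.
Local Notation mu := (@lebesgue_measure R).
Local Notation H := `[(0 : R), +oo[%classic.
Implicit Types (f g w : R -> R).

Lemma ge0_integral_fold f : continuous f -> (forall x, 0 <= f x) ->
  (\int[mu]_x (f x)%:E =
   \int[mu]_(x in H) (f x)%:E + \int[mu]_(x in H) (f (- x))%:E)%E.
Proof.
move=> cf f0.
have mf : measurable_fun [set: R] f by exact: continuous_measurable_fun.
rewrite -(setUv H) ge0_integral_setU//=; last 4 first.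
- exact: measurableC.
- by apply/measurable_EFinP; rewrite setUv.
- by move=> x _; rewrite lee_fin.
- exact/disj_setPCl.
congr (_ + _)%E.
rewrite setCitvr integral_itv_bndo_bndc; last exact/measurable_EFinP/measurable_funTS.
rewrite -{1}oppr0 ge0_integration_by_substitutionNy//.
exact: continuous_subspaceT.
Qed.

Lemma integrable_halves w : continuous w -> (forall x, 0 <= w x) ->
  mu.-integrable setT (EFin \o w) ->
  mu.-integrable H (EFin \o w) /\ mu.-integrable H (EFin \o (fun x => w (- x))).
Proof.
move=> cw w0 iw; split; first by apply: integrableS iw.
have cw' : continuous (fun x => w (- x)).
  by move=> x; apply: (@continuous_comp _ _ _ -%R w); [exact: continuousN|exact: cw].
apply/integrableP; split.
  by apply/measurable_EFinP; apply: measurable_funTS; exact: continuous_measurable_fun.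
have -> : (\int[mu]_(x in H) `|(EFin \o (fun x => w (- x)%R)) x| =
    \int[mu]_(x in H) (w (- x)%R)%:E)%E.
  by apply: eq_integral => x _ /=; rewrite ger0_norm.
have /integrableP[_] := iw.
have -> : (\int[mu]_x `|(EFin \o w) x| = \int[mu]_x (w x)%:E)%E.
  by apply: eq_integral => x _ /=; rewrite ger0_norm.
rewrite ge0_integral_fold//; apply: le_lt_trans; rewrite leeDr//.
by apply: integral_ge0 => x _; rewrite lee_fin.
Qed.

Lemma integrable_dominatedT f w : continuous f -> mu.-integrable setT (EFin \o w) ->
  (forall x, `|f x| <= w x) -> mu.-integrable setT (EFin \o f).
Proof.
move=> cf iw fw; apply: (@le_integrable _ _ _ mu setT _ _ (EFin \o w)) => //.
- by apply/measurable_EFinP; exact: continuous_measurable_fun.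
- by move=> x _; rewrite /= lee_fin (le_trans (fw x))// ler_norm.
Qed.

(** Write f as (f + w) - w, where both terms are nonnegative and fold separately. *)
Lemma Rintegral_fold f w : continuous f -> continuous w ->
  (forall x, `|f x| <= w x) -> mu.-integrable setT (EFin \o w) ->
  \int[mu]_x f x = \int[mu]_(x in H) f x + \int[mu]_(x in H) f (- x).
Proof.
move=> cf cw fw iw.
have w0 x : 0 <= w x by exact: le_trans (fw x).
have cN (k : R -> R) : continuous k -> continuous (fun x => k (- x)).
  by move=> ck x; apply: (@continuous_comp _ _ _ -%R k); [exact: continuousN|exact: ck].
have itf := integrable_dominatedT cf iw fw.
have [iw1 iw2] := integrable_halves cw w0 iw.
have if1 : mu.-integrable H (EFin \o f) by apply: integrable_dominated iw1 _.
have if2 : mu.-integrable H (EFin \o (fun x => f (- x))).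
  by apply: integrable_dominated iw2 _; [exact: cN|move=> x _; exact: fw].
pose k x := f x + w x.
have ck : continuous k by move=> x; apply: cvgD; [exact: cf|exact: cw].
have k0 x : 0 <= k x by have := fw x; rewrite ler_norml /k => /andP[h _]; lra.
have ik : mu.-integrable setT (EFin \o k).
  apply: (@integrable_dominatedT k (fun x => w x + w x)) => //.
    have := integrableD measurableT iw iw.
    by apply: eq_integrable => // x _; rewrite /= EFinD.
  by move=> x; rewrite (le_trans (ler_normD _ _))// lerD// ger0_norm.
have fold (g : R -> R) : continuous g -> (forall x, 0 <= g x) ->
    mu.-integrable setT (EFin \o g) ->
    \int[mu]_x g x = \int[mu]_(x in H) g x + \int[mu]_(x in H) g (- x).
  move=> cg g0 ig; have [i1 i2] := integrable_halves cg g0 ig.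
  rewrite /Rintegral ge0_integral_fold// fineD//.
  - exact: (integrable_fin_num _ i1).
  - exact: (integrable_fin_num _ i2).
have e1 := fold k ck k0 ik; have e2 := fold w cw w0 iw.
move: e1; rewrite /k (RintegralD measurableT itf iw) (RintegralD _ if1 iw1)// (RintegralD _ if2 iw2)//.
rewrite e2; lra.
Qed.

Lemma integrable_oneDsqrVT (C : R) : 0 <= C ->
  mu.-integrable setT (EFin \o (fun x : R => C * (oneDsqr x)^-1)).
Proof.
move=> C0.
have cV : continuous (fun x : R => C * (oneDsqr x)^-1).
  by move=> x; apply: cvgM; [exact: cvg_cst|exact: continuous_oneDsqrV].
have V0 (x : R) : 0 <= C * (oneDsqr x)^-1 by rewrite mulr_ge0// invr_ge0.
apply/integrableP; split.
  by apply/measurable_EFinP; exact: continuous_measurable_fun.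
have -> : (\int[mu]_x `|(EFin \o (fun x : R => C * (oneDsqr x)^-1)%R) x| =
    \int[mu]_x (C * (oneDsqr x)^-1)%:E)%E.
  by apply: eq_integral => x _ /=; rewrite ger0_norm.
rewrite ge0_integral_fold//.
have -> : (\int[mu]_(x in H) (C * (oneDsqr (- x)%R)^-1)%:E = \int[mu]_(x in H) (C * (oneDsqr x)^-1)%:E)%E.
  by apply: eq_integral => x _; rewrite /oneDsqr sqrrN.
have -> : (\int[mu]_(x in H) (C * (oneDsqr x)^-1)%:E = (C * (pi / 2))%:E)%E.
  under eq_integral do rewrite EFinM.
  rewrite ge0_integralZl//.
  - by rewrite integral0y_oneDsqr EFinM.
  - apply/measurable_EFinP; apply: measurable_funTS.
    by apply: continuous_measurable_fun; exact: continuous_oneDsqrV.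
exact: (ltry (C * (pi / 2) + C * (pi / 2))).
Qed.

End Folding.

(** * Dilations and densities *)

Section Dilation.
Variable R : realType.
Local Notation mu := (@lebesgue_measure R).
Implicit Types (f g p P W : R -> R) (x y : R).

Lemma continuous_dilate f (c : R) : continuous f -> continuous (fun x => f (c * x)).
Proof.
move=> cf x; apply: (@continuous_comp _ _ _ (fun x => c * x) f); last exact: cf.
by apply: cvgM; [exact: cvg_cst|exact: cvg_id].
Qed.

Lemma continuous_sqr f : continuous f -> continuous (fun x => f x ^+ 2).
Proof. by move=> cf; apply: (@continuous_mul R f f). Qed.

Lemma cvg_comp_continuous f (u : nat -> R) (v : R) : continuous f ->
  u @ \oo --> v -> (fun n => f (u n)) @ \oo --> f v.
Proof. by move=> cf cu; apply: (@cvg_comp _ _ _ u f); [exact: cu|exact: cf]. Qed.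

Lemma ge0_integral_dilate f (c : R) : 0 < c -> continuous f -> (forall x, 0 <= f x) ->
  (\int[mu]_x (f x)%:E = \int[mu]_x (f (c * x)%R * c)%:E)%E.
Proof.
move=> c0 cf f0.
have d x : is_derive x 1 (fun y : R => c * y) c.
  by have := der_scale c (der_id x); rewrite mulr1.
have E : (fun y : R => c * y)^`()%classic = cst c.
  by apply/funext => x; rewrite derive1E; have [_ ->] := d x.
rewrite (@increasing_ge0_integration_by_substitutionT R (fun y => c * y) f)//.
- by apply: eq_integral => x _; rewrite E.
- by move=> x y xy; rewrite ltr_pM2l.
- by rewrite E; move=> x; exact: cvg_cst.
- by rewrite E; exact: is_cvg_cst.
- by rewrite E; exact: is_cvg_cst.
- by apply: gt0_cvgMrNy => //; exact: cvg_id.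
- by apply: gt0_cvgMry => //; exact: cvg_id.
Qed.

(** The substitution y = l_n x moves the dilation off [P], so that dominated convergence works with
    a fixed combination of P and y^2 P; no pointwise bound on [P] enters. *)
Lemma integral_dilate_cvg P g p W (a b : R) (l e : nat -> R) :
  continuous P -> (forall x, 0 <= P x) ->
  continuous g -> (forall x, `|g x| <= 1) -> g 0 = 1 ->
  continuous p -> (forall x, 0 <= p x <= a + b * x ^+ 2) -> 0 <= b ->
  continuous W -> (forall x, 0 <= W x <= 2) ->
  (forall n, 2^-1 <= l n <= 1) -> l @ \oo --> (1 : R) -> e @ \oo --> (0 : R) ->
  mu.-integrable setT (EFin \o P) ->
  mu.-integrable setT (EFin \o (fun x => x ^+ 2 * P x)) ->
  (\int[mu]_x (p x * (P (l n * x) * g (e n * x) ^+ 2) * W x)%:E)%E @[n --> \oo] -->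
  (\int[mu]_x (p x * P x * W x)%:E)%E.
Proof.
move=> cP P0 cg g1 g0 cp p0 b0 cW W0 l12 l1 e0 iP ix2P.
have lgt n : 0 < l n by have /andP[+ _] := l12 n; apply: lt_le_trans; rewrite invr_gt0.
pose c n := (l n)^-1.
have cgt n : 0 < c n by rewrite invr_gt0.
have c2 n : c n <= 2.
  by rewrite /c -[leRHS]invrK lef_pV2 ?posrE ?invr_gt0//; have /andP[] := l12 n.
have c1 : c @ \oo --> (1 : R).
  by rewrite -[1 in X in _ --> X]invr1; apply: cvgV => //; exact: oner_neq0.
pose f n y := p (c n * y) * (P y * g (e n * (c n * y)) ^+ 2) * W (c n * y) * c n.
have cf n : continuous (f n).
  apply: continuous_mul; last by move=> x; exact: cvg_cst.
  apply: continuous_mul; last exact: continuous_dilate.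
  apply: continuous_mul; first exact: continuous_dilate.
  apply: continuous_mul => //.
  have cgg : continuous (fun y => g (e n * (c n * y))).
    exact: (@continuous_dilate (fun u => g (e n * u)) (c n) (@continuous_dilate g (e n) cg)).
  exact: continuous_sqr.
have -> : (fun n => \int[mu]_x (p x * (P (l n * x) * g (e n * x) ^+ 2) * W x)%:E)%E =
    (fun n => \int[mu]_x (f n x)%:E)%E.
  apply/funext => n; rewrite (ge0_integral_dilate (c := c n))//.
  - apply: eq_integral => x _; rewrite /f /c; congr (_ %:E).
    by rewrite (mulrA (l n) _ x) divff ?mul1r// gt_eqF.
  - apply: continuous_mul => //; apply: continuous_mul => //.
    apply: continuous_mul; first exact: continuous_dilate.
    by apply: continuous_sqr; exact: continuous_dilate.
  - move=> x; have /andP[p00 _] := p0 x; have /andP[W00 _] := W0 x.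
    apply: mulr_ge0 => //; apply: mulr_ge0 => //; apply: mulr_ge0 => //; exact: sqr_ge0.
(* As c_n <= 2, the polynomial is at most a + 4 b y^2; the weight and the Jacobian contribute a
   factor 2 each. *)
pose w y := 4 * a * P y + 16 * b * (y ^+ 2 * P y).
have iw : mu.-integrable setT (EFin \o w).
  rewrite (_ : EFin \o w = (fun y => (4 * a)%:E * (EFin \o P) y
     + (16 * b)%:E * (EFin \o (fun x => x ^+ 2 * P x)%R) y)%E).
    by apply: integrableD => //; apply: integrableZl.
  by apply/funext => y; rewrite /w /= EFinD !EFinM.
have fw n y : `|f n y| <= w y.
  have /andP[p00 p1] := p0 (c n * y); have /andP[W00 W2] := W0 (c n * y).
  have gg : g (e n * (c n * y)) ^+ 2 <= 1.
    by rewrite -[g _ ^+ 2]real_normK ?num_real// expr_le1.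
  have cc : (c n * y) ^+ 2 <= 4 * y ^+ 2.
    rewrite exprMn ler_wpM2r ?sqr_ge0// (_ : 4 = 2 ^+ 2); last by ring.
    by rewrite ler_pXn2r ?nnegrE ?(ltW (cgt n)).
  have pe : p (c n * y) <= a + b * (4 * y ^+ 2).
    by apply: le_trans p1 _; rewrite lerD2l ler_wpM2l.
  have c0 := ltW (cgt n); have Py := P0 y.
  rewrite /f; move: gg (sqr_ge0 (g (e n * (c n * y)))); move: (g _ ^+ 2) => q q1 q0.
  rewrite ger0_norm; last by rewrite !mulr_ge0.
  have -> : w y = (a + b * (4 * y ^+ 2)) * (P y * 1) * 2 * 2 by rewrite /w; ring.
  apply: ler_pM => //; first by rewrite !mulr_ge0.
  apply: ler_pM => //; first by rewrite !mulr_ge0.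
  by apply: ler_pM => //; [rewrite mulr_ge0|apply: ler_pM].
apply: (@dominated_cvg _ _ _ mu setT measurableT (fun n x => (f n x)%:E) _ (EFin \o w)) => //.
- by move=> n; apply/measurable_EFinP; exact: continuous_measurable_fun.
- move=> x _; apply: cvg_EFin; first exact: nearW.
  have cx : (fun n => c n * x) @ \oo --> x.
    by rewrite -[x in X in _ --> X]mul1r; apply: cvgM => //; exact: cvg_cst.
  have ce : (fun n => e n * (c n * x)) @ \oo --> (0 : R).
    by rewrite -[0 in X in _ --> X](mul0r x); apply: cvgM.
  have -> : p x * P x * W x = p x * (P x * (g 0 * g 0)) * W x * 1 by rewrite g0; ring.
  rewrite /f /comp /=; under eq_fun do rewrite expr2.
  apply: cvgM => //; apply: cvgM; last exact: (cvg_comp_continuous cW cx).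
  apply: cvgM; first exact: (cvg_comp_continuous cp cx).
  apply: cvgM; first exact: cvg_cst.
  by apply: cvgM; exact: (cvg_comp_continuous cg ce).
- by move=> n x _; rewrite /= lee_fin.
Qed.

End Dilation.

(** * Bounds for the densities *)

Section DensityBounds.
Variable R : realType.
Implicit Types (x : R) (G : symgroup).

Lemma sinc2piE x : sinc2pi x = sinc (2 * pi * x).
Proof.
rewrite /sinc2pi; case: eqP => [->|/eqP x0]; first by rewrite mulr0 sinc0.
by rewrite -sincE mulrC mulKf// !mulf_neq0// gt_eqF// pi_gt0.
Qed.

Lemma continuous_sinc2pi : continuous (@sinc2pi R).
Proof.
rewrite (_ : @sinc2pi R = fun x => sinc (2 * pi * x)); last exact/funext/sinc2piE.
by apply: continuous_dilate; exact: etype_continuous (etype_sinc R).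
Qed.

Lemma continuous_W G : continuous (@W_ac R G).
Proof.
have cs := continuous_sinc2pi.
case: G; rewrite /W_ac => x; try exact: cvg_cst;
  by [apply: cvgB; [exact: cvg_cst|exact: cs]|apply: cvgD; [exact: cvg_cst|exact: cs]].
Qed.

Lemma W_ac_bound G x : 0 <= W_ac G x <= 2.
Proof.
have := sinc_le1 (2 * pi * x); rewrite -sinc2piE ler_norml => /andP[h1 h2].
by case: G; rewrite /W_ac; apply/andP; split; lra.
Qed.

(** Here 2 pi |x| >= 2, so |sinc| <= 1/2. Near 0 no uniform bound is possible: the densities of Sp
    and SO(odd) vanish at 0. *)
Lemma W_ac_ge_half G x : 1 <= `|x| -> 2^-1 <= W_ac G x.
Proof.
move=> x1; have := sinc_leV (2 * pi * x); rewrite -sinc2piE.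
have pi2 := pi_ge2 R.
have h : 2 <= `|2 * pi * x|.
  rewrite normrM ger0_norm; last by rewrite mulr_ge0// pi_ge0.
  rewrite -[leLHS]mulr1; apply: ler_pM => //; lra.
move=> h1; have : `|sinc2pi x| <= 2^-1.
  have : 2 * `|sinc2pi x| <= 1 by apply: le_trans h1; rewrite ler_wpM2r.
  by lra.
rewrite ler_norml => /andP[h2 h3].
by case: G; rewrite /W_ac; lra.
Qed.

Lemma sinc2piN x : sinc2pi (- x) = sinc2pi x.
Proof. by rewrite /sinc2pi oppr_eq0 !mulrN sinN invrN mulrNN. Qed.

Lemma W_acN G x : W_ac G (- x) = W_ac G x.
Proof. by case: G; rewrite /W_ac ?sinc2piN. Qed.

Lemma W_atom_ge0 G : 0 <= W_atom R G.
Proof. by case: G => //=; rewrite ?invr_ge0. Qed.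

End DensityBounds.

(** * Fourier transforms of rapidly decreasing even functions of exponential type *)

Section RapidIntegrals.
Variable R : realType.
Local Notation mu := (@lebesgue_measure R).
Local Notation H := `[(0 : R), +oo[%classic.
Implicit Types (f h : R -> R) (x y : R).

Lemma rapid_dominated f : rapid f -> exists2 C : R, 0 <= C &
  forall x, `|f x| <= C * (oneDsqr x)^-1.
Proof.
move=> /rapid_bound[C HC]; exists C.
  have := HC 0; rewrite normr0 addr0 mulr1 /oneDsqr expr0n /= addr0 invr1 mulr1.
  exact: le_trans.
by move=> x; apply: le_trans (HC x); rewrite ler_peMr// lerDl.
Qed.

Let mH : measurable (H : set (measurableTypeR R)).
Proof. exact: measurable_itv. Qed.

Lemma continuous_reflect f : continuous f -> continuous (fun x => f (- x)).
Proof.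
by move=> cf x; apply: (@continuous_comp _ _ _ -%R f); [exact: continuousN|exact: cf].
Qed.

Let contC (C : R) : continuous (fun x : R => C * (oneDsqr x)^-1).
Proof. by move=> x; apply: cvgM; [exact: cvg_cst|exact: continuous_oneDsqrV]. Qed.

Lemma rapid_integrable f : continuous f -> rapid f -> mu.-integrable setT (EFin \o f).
Proof.
move=> cf /rapid_dominated[C C0 HC].
exact: integrable_dominatedT cf (integrable_oneDsqrVT C0) HC.
Qed.

Lemma rapid_integrableH f : continuous f -> rapid f -> mu.-integrable H (EFin \o f).
Proof. by move=> cf rf; apply: integrableS (rapid_integrable cf rf). Qed.

Lemma rapid_fold f : continuous f -> rapid f ->
  \int[mu]_x f x = \int[mu]_(x in H) f x + \int[mu]_(x in H) f (- x).
Proof.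
move=> cf /rapid_dominated[C C0 HC].
exact: (@Rintegral_fold R f (fun x => C * (oneDsqr x)^-1) cf (@contC C) HC
  (integrable_oneDsqrVT C0)).
Qed.

Lemma Rintegral_even_part f : continuous f -> rapid f ->
  \int[mu]_x (2^-1 * (f x + f (- x))) = \int[mu]_x f x.
Proof.
move=> cf rf; have cf' := continuous_reflect cf; have rf' := rapid_reflect rf.
pose k x := f x + f (- x).
have ck : continuous k by move=> x; apply: cvgD; [exact: cf|exact: cf'].
have rk : rapid k by exact: rapidD.
have ck2 : continuous (fun x => 2^-1 * k x).
  by apply: continuous_mul => // x; exact: cvg_cst.
have rk2 : rapid (fun x => 2^-1 * k x).
  by apply: (@rapid_poly_mul _ _ (fun=> 2^-1) 0 2^-1) => // x; rewrite expr0 mulr1 ger0_norm.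
rewrite (rapid_fold ck2 rk2) (rapid_fold cf rf).
have -> : \int[mu]_(x in H) (2^-1 * k (- x)) = \int[mu]_(x in H) (2^-1 * k x).
  by apply: eq_Rintegral => x _; rewrite /k opprK addrC.
rewrite (RintegralZl 2^-1 mH (rapid_integrableH ck rk)).
rewrite (RintegralD mH (rapid_integrableH cf rf) (rapid_integrableH cf' rf')).
by lra.
Qed.

Let cosM_cont (t : R) f : continuous f -> continuous (fun x => f x * cos (t * x)).
Proof.
move=> cf; apply: continuous_mul => // x.
apply: (@continuous_comp _ _ _ (fun x => t * x) cos); last exact: continuous_cos.
by apply: cvgM; [exact: cvg_cst|exact: cvg_id].
Qed.

Let sinM_cont (t : R) f : continuous f -> continuous (fun x => f x * sin (t * x)).
Proof.
move=> cf; apply: continuous_mul => // x.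
apply: (@continuous_comp _ _ _ (fun x => t * x) sin); last exact: continuous_sin.
by apply: cvgM; [exact: cvg_cst|exact: cvg_id].
Qed.

Let rapid_bddM f k : (forall x, `|k x| <= 1) -> rapid f -> rapid (fun x => f x * k x).
Proof.
move=> k1 rf; under eq_fun do rewrite mulrC.
by apply: (@rapid_poly_mul _ _ k 0 1) => // x; rewrite expr0 mulr1.
Qed.

Lemma fourier_etype_eq0 (r A : R) h (xi : R) : 0 < r -> etype r A h -> rapid h ->
  (forall x, h (- x) = h x) -> r < `|2 * pi * xi| -> fourier h xi = 0.
Proof.
move=> r0 eh rh hN rxi; have ch := etype_continuous eh.
pose t := `|2 * pi * xi|.
apply/eqP; rewrite eq_complex /=; apply/andP; split; apply/eqP.
  have -> : \int[mu]_x (h x * cos (2 * pi * x * xi)) = \int[mu]_x (h x * cos (t * x)).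
    apply: eq_Rintegral => x _; congr (_ * _); rewrite /t.
    have -> : 2 * pi * x * xi = 2 * pi * xi * x by ring.
    by case: (ger0P (2 * pi * xi)) => // _; rewrite mulNr cosN.
  rewrite rapid_fold.
  - have -> : \int[mu]_(x in H) (h (- x) * cos (t * - x)) = \int[mu]_(x in H) (h x * cos (t * x)).
      by apply: eq_Rintegral => x _; rewrite hN mulrN cosN.
    have [C HC] := rapid_bound rh; case: eh => D [D0 fD bD].
    have := @band_limited_cos_integral0 R r A C t D r0 fD bD.
    by rewrite D0 => /(_ hN HC rxi) ->; rewrite addr0.
  - exact: cosM_cont.
  - by apply: rapid_bddM => // x; exact: cos_max.
have -> : \int[mu]_x (h x * sin (2 * pi * x * xi)) = \int[mu]_x (h x * sin (2 * pi * xi * x)).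
  by apply: eq_Rintegral => x _; congr (_ * sin _); ring.
have cs : continuous (fun x => h x * sin (2 * pi * xi * x)) by exact: sinM_cont.
have rs : rapid (fun x => h x * sin (2 * pi * xi * x)).
  by apply: rapid_bddM => // x; exact: sin_max.
rewrite (rapid_fold cs rs).
have -> : \int[mu]_(x in H) (h (- x) * sin (2 * pi * xi * - x)) =
    \int[mu]_(x in H) (-1 * (h x * sin (2 * pi * xi * x))).
  by apply: eq_Rintegral => x _; rewrite hN mulrN sinN; ring.
by rewrite (RintegralZl (-1) mH (rapid_integrableH cs rs)) mulN1r subrr oppr0.
Qed.

(** The transform vanishes off the closed interval of radius r / (2 pi) < Delta, so the closure in
    [fourier_supp] stays inside it. *)
Lemma fourier_supp_etype (r A Delta : R) h : 0 < r -> r < 2 * pi * Delta ->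
  etype r A h -> rapid h -> (forall x, h (- x) = h x) ->
  fourier_supp h `<=` [set` `]- Delta, Delta[].
Proof.
move=> r0 rD eh rh hN; have pi0 := pi_gt0 R.
have p2 : 0 < 2 * pi :> R by rewrite mulr_gt0.
pose s := r / (2 * pi).
have sub : [set xi | fourier h xi != 0] `<=` [set` `[- s, s]].
  move=> xi /= /negP h0; rewrite in_itv /= -ler_norml leNgt; apply/negP => sx; apply: h0.
  apply/eqP; apply: (fourier_etype_eq0 r0 eh rh hN).
  by rewrite normrM (gtr0_norm p2) mulrC -ltr_pdivrMr.
move=> x /(closure_subset sub).
rewrite -(proj1 (closure_id _) (itv_closed (x := - s) (y := s))) /= !in_itv /=.
have sD : s < Delta by rewrite /s ltr_pdivrMr// mulrC.
by move=> /andP[h1 h2]; apply/andP; split; lra.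
Qed.

End RapidIntegrals.

(** * Sums over zeros *)

Section ZeroSums.
Variables (R : realType) (F : Lfamily R) (o : ordering).

Lemma nontrivial_zero_dual (f : F) (gamma : R) :
  nontrivial_zero f (critical_pt gamma) -> nontrivial_zero (dual f) (critical_pt (- gamma)).
Proof.
rewrite /nontrivial_zero Lambda_fe => /eqP; rewrite mulf_eq0 => /orP[/eqP e0|/eqP].
  by have := rootnum_norm f; rewrite e0 cmod0 => /eqP; rewrite eq_sym oner_eq0.
rewrite (_ : 1 - critical_pt gamma = critical_pt (- gamma))//.
apply/eqP; rewrite eq_complex /= add0r eqxx andbT; apply/eqP.
by lra.
Qed.

Lemma subfamily_dual (f : F) (Q : R) : subfamily F o Q f -> subfamily F o Q (dual f).
Proof. by rewrite /subfamily; case: o => /=; rewrite cond_dual. Qed.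

Lemma normalized_dual (f : F) (gamma : R) :
  normalized (dual f) (- gamma) = - normalized f gamma.
Proof. by rewrite /normalized cond_dual !mulNr. Qed.

Lemma zero_average_ge0 (phi : R -> R) (alpha m Q : R) :
  (forall x, m < `|x - alpha| -> m < `|x + alpha| -> 0 <= phi x) ->
  (m%:E < min_zero_dist F o alpha Q)%E -> (0 <= zero_average F o phi Q)%E.
Proof.
move=> phi0 mQ.
have far f gamma : subfamily F o Q f -> nontrivial_zero f (critical_pt gamma) ->
    m < `|normalized f gamma - alpha|.
  move=> fQ z; rewrite -lte_fin; apply: lt_le_trans mQ _.
  by apply: ereal_inf_lbound; exists f, gamma.
apply: mule_ge0; first by rewrite lee_fin invr_ge0.
apply: fsume_ge0 => f fQ; rewrite /zero_sum /=.
have pos (p : R * nat) : zeros_with_mult f p -> 0 <= phi (normalized f p.1).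
  move=> /(_ 0%N (leq0n _)) z0; apply: phi0; first exact: far.
  have := far _ _ (subfamily_dual fQ) (nontrivial_zero_dual z0).
  by rewrite normalized_dual -opprD normrN.
(* The negative parts vanish at every zero, so the subtracted sum is 0 and no difference of
   infinities arises. *)
rewrite [X in (_ - X)%E]esum1; last first.
  by move=> p /pos h; rewrite funenegE; apply/max_idPr; rewrite leeNl oppe0 lee_fin.
by rewrite sube0; apply: esum_ge0 => p _; exact: funepos_ge0.
Qed.

(** The limsup is an infimum of suprema over the sets of the filter, and the set of Q with negative
    average is one of them because l < 0. *)
Lemma limf_esup_min_zero_dist_le (phi : R -> R) (alpha m : R) (l : \bar R) :
  (forall x, m < `|x - alpha| -> m < `|x + alpha| -> 0 <= phi x) ->
  zero_average F o phi Q @[Q --> Q_to_infty F o] --> l -> (l < 0)%E ->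
  (limf_esup (min_zero_dist F o alpha) (Q_to_infty F o) <= m%:E)%E.
Proof.
move=> phi0 cv l0.
have V := cv _ (open_ereal_lt' l0).
apply: (@le_trans _ _ (ereal_sup
  [set min_zero_dist F o alpha Q | Q in [set Q | (zero_average F o phi Q < 0)%E]])).
  by apply: ereal_inf_lbound; exists [set Q | (zero_average F o phi Q < 0)%E].
apply: ge_ereal_sup => _ [Q /= neg <-]; rewrite leNgt; apply/negP => mQ.
by have := zero_average_ge0 phi0 mQ; rewrite leNgt neg.
Qed.

End ZeroSums.

(** * The test function *)

Section ExtremalFunction.
Variables (R : realType) (tau : R) (G : symgroup) (F : Cplx R -> Cplx R).
Hypothesis tau0 : 0 < tau.
Hypothesis HF : in_H tau F.
Hypothesis Fn0 : exists z, F z != 0.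
Local Notation mu := (@lebesgue_measure R).

Definition sqmod (x : R) : R := cmod (F (ofreal x)) ^+ 2.

Lemma sqmod_ge0 x : 0 <= sqmod x. Proof. exact: sqr_ge0. Qed.

Lemma etype_sqmod (rho : R) : tau < rho -> exists A, etype (rho + rho) A sqmod.
Proof. by case: HF => eF tF _; exact: entire_sqr_etype. Qed.

Lemma continuous_sqmod : continuous sqmod.
Proof. by have [|A] := @etype_sqmod (tau + 1); [rewrite ltrDl|exact: etype_continuous]. Qed.

Lemma sqmod_growth : exists C : R, forall x, sqmod x <= C * (1 + `|x|).
Proof.
have t1 : tau < tau + 1 by rewrite ltrDl.
have [A eA] := etype_sqmod t1.
apply: (etype_integrable_growth _ eA sqmod_ge0); last by case: HF.
by have t0 := tau0; lra.
Qed.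

Lemma ge0_integrable_continuous (f : R -> R) : continuous f -> (forall x, 0 <= f x) ->
  (\int[mu]_x (f x)%:E < +oo)%E -> mu.-integrable setT (EFin \o f).
Proof.
move=> cf f0 fin; apply/integrableP; split.
  by apply/measurable_EFinP; exact: continuous_measurable_fun.
apply: le_lt_trans fin; rewrite le_eqVlt; apply/orP; left; apply/eqP.
by apply: eq_integral => x _ /=; rewrite ger0_norm.
Qed.

Lemma integrable_sqmod : mu.-integrable setT (EFin \o sqmod).
Proof.
apply: ge0_integrable_continuous; [exact: continuous_sqmod|exact: sqmod_ge0|].
by case: HF.
Qed.

(* Otherwise all derivatives of |F|^2 vanish at 2, hence |F|^2 = 0 by its Taylor expansion. *)
Lemma sqmod_gt0_right : exists2 x0 : R, 1 < x0 & 0 < sqmod x0.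
Proof.
apply: contrapT => h.
have Pz x : 1 < x -> sqmod x = 0.
  move=> x1; apply/eqP; apply/negPn/negP => Px; apply: h; exists x => //.
  by rewrite lt_neqAle eq_sym Px sqmod_ge0.
have t1 : tau < tau + 1 by rewrite ltrDl.
have [A [D [D0 fD bD]]] := etype_sqmod t1.
have Dz n : forall x, 1 < x -> D n x = 0.
  elim: n => [|n IH] x x1; first by rewrite D0 Pz.
  exact: (eq_derive0 x1 IH (fD n x)).
have P00 x : sqmod x = 0.
  have r0 : 0 <= tau + 1 + (tau + 1) by have t0 := tau0; lra.
  have := etype_taylor 2 (x - 2) r0 fD bD; rewrite D0 (addrC 2) subrK => ->.
  apply/eqP; rewrite -normr_eq0 eq_le normr_ge0 andbT.
  rewrite -[leRHS](mul0r (expR (1 * `|x - 2|))); apply: ev_le => n.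
  by rewrite Dz ?normr0 ?mul0r//; lra.
have [z /eqP] := Fn0; apply; case: HF => eF tF _; apply: (entire_eq0_real tau0 eF tF) => x.
by apply/eqP; rewrite -cmod_eq0 -sqrf_eq0 -/(sqmod x) P00.
Qed.

(** Positivity is tested on a short interval starting at some x0 > 1, where every density is at
    least 1/2. *)
Lemma integral_sqmodW_gt0 : (0 < \int[mu]_x (sqmod x * W_ac G x)%:E)%E.
Proof.
have [x0 x01 Px0] := sqmod_gt0_right.
have h : sqmod x0 / 2 < sqmod x0 by lra.
have cS : continuous sqmod := continuous_sqmod.
have near0 : \forall y \near x0, sqmod x0 / 2 < sqmod y by exact: (cvgr_gt _ (cS x0) _ h).
have [d /= d0 Hd] := proj1 (nbhs_ballP _ _) near0.
pose J := `[x0, x0 + d / 2]%classic.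
have mJ : measurable (J : set (measurableTypeR R)) by exact: measurable_itv.
have cPW : continuous (fun x => sqmod x * W_ac G x).
  by apply: continuous_mul; [exact: continuous_sqmod|exact: continuous_W].
have mPW : measurable_fun setT (fun x => (sqmod x * W_ac G x)%:E).
  by apply/measurable_EFinP; exact: continuous_measurable_fun.
have PW0 x : 0 <= sqmod x * W_ac G x.
  by rewrite mulr_ge0 ?sqmod_ge0//; have /andP[] := W_ac_bound G x.
have muJ : (0 < lebesgue_measure (J : set R))%E.
  rewrite /J lebesgue_measure_itv /= lte_fin ltrDl divr_gt0//.
  by rewrite -EFinB lte_fin; lra.
apply: (@lt_le_trans _ _ (\int[mu]_(x in J) (cst (sqmod x0 / 4)%:E x))%E).
  rewrite integral_cst//; apply: mule_gt0; first by rewrite lte_fin; lra.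
  exact: muJ.
apply: (@le_trans _ _ (\int[mu]_(x in J) (sqmod x * W_ac G x)%:E)%E).
  apply: ge0_le_integral => //.
  - by move=> x _; rewrite lee_fin; lra.
  - exact: measurable_funTS.
  - move=> x; rewrite /J /= in_itv /= => /andP[x1 x2]; rewrite lee_fin.
    have Px : sqmod x0 / 2 < sqmod x.
      by apply: Hd; rewrite /ball /= ltr_norml; apply/andP; split; lra.
    have Wx : 2^-1 <= W_ac G x by apply: W_ac_ge_half; rewrite ger0_norm; lra.
    have -> : sqmod x0 / 4 = sqmod x0 / 2 * 2^-1 by lra.
    by apply: ler_pM => //; lra.
by apply: ge0_subset_integral => // x _; rewrite lee_fin.
Qed.

End ExtremalFunction.

(** * From a competitor in the extremal problem to an admissible test function *)

Section TestFunction.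
Variables (R : realType) (alpha Delta m : R) (G : symgroup) (F : Cplx R -> Cplx R).
Hypothesis Delta0 : 0 < Delta.
Hypothesis m0 : 0 < m.
Hypothesis HF : in_H (pi * Delta) F.
Hypothesis Fn0 : exists z, F z != 0.
Local Notation mu := (@lebesgue_measure R).
Local Notation P := (sqmod F).
Local Notation W := (@W_ac R G).
Let tau : R := pi * Delta.
Let tau0 : 0 < tau. Proof. by rewrite mulr_gt0// pi_gt0. Qed.
Let P0 := @sqmod_ge0 R F.
Let cP : continuous P := continuous_sqmod tau0 HF.
Let cW : continuous W := @continuous_W R G.
Let W0 x : 0 <= W x. Proof. by have /andP[] := W_ac_bound G x. Qed.
Let W2 x : W x <= 2. Proof. by have /andP[] := W_ac_bound G x. Qed.

Let cshift : continuous (fun x : R => (x - alpha) ^+ 2).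
Proof.
by apply: continuous_sqr => x; apply: cvgB; [exact: cvg_id|exact: cvg_cst].
Qed.

Let sqr_shift_le x : (x - alpha) ^+ 2 <= 2 * alpha ^+ 2 + 2 * x ^+ 2.
Proof. by have := sqr_ge0 (x + alpha); rewrite !expr2; lra. Qed.

(** For |x| >= 1 the density is removed at the cost of a factor 2 and x^2 <= 2 (x - alpha)^2 + 2
    alpha^2; for |x| <= 1 simply x^2 <= 1 and [P] is integrable. *)
Let integrable_x2P :
  (\int[mu]_x ((x - alpha) ^+ 2 * P x * W x)%:E < +oo)%E ->
  mu.-integrable setT (EFin \o (fun x => x ^+ 2 * P x)).
Proof.
move=> fin.
have iN : mu.-integrable setT (EFin \o (fun x => (x - alpha) ^+ 2 * P x * W x)).
  apply: ge0_integrable_continuous fin.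
    by apply: continuous_mul => //; exact: continuous_mul.
  by move=> x; apply: mulr_ge0 => //; apply: mulr_ge0 => //; exact: sqr_ge0.
pose w x := (1 + 2 * alpha ^+ 2) * P x + 4 * ((x - alpha) ^+ 2 * P x * W x).
have iw : mu.-integrable setT (EFin \o w).
  rewrite (_ : EFin \o w = (fun y => (1 + 2 * alpha ^+ 2)%:E * (EFin \o P) y
     + 4%:E * (EFin \o (fun x => (x - alpha) ^+ 2 * P x * W x)%R) y)%E).
    by apply: integrableD => //; apply: integrableZl => //; exact: integrable_sqmod tau0 HF.
  by apply/funext => y; rewrite /w /= EFinD !EFinM.
apply: integrable_dominatedT iw _.
  by apply: continuous_mul => //; apply: continuous_sqr => x; exact: cvg_id.
move=> x; rewrite ger0_norm; last by apply: mulr_ge0 => //; exact: sqr_ge0.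
rewrite /w.
have Px := P0 x; have aP : 0 <= alpha ^+ 2 * P x by apply: mulr_ge0 => //; exact: sqr_ge0.
have [x1|/ltW x1] := leP 1 `|x|.
  have Wx := W_ac_ge_half G x1.
  have h1 : x ^+ 2 <= 2 * (x - alpha) ^+ 2 + 2 * alpha ^+ 2.
    by have := sqr_ge0 (x - alpha - alpha); rewrite !expr2; lra.
  have h2 := ler_wpM2r Px h1.
  have aP' : 0 <= (x - alpha) ^+ 2 * P x by apply: mulr_ge0 => //; exact: sqr_ge0.
  have h3 := ler_wpM2l aP' Wx.
  by lra.
have h1 : x ^+ 2 <= 1 by rewrite -[x ^+ 2]real_normK ?num_real// expr_le1.
have h2 := ler_wpM2r Px h1.
have h3 : 0 <= (x - alpha) ^+ 2 * P x * W x by apply: mulr_ge0 => //; apply: mulr_ge0 => //; exact: sqr_ge0.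
by lra.
Qed.

Let sqr_le_1D (x : R) : x ^+ 2 <= (1 + `|x|) ^+ 2 /\ 1 <= (1 + `|x|) ^+ 2.
Proof.
rewrite -[x ^+ 2]real_normK ?num_real//; have := normr_ge0 x; rewrite !expr2.
by move=> h; split; nra.
Qed.

Section Dilated.
Variables (d : R) (g : R -> R).
Hypothesis d01 : 0 < d <= 2^-1.
Hypothesis eg : etype 1 1 g.
Hypothesis g0 : g 0 = 1.
Hypothesis g1 : forall x, `|g x| <= 1.
Hypothesis rg : rapid g.
Let l : R := 1 - d.
Let e : R := tau / 4 * d.
(** Squaring [g] keeps the kernel nonnegative. One factor [g] supplies the decay, the other is
    merely bounded by 1. *)
Let kern x := P (l * x) * g (e * x) ^+ 2.
Let Theta x := ((x - alpha) ^+ 2 - m ^+ 2) * kern x.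
Let phi x := 2^-1 * (Theta x + Theta (- x)).

Let e0 : 0 < e. Proof. by case/andP: d01 => d0 _; rewrite mulr_gt0// divr_gt0. Qed.
Let l0 : 0 < l. Proof. by case/andP: d01 => _ d1; rewrite /l; lra. Qed.
Let ckern : continuous kern.
Proof.
apply: continuous_mul; first exact: continuous_dilate.
by apply: continuous_sqr; apply: continuous_dilate; exact: etype_continuous eg.
Qed.

Let rapid_kern (h : R -> R) (K : R) : (forall x, `|h x| <= K * (1 + `|x|) ^+ 2) ->
  rapid (fun x => h x * kern x).
Proof.
move=> hK; have [C HC] := sqmod_growth tau0 HF.
have C0 : 0 <= C by have := HC 0; rewrite normr0 addr0 mulr1; exact: le_trans.
have -> : (fun x => h x * kern x) = (fun x => h x * (P (l * x) * g (e * x)) * g (e * x)).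
  by apply/funext => x; rewrite /kern expr2; ring.
apply: (@rapid_poly_mul _ _ _ 3 (K * C)); last exact: rapid_scale.
move=> x; rewrite normrM [leRHS](_ : _ = K * (1 + `|x|) ^+ 2 * (C * (1 + `|x|) * 1)); last by ring.
apply: ler_pM => //; rewrite normrM (ger0_norm (P0 _)); apply: ler_pM => //.
apply: le_trans (HC _) _; rewrite ler_wpM2l// lerD2l normrM (gtr0_norm l0) ler_piMl//.
by rewrite /l; case/andP: d01 => dd _; lra.
Qed.

Let shift_bound x : `|(x - alpha) ^+ 2| <= (2 + 2 * alpha ^+ 2) * (1 + `|x|) ^+ 2.
Proof.
rewrite ger0_norm ?sqr_ge0//; have := sqr_shift_le x; have [h1 h2] := sqr_le_1D x.
by have := ler_wpM2l (sqr_ge0 alpha) h2; lra.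
Qed.

Let poly_bound x : `|(x - alpha) ^+ 2 - m ^+ 2| <=
  (2 + 2 * alpha ^+ 2 + m ^+ 2) * (1 + `|x|) ^+ 2.
Proof.
apply: le_trans (ler_normB _ _) _; have := shift_bound x.
rewrite [`|m ^+ 2|]ger0_norm ?sqr_ge0//; have [_ h2] := sqr_le_1D x.
by have := ler_wpM2l (sqr_ge0 m) h2; lra.
Qed.

Let cTheta : continuous Theta.
Proof.
apply: continuous_mul => // x; apply: cvgB; [exact: cshift|exact: cvg_cst].
Qed.

Let rTheta : rapid Theta.
Proof. exact: rapid_kern poly_bound. Qed.

Let rapidW f : rapid f -> rapid (fun x => f x * W x).
Proof.
move=> rf; under eq_fun do rewrite mulrC.
by apply: (@rapid_poly_mul _ _ _ 0 2) => // x; rewrite expr0 mulr1 ger0_norm.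
Qed.

Let etype_Theta : exists r A : R, [/\ 0 < r, r < 2 * pi * Delta & etype r A Theta].
Proof.
case/andP: d01 => d0 d12.
(* Type budget: 2 rho (1 - d) for [P], tau d / 2 for the two factors [g], tau d / 4 for the
   polynomial. The sum is 2 tau - tau d (3/4 + d/2), below 2 pi Delta. *)
pose eta := tau * d / 8; pose rho := tau * (1 + d / 4).
have td : 0 < tau * d by rewrite mulr_gt0.
have eta0 : 0 < eta by rewrite divr_gt0.
have trho : tau < rho by rewrite /rho mulrDr mulr1 ltrDl mulrA divr_gt0.
have [A eA] := etype_sqmod tau0 HF trho.
have s1 := etypeD (etype_id eta0) (etype_cst (- alpha) (ltW eta0)).
have s2 := etypeM (ltW eta0) (ltW eta0) s1 s1.
have s3 := etypeD s2 (etype_cst (- m ^+ 2) (addr_ge0 (ltW eta0) (ltW eta0))).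
have g2 := etype_scale e eg.
have ne : 0 <= `|e| * 1 by rewrite mulr1.
have g3 := etypeM ne ne g2 g2.
have k1 := etype_scale l eA.
have rr : 0 <= rho + rho by have t0 := tau0; lra.
have k2 := etypeM (mulr_ge0 (normr_ge0 l) rr) (addr_ge0 ne ne) k1 g3.
have T := etypeM (addr_ge0 (ltW eta0) (ltW eta0))
  (addr_ge0 (mulr_ge0 (normr_ge0 l) rr) (addr_ge0 ne ne)) s3 k2.
do 2 eexists; split; last exact: T.
  by rewrite ltr_wpDr ?addr_gt0// addr_ge0 ?addr_ge0// mulr_ge0.
rewrite (gtr0_norm l0) (gtr0_norm e0) -(mulrA 2) -/tau /eta /rho /l /e.
rewrite [ltLHS](_ : _ = 2 * tau - tau * d * (3 / 4 + d / 2)); last by field.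
rewrite ltrBlDr ltrDl mulr_gt0//; lra.
Qed.

Let etype_phi : exists r A : R, [/\ 0 < r, r < 2 * pi * Delta & etype r A phi].
Proof.
have [r [A [r0 rD eT]]] := etype_Theta.
exists r, (`|2^-1| * (A + A)); split => //.
apply: etypeZ; apply: etypeD => //.
have := etype_scale (-1) eT; rewrite normrN1 mul1r.
by under [in X in X -> _]eq_fun do rewrite mulN1r.
Qed.

Let rphi : rapid phi.
Proof.
apply: (@rapid_poly_mul _ _ (fun=> 2^-1) 0 2^-1) => [x|].
  by rewrite expr0 mulr1 ger0_norm.
by apply: rapidD => //; exact: rapid_reflect.
Qed.

Let phiN x : phi (- x) = phi x.
Proof. by rewrite /phi opprK addrC. Qed.

Let phi_ge0 x : m < `|x - alpha| -> m < `|x + alpha| -> 0 <= phi x.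
Proof.
have mm y : m < `|y| -> 0 <= y ^+ 2 - m ^+ 2.
  move=> my; rewrite subr_ge0 -[y ^+ 2]real_normK ?num_real//.
  by rewrite ler_pXn2r ?nnegrE// ltW.
have k0 y : 0 <= kern y by apply: mulr_ge0 => //; exact: sqr_ge0.
move=> h1 h2; rewrite mulr_ge0// addr_ge0// mulr_ge0// mm//.
by rewrite -opprD normrN.
Qed.

(** The density is even, so the even part integrates like [Theta]. Both dilations fix 0 and g 0 = 1,
    hence the atom term does not depend on [d]. The factor 1 in the second integral gives it the
    shape treated by [integral_dilate_cvg]. *)
Let integralW_phi : integralW G phi =
  (fine (\int[mu]_x ((x - alpha) ^+ 2 * kern x * W x)%:E)
   - m ^+ 2 * fine (\int[mu]_x (1 * kern x * W x)%:E)
   + W_atom R G * ((alpha ^+ 2 - m ^+ 2) * P 0))%:E.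
Proof.
have c1 : continuous (fun x => (x - alpha) ^+ 2 * kern x * W x).
  by apply: continuous_mul => //; exact: continuous_mul.
have c0 : continuous (fun x => 1 * kern x * W x).
  by apply: continuous_mul => //; apply: continuous_mul => // x; exact: cvg_cst.
have r1 : rapid (fun x => (x - alpha) ^+ 2 * kern x * W x).
  by apply: rapidW; exact: rapid_kern shift_bound.
have r0 : rapid (fun x => 1 * kern x * W x).
  apply: rapidW; apply: (@rapid_kern (fun=> 1) 1) => x.
  by rewrite normr1 mul1r; case: (sqr_le_1D x).
have cTW : continuous (fun x => Theta x * W x) by exact: continuous_mul.
have rTW := rapidW rTheta.
rewrite /integralW EFinD; congr (_ + _)%E; last first.
  by rewrite /phi oppr0 /Theta /kern !mulr0 g0 expr1n mulr1 sub0r sqrrN; congr (_ %:E); lra.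
have E : (fun x => phi x * W x) =
    (fun x => 2^-1 * (Theta x * W x + Theta (- x) * W (- x))).
  by apply/funext => x; rewrite /phi W_acN; ring.
have cphi : continuous (fun x => phi x * W x).
  by apply: continuous_mul => //; have [r [A [_ _ /etype_continuous]]] := etype_phi.
have fin := integrable_fin_num measurableT (rapid_integrable cphi (rapidW rphi)).
rewrite -(fineK fin); congr (_ %:E).
rewrite -[LHS]/(\int[mu]_x (phi x * W x)) E (Rintegral_even_part cTW rTW).
have i0 := rapid_integrable c0 r0; have i1 := rapid_integrable c1 r1.
rewrite -[X in _ = X - _]/(\int[mu]_x ((x - alpha) ^+ 2 * kern x * W x)).
rewrite -[X in _ = _ - _ * X]/(\int[mu]_x (1 * kern x * W x)).
rewrite -(RintegralZl (m ^+ 2) measurableT i0) -RintegralB//.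
  by apply: eq_Rintegral => x _; rewrite /Theta; ring.
rewrite (_ : EFin \o _ = fun x => ((m ^+ 2)%:E * (EFin \o (fun x => 1 * kern x * W x)%R) x)%E).
  exact: integrableZl.
by apply/funext => x /=; rewrite EFinM.
Qed.

Lemma dilated_test_function : exists phi : R -> R, [/\ schwartz phi,
  forall x, phi (- x) = phi x, fourier_supp phi `<=` [set` `]- Delta, Delta[],
  forall x, m < `|x - alpha| -> m < `|x + alpha| -> 0 <= phi x &
  integralW G phi =
  (fine (\int[mu]_x ((x - alpha) ^+ 2 * (P ((1 - d) * x) * g (tau / 4 * d * x) ^+ 2) * W x)%:E)
   - m ^+ 2 * fine (\int[mu]_x (1 * (P ((1 - d) * x) * g (tau / 4 * d * x) ^+ 2) * W x)%:E)
   + W_atom R G * ((alpha ^+ 2 - m ^+ 2) * P 0))%:E].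
Proof.
have [r [A [r0 rD ep]]] := etype_phi.
exists phi; split.
- exact: etype_rapid_schwartz r0 ep rphi.
- exact: phiN.
- exact: fourier_supp_etype r0 rD ep rphi phiN.
- exact: phi_ge0.
- exact: integralW_phi.
Qed.

End Dilated.

Let deltas n : R := 2^-1 * harmonic n.

Let deltas01 n : 0 < deltas n <= 2^-1.
Proof.
have h : 0 < harmonic n :> R by rewrite /harmonic /= invr_gt0.
have h1 : harmonic n <= 1 :> R by rewrite /harmonic /= invf_le1// ler1n.
by apply/andP; split; rewrite /deltas; lra.
Qed.

Let cvg_deltas : deltas @ \oo --> (0 : R).
Proof.
by rewrite -(mulr0 2^-1); apply: cvgM; [exact: cvg_cst|exact: cvg_harmonic].
Qed.

Lemma extremal_test_function :
  (integralW G (fun x => (cmod (ofreal (x - alpha) * F (ofreal x)) ^+ 2)%R) /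
   integralW G (fun x => (cmod (F (ofreal x)) ^+ 2)%R) < (m ^+ 2)%:E)%E ->
  exists phi : R -> R, [/\ schwartz phi, forall x, phi (- x) = phi x,
    fourier_supp phi `<=` [set` `]- Delta, Delta[],
    forall x, m < `|x - alpha| -> m < `|x + alpha| -> 0 <= phi x &
    (integralW G phi < 0)%E].
Proof.
have [g [eg g0 g1 rg]] := multiplier_exists R.
have cg : continuous g := etype_continuous eg.
set a := W_atom R G; have a0 : 0 <= a := W_atom_ge0 R G.
have -> : integralW G (fun x => (cmod (F (ofreal x)) ^+ 2)%R) =
    (\int[mu]_x (1 * P x * W x)%:E + (a * P 0)%:E)%E.
  by congr (_ + _)%E; apply: eq_integral => x _; rewrite mul1r.
have -> : integralW G (fun x => (cmod (ofreal (x - alpha) * F (ofreal x)) ^+ 2)%R) =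
    (\int[mu]_x ((x - alpha) ^+ 2 * P x * W x)%:E + (a * (alpha ^+ 2 * P 0))%:E)%E.
  have E x : cmod (ofreal (x - alpha) * F (ofreal x)) ^+ 2 = (x - alpha) ^+ 2 * P x.
    by rewrite cmodM exprMn cmod_ofreal real_normK ?num_real.
  rewrite /integralW E sub0r sqrrN; congr (_ + _)%E.
  by apply: eq_integral => x _; rewrite E.
have PW0 x : 0 <= 1 * P x * W x by rewrite mul1r mulr_ge0.
have iB : mu.-integrable setT (EFin \o (fun x => 1 * P x * W x)).
  apply: (@integrable_dominatedT _ _ (fun x => 2 * P x)).
  - by apply: continuous_mul => //; apply: continuous_mul => // x; exact: cvg_cst.
  - rewrite (_ : EFin \o _ = fun x => (2%:E * (EFin \o P) x)%E).
      by apply: integrableZl => //; exact: integrable_sqmod tau0 HF.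
    by apply/funext => x /=; rewrite EFinM.
  - by move=> x; rewrite ger0_norm// mul1r mulrC; apply: ler_wpM2r.
have finB := integrable_fin_num measurableT iB.
have B0 : (0 < \int[mu]_x (1 * P x * W x)%:E)%E.
  have := integral_sqmodW_gt0 G tau0 HF Fn0.
  by under eq_integral do rewrite -[P _]mul1r.
rewrite -(fineK finB) in B0 *; set b := fine _ in B0 *; rewrite lte_fin in B0.
have den0 : 0 < b + a * P 0 by rewrite ltr_wpDr// mulr_ge0.
rewrite -EFinD inver gt_eqF// lte_pdivrMr// -EFinM => hq.
have N0 : (0 <= \int[mu]_x ((x - alpha) ^+ 2 * P x * W x)%:E)%E.
  apply: integral_ge0 => x _; rewrite lee_fin.
  by apply: mulr_ge0 => //; apply: mulr_ge0 => //; exact: sqr_ge0.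
(* A quotient below a real number excludes an infinite numerator; this yields the integrability of
   x^2 P. *)
have finN : (\int[mu]_x ((x - alpha) ^+ 2 * P x * W x)%:E < +oo)%E.
  by move: hq; case: (\int[mu]_x ((x - alpha) ^+ 2 * P x * W x)%:E)%E => // r _; exact: ltry.
have ix2P := integrable_x2P finN.
have finN' : (\int[mu]_x ((x - alpha) ^+ 2 * P x * W x)%:E)%E \is a fin_num.
  by rewrite ge0_fin_numE.
have iP : mu.-integrable setT (EFin \o P) := integrable_sqmod tau0 HF.
pose l n := 1 - deltas n; pose e n := tau / 4 * deltas n.
have l12 n : 2^-1 <= l n <= 1.
  by have /andP[h1 h2] := deltas01 n; rewrite /l; apply/andP; split; lra.
have cl : l @ \oo --> (1 : R).
  by rewrite -[1 in X in _ --> X]subr0; apply: cvgB => //; exact: cvg_cst.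
have ce : e @ \oo --> (0 : R).
  by rewrite -(mulr0 (tau / 4)); apply: cvgM => //; exact: cvg_cst.
have cst1 : continuous (fun _ : R => 1 : R) by move=> x; exact: cvg_cst.
have b1 x : 0 <= (1 : R) <= 1 + 0 * x ^+ 2 by rewrite mul0r addr0 lexx ler01.
have b2 x : 0 <= (x - alpha) ^+ 2 <= 2 * alpha ^+ 2 + 2 * x ^+ 2.
  by rewrite sqr_ge0 sqr_shift_le.
have two0 : 0 <= 2 :> R by [].
have cv0 := integral_dilate_cvg cP P0 cg g1 g0 cst1 b1 (lexx 0) cW (W_ac_bound G)
  l12 cl ce iP ix2P.
have cv1 := integral_dilate_cvg cP P0 cg g1 g0 cshift b2 two0 cW (W_ac_bound G)
  l12 cl ce iP ix2P.
rewrite -(fineK finB) in cv0; rewrite -(fineK finN') in cv1 hq.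
have {cv0}cv0 := fine_cvg cv0; have {cv1}cv1 := fine_cvg cv1.
rewrite -EFinD lte_fin -/b in hq cv0; set c := fine _ in hq cv1.
have cvT : (fun n =>
    fine (\int[mu]_x ((x - alpha) ^+ 2 * (P (l n * x) * g (e n * x) ^+ 2) * W x)%:E)
    - m ^+ 2 * fine (\int[mu]_x (1 * (P (l n * x) * g (e n * x) ^+ 2) * W x)%:E)
    + a * ((alpha ^+ 2 - m ^+ 2) * P 0)) @ \oo -->
    c - m ^+ 2 * b + a * ((alpha ^+ 2 - m ^+ 2) * P 0).
  apply: cvgD; last exact: cvg_cst.
  by apply: cvgB; [exact: cv1|apply: cvgM; [exact: cvg_cst|exact: cv0]].
(* This is the inequality between quotient and m^2 with denominators cleared and the atom terms
   collected. *)
have neg : c - m ^+ 2 * b + a * ((alpha ^+ 2 - m ^+ 2) * P 0) < 0 by lra.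
have [n _ /(_ n (leqnn n)) Hn] : \forall n \near \oo,
    fine (\int[mu]_x ((x - alpha) ^+ 2 * (P (l n * x) * g (e n * x) ^+ 2) * W x)%:E)
    - m ^+ 2 * fine (\int[mu]_x (1 * (P (l n * x) * g (e n * x) ^+ 2) * W x)%:E)
    + a * ((alpha ^+ 2 - m ^+ 2) * P 0) < 0 by exact: (cvgr_lt _ cvT _ neg).
have [phi [s1 s2 s3 s4 s5]] := dilated_test_function (deltas01 n) eg g0 g1 rg.
by exists phi; split => //; rewrite s5 lte_fin.
Qed.

End TestFunction.

Theorem theorem1 (R : realType) (alpha Delta : R) (F : Lfamily R)
    (o : ordering) (G : symgroup) :
  alpha != 0 ->
  0 < Delta ->
  (forall Q : R, finite_set (subfamily F o Q)) ->
  GRH F ->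
  (forall phi : R -> R,
     schwartz phi ->
     (forall x : R, phi (- x) = phi x) ->
     fourier_supp phi `<=` [set` `]- Delta, Delta[] ->
     zero_average F o phi Q @[Q --> Q_to_infty F o]
       --> integralW G phi) ->
  (limf_esup (min_zero_dist F o alpha) (Q_to_infty F o)
     <= sqrte (extremalA G (pi * Delta) alpha))%E.
Proof.
move=> _ Delta0 _ _ density; rewrite leNgt; apply/negP => lt.
have s0 := sqrte_ge0 (extremalA G (pi * Delta) alpha).
have [m [m0 sm mL]] : exists m : R, [/\ 0 < m,
    (sqrte (extremalA G (pi * Delta) alpha) < m%:E)%E &
    (m%:E < limf_esup (min_zero_dist F o alpha) (Q_to_infty F o))%E].
  move: s0 lt; case: (sqrte _) => [s| |]; last 2 first.
  - by move=> _; rewrite ltNge leey.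
  - by rewrite leNgt ltNy0.
  rewrite lee_fin => s0; case: (limf_esup _ _) => [r| |]; last 2 first.
  - by move=> _; exists (s + 1); rewrite lte_fin ltry; split => //; lra.
  - by rewrite ltNge leNye.
  by rewrite lte_fin => sr; exists ((s + r) / 2); rewrite !lte_fin; split; lra.
have Am : (extremalA G (pi * Delta) alpha < (m ^+ 2)%:E)%E.
  move: sm; case: (extremalA _ _ _) => [r| |]//; rewrite /sqrte ?lte_fin ?ltNyr// => rm.
  (* The root of a nonpositive number is 0 by convention and says nothing about [r]; there the
     positivity of [m] suffices. *)
  have [r0|r0] := leP r 0; first by rewrite (le_lt_trans r0)// exprn_gt0.
  rewrite -[r]sqr_sqrtr ?(ltW r0)// ltr_pXn2r ?nnegrE ?sqrtr_ge0//; exact: ltW.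
have [_ [Fn [HF Fn0] <-] hq] := ereal_inf_lt Am.
have [phi [s1 s2 s3 s4 neg]] := extremal_test_function Delta0 m0 HF Fn0 hq.
have := limf_esup_min_zero_dist_le s4 (density phi s1 s2 s3) neg.
by rewrite leNgt mL.
Qed.
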